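(* Let $d\ge 1$, $p\ge 2$ and $n_1,\ldots,n_d\ge 1$ be integers, and let $P(\mathbf{w})=A+B\sum_{i=1}^d|w_i|^{r_i}$ for $\mathbf w\in\mathbb R^d$, where $A$, $B$ and $r_1,\ldots,r_d$ are non-negative constants. Suppose $g\in C_P^p(\mathbb{R}^d)$. Let $X_{ij}$ ($1\leq i\leq n_j$, $1\leq j\leq d$) be independent real random variables with $\mathbb{E}X_{ij}^k=\mathbb{E}Z^k$ for all $1\leq i\leq n_j$, $1\leq j\leq d$ and all positive integers $k\leq p$, where $Z\sim N(0,1)$. Suppose also that $\mathbb{E}|X_{ij}|^{r_l+p+1}<\infty$ for all $i$, $j$ and $l$. Let $\mathbf W=(W_1,\ldots,W_d)^T$ with $W_j=\frac{1}{\sqrt{n_j}}\sum_{i=1}^{n_j}X_{ij}$, and let $\mathbf Z\sim N(\mathbf 0,I_d)$. Then, for $h\in C_b^p(\mathbb{R})$, \begin{align*} |\mathbb{E}h(g(\mathbf{W}))-\mathbb{E}h(g(\mathbf{Z}))| &\leq\frac{p+1}{p!}h_p\sum_{j=1}^d\sum_{i=1}^{n_j}\frac{1}{n_j^{(p+1)/2}}\bigg[A\mathbb{E}|X_{ij}|^{p+1}+B\sum_{k=1}^d2^{r_k}\bigg(2^{r_k}\mathbb{E}|X_{ij}|^{p+1}\mathbb{E}|W_k|^{r_k} \\ &\quad+\frac{2^{r_k}}{n_k^{r_k/2}}\mathbb{E}|X_{ij}^{p+1}X_{ik}^{r_k}|+\mathbb{E}|Z|^{r_k+1}\mathbb{E}|X_{ij}|^{p+1}\bigg)\bigg],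 \end{align*} where the term containing $X_{ik}$ is omitted whenever $i>n_k$.
   Context: For a function $u$ on $\mathbb R$, $\|u\|$ is its supremum norm (essential supremum for a derivative that exists only almost everywhere). $h\in C_b^n(\mathbb{R})$ means that $h:\mathbb R\to\mathbb R$ is such that $h^{(n-1)}$ exists and is absolutely continuous (locally), and the derivatives $h',\ldots,h^{(n)}$ are bounded; $h$ itself need not be bounded. For $P:\mathbb R^d\to[0,\infty)$, $g\in C_P^n(\mathbb{R}^d)$ means that $g:\mathbb R^d\to\mathbb R$ has all partial derivatives up to order $n$ and $\big|\frac{\partial^k g(\mathbf w)}{\partial w_{i_1}\cdots\partial w_{i_k}}\big|^{n/k}\le P(\mathbf w)$ for all $\mathbf w\in\mathbb R^d$, all $k=1,\ldots,n$ and all indices $i_1,\ldots,i_k$. For $h\in C_b^n(\mathbb R)$, $h_n:=\sum_{k=1}^n{n\brace k}\|h^{(k)}\|$, where ${n\brace k}$ is the Stirling number of the second kind. *)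

(* Defs.v *)
From HB Require Import structures.
From mathcomp Require Import all_boot all_order all_algebra.
From mathcomp Require Import all_classical all_reals all_analysis.
From mathcomp Require Import ess_sup_inf.

Set Implicit Arguments.
Unset Strict Implicit.
Unset Printing Implicit Defensive.

Import Order.TTheory GRing.Theory Num.Theory.
Import numFieldNormedType.Exports.

Local Open Scope classical_set_scope.
Local Open Scope ring_scope.

(* Stirling numbers of the second kind. *)
Fixpoint stirling2 (n k : nat) : nat :=
  match n, k with
  | 0, 0 => 1
  | 0, _.+1 => 0
  | _.+1, 0 => 0
  | n'.+1, k'.+1 => (k'.+1 * stirling2 n' k'.+1 + stirling2 n' k')%N
  end.

(* Absolute continuity on every compact interval [a, b]: the ]s k, t k[ range
   over the finite families of pairwise disjoint subintervals. *)
Definition locally_abs_cont (R : realType) (f : R -> R) : Prop :=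
  forall a b : R, a <= b ->
  forall e : R, 0 < e -> exists2 dlt : R, 0 < dlt &
  forall (m : nat) (s t : 'I_m -> R),
    (forall k, [/\ a <= s k, s k <= t k & t k <= b]) ->
    trivIset [set: 'I_m] (fun k => `]s k, t k[%classic) ->
    \sum_(k < m) (t k - s k) < dlt ->
    \sum_(k < m) `|f (t k) - f (s k)| < e.

Definition sup_norm (R : realType) (f : R -> R) : \bar R :=
  ereal_sup (range (fun x => `|f x|%:E)).

Definition ess_sup_norm (R : realType) (f : R -> R) : \bar R :=
  ess_sup (@lebesgue_measure R) (fun x => `|f x|%:E).

(* The norm of h^(k) for h in C_b^n: h^(n) exists only almost everywhere, so
   its norm is the essential supremum, which ignores the arbitrary value of
   derive1n n h at the points where derive1n n.-1 h is not derivable. *)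
Definition deriv_norm (R : realType) (n : nat) (h : R -> R) (k : nat)
    : \bar R :=
  if (k < n)%N then sup_norm (derive1n k h) else ess_sup_norm (derive1n k h).

(* C_b^n(R), for n >= 1; h itself need not be bounded. *)
Definition C_b (R : realType) (n : nat) (h : R -> R) : Prop :=
  [/\ forall (k : nat) (x : R), (k < n.-1)%N -> derivable (derive1n k h) x 1,
      locally_abs_cont (derive1n n.-1 h) &
      forall k : nat, (0 < k <= n)%N -> (deriv_norm n h k < +oo)%E].

Definition h_norm (R : realType) (n : nat) (h : R -> R) : \bar R :=
  (\sum_(1 <= k < n.+1) (stirling2 n k)%:R%:E * deriv_norm n h k)%E.

Section partial_derivatives.
Context (R : realType) (d : nat).
Implicit Type g : 'rV[R]_d -> R.

Definition basis_vec (i : 'I_d) : 'rV[R]_d := delta_mx 0 i.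

(* iter_partial [:: i_1; ...; i_k] g = d^k g / (d w_{i_1} ... d w_{i_k}),
   with d / d w_{i_k} taken first. *)
Definition iter_partial (s : seq 'I_d) g : 'rV[R]_d -> R :=
  foldr (fun i f => 'D_(basis_vec i) f) g s.

(* C_P^n(R^d); continuity of the partial derivatives is not required. *)
Definition C_P (n : nat) (P : 'rV[R]_d -> R) g : Prop :=
  (forall (s : seq 'I_d) (i : 'I_d) (w : 'rV[R]_d), (size s < n)%N ->
     derivable (iter_partial s g) w (basis_vec i)) /\
  (forall (s : seq 'I_d) (w : 'rV[R]_d), (0 < size s <= n)%N ->
     `|iter_partial s g w| `^ (n%:R / (size s)%:R) <= P w).

(* 0 `^ 0 = 1, so r i = 0 contributes the constant 1. *)
Definition growth (A B : R) (r : 'I_d -> R) (w : 'rV[R]_d) : R :=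
  A + B * \sum_(i < d) `|w 0 i| `^ r i.

End partial_derivatives.

Section random_variables.
Context (dT : measure_display) (T : measurableType dT) (R : realType)
  (Pr : probability T R).

Definition mutually_independent (I : finType) (X : I -> {RV Pr >-> R}) : Prop :=
  forall (J : {set I}) (E : I -> set R),
    (forall i, i \in J -> measurable (E i)) ->
    Pr (\bigcap_(i in [set` J]) (X i @^-1` E i)) =
    (\prod_(i in J) Pr (X i @^-1` E i))%E.

(* The laws are compared on measurable sets only: outside them the values of
   both sides are arbitrary. *)
Definition std_normal (Z : {RV Pr >-> R}) : Prop :=
  forall E : set R, measurable E -> distribution Pr Z E = normal_prob 0 1 E.

(* N(0, I_d), coordinatewise *)
Definition std_normal_vec (d : nat) (Z : 'I_d -> {RV Pr >-> R}) : Prop :=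
  (forall j, std_normal (Z j)) /\ mutually_independent Z.

Definition rand_vec (d : nat) (Y : 'I_d -> {RV Pr >-> R}) (x : T) : 'rV[R]_d :=
  \row_j Y j x.

(* W_j = n_j^(-1/2) * sum_i X_ij; the array is indexed column first, so that
   X j i is X_ij. *)
Definition std_sum (d : nat) (n : 'I_d -> nat)
    (X : forall j : 'I_d, 'I_(n j) -> {RV Pr >-> R}) (x : T) : 'rV[R]_d :=
  \row_j ((Num.sqrt (n j)%:R)^-1 * \sum_(i < n j) X j i x).

Definition flat_array (d : nat) (n : 'I_d -> nat)
    (X : forall j : 'I_d, 'I_(n j) -> {RV Pr >-> R})
    (ji : {j : 'I_d & 'I_(n j)}) : {RV Pr >-> R} :=
  X (tag ji) (tagged ji).

End random_variables.

(* Main.v *)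
(* The coordinates W_j are replaced by the Gaussian coordinates Z_j one at a time;
   the other coordinates being independent of both, this is a comparison of
   E Psi(W_j) with E Psi(Z_j) for a function Psi of one variable, with
   |Psi^(p)(t)| <= alpha + beta |t|^r by Faa di Bruno's formula, once h has been
   mollified into a p times derivable function without increasing its norms.

   In one variable put Phi(t) = E Psi(sin t W + cos t Z).  By Gaussian integration
   by parts Phi'(t) = cos t (E W a(W) - E a'(W)) with a(w) = E Psi'(sin t w + cos t Z),
   and the p-th derivative of a is bounded by (sin t)^p / cos t times
   alpha E|Z| + beta E|Z| |sin t w + cos t Z|^r, through one further integration by
   parts.  Writing W = V + Y with Y a summand and V independent of Y, the Taylor
   polynomials of Y a(V + Y) and of a'(V + Y) around V have expectations that cancel
   in the sum over the summands, because the moments of the summands satisfy the Gaussian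
   recurrence E X^(k+2) = (k+1) E X^k up to order p; the remainders give the factor
   (p+1)/p!.  Integrating (sin t)^p <= (sin t)^2 over [0, pi/2] gives the constant
   pi/4 <= 1.

   The factor 2^r 2^r in front of E|X|^(p+1) E|W|^r comes from
   |sin t w + cos t z|^r and from bounding |V + t Y|^r in terms of W = V + Y: for
   r >= 1 the second step uses convexity and E|V|^r <= E|W|^r, and for r < 1, where
   this fails, V is compared with V + Y' for an independent copy Y' of Y. *)
Require Import Defs.
From HB Require Import structures.
From mathcomp Require Import all_boot all_order all_algebra.
From mathcomp Require Import all_classical all_reals all_analysis.
From mathcomp Require Import ess_sup_inf measurable_realfun.
From mathcomp Require Import ring lra.

Set Implicit Arguments.
Unset Strict Implicit.
Unset Printing Implicit Defensive.

Import Order.TTheory GRing.Theory Num.Theory.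
Import numFieldNormedType.Exports.

Local Open Scope classical_set_scope.
Local Open Scope ring_scope.


(** * Absolute continuity *)

(** The bound involves absolute moments of order p+1, so the Taylor expansion of a must reach its
    p-th derivative, formally an average of Psi^(p+1), whereas h and g supply p derivatives.
    Averaging over cos t Z makes up for the missing one: integration by parts trades it for a factor
    Z / cos t, and the singularity at t = pi/2 cancels against the factor cos t of Phi'(t).

    The constant (p+1)/p! is 1/p! + 1/(p-1)!, from the remainders of Y a(V + Y) and of E Y^2 a'(V +
    Y). The second takes the shape of the first because E Y^2 E[|Y|^(p-1) B(|Y|)] <=
    E[|Y|^(p+1) B(|Y|)] for nondecreasing B.

    The factor Z leaves E|Z| in front of the growth due to the other coordinates. It is kept there:
    where such a coordinate is already Gaussian, E|Z| E|Z|^r <= E|Z|^(r+1) produces the Gaussian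
    moment of the statement.

    Top derivatives may be discontinuous, so Taylor's formula rests on the mean value theorem, and
    measurability of h(g(W)) on continuity in each coordinate. Independence is used as an equality
    of laws with a product space, so that iterated integrals replace conditional expectations. *)

Definition nonoverlapping (R : realType) (l : seq (R * R)) : bool :=
  all (fun u => u.1 <= u.2) l &&
  pairwise (fun u v => (u.2 <= v.1) || (v.2 <= u.1)) l.

(** Global, and with lists in place of indexed families, so that an interval can be exchanged for a
    partition of it. The intervals may touch or be degenerate. *)
Definition abs_cont (R : realType) (f : R -> R) : Prop :=
  forall e : R, 0 < e -> exists2 dlt : R, 0 < dlt &
  forall l : seq (R * R), nonoverlapping l ->
    \sum_(u <- l) (u.2 - u.1) < dlt ->
    \sum_(u <- l) `|f u.2 - f u.1| <= e.

Definition clamp (R : realType) (a b x : R) : R := Num.max a (Num.min b x).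

Section abs_cont_lipschitz.
Context {R : realType}.
Implicit Types (f : R -> R) (a b c x y e : R) (l : seq (R * R)).

Lemma clamp_itv a b x : a <= b -> a <= clamp a b x <= b.
Proof. by move=> ab; rewrite /clamp le_max lexx /= ge_max ab ge_min lexx. Qed.

Lemma clamp_id a b x : a <= x <= b -> clamp a b x = x.
Proof. by move=> /andP[ax xb]; rewrite /clamp min_r // max_r. Qed.

Lemma clamp_le a b x y : x <= y -> clamp a b x <= clamp a b y.
Proof.
move=> xy; rewrite /clamp; apply: le_max2 => //; apply: le_min2 => //.
Qed.

Lemma clamp_sub a b x y : x <= y -> clamp a b y - clamp a b x <= y - x.
Proof. rewrite /clamp /Num.max /Num.min; do !case: ifPn; lra. Qed.

(** Clamping shortens intervals and keeps them disjoint; the composite is constant outside [a, b],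
    hence absolutely continuous on the whole line. *)
Lemma clamp_abs_cont f a b : a <= b -> locally_abs_cont f ->
  abs_cont (f \o clamp a b).
Proof.
move=> ab acf e e0; have [d d0 hd] := acf a b ab e e0; exists d => //.
move=> l /andP[/allP le_l dl] ltd.
have nthP (k : 'I_(size l)) : nth (0, 0) l k \in l by exact: mem_nth.
have := hd (size l) (fun k => clamp a b (nth (0, 0) l k).1)
  (fun k => clamp a b (nth (0, 0) l k).2).
rewrite (big_nth (0, 0)) big_mkord => H; apply/ltW; apply: H.
- move=> k; have := le_l _ (nthP k) => kk; split.
  + by case/andP: (clamp_itv (nth (0, 0) l k).1 ab).
  + exact: clamp_le.
  + by case/andP: (clamp_itv (nth (0, 0) l k).2 ab).
- have wlg i j : (i < j < size l)%N ->
    forall z, clamp a b (nth (0, 0) l i).1 < z < clamp a b (nth (0, 0) l i).2 ->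
      clamp a b (nth (0, 0) l j).1 < z < clamp a b (nth (0, 0) l j).2 -> False.
    move=> /andP[ij js] z /andP[z1 z2] /andP[z3 z4].
    have /(pairwiseP (0, 0)) /(_ i j) := dl.
    rewrite !inE => /(_ (ltn_trans ij js) js ij) /orP[] /(clamp_le a b) h.
      by have := lt_trans (lt_le_trans z2 h) z3; rewrite ltxx.
    by have := lt_trans (lt_le_trans z4 h) z1; rewrite ltxx.
  apply/trivIsetP => i j _ _ ij; rewrite -subset0 => z [] /=.
  rewrite !in_itv /= => zi zj.
  have : (i : nat) != j by [].
  rewrite neq_ltn => /orP[] lt.
    by apply: (wlg i j _ z) => //; rewrite lt ltn_ord.
  by apply: (wlg j i _ z) => //; rewrite lt ltn_ord.
- apply: le_lt_trans ltd; rewrite (big_nth (0, 0)) big_mkord.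
  by apply: ler_sum => i _; apply: clamp_sub; exact: le_l.
Qed.

Lemma partition_nonoverlapping c d s : itv_partition c d s ->
  [/\ nonoverlapping (zip (c :: s) s),
      all (fun u => c <= u.1) (zip (c :: s) s),
      all (fun u => u.2 <= d) (zip (c :: s) s) &
      \sum_(u <- zip (c :: s) s) (u.2 - u.1) = d - c].
Proof.
elim: s c => [|x s ih] c /=.
  by move=> /itv_partition_nil ->; rewrite big_nil subrr; split.
move=> cs; have [] := cs => /= /andP[cx xs] _.
have xsd := itv_partition_cons cs; have [h1 h2 h3 h4] := ih _ xsd.
split.
- case/andP: h1 => h1 h1'; rewrite /nonoverlapping /= (ltW cx) h1 h1' /=.
  by rewrite ?andbT; apply/allP => u /(allP h2) /= ->.
- by rewrite lexx /=; apply/allP => u /(allP h2) /=; apply: le_trans; exact: ltW.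
- by rewrite h3 andbT; exact: itv_partition_le xsd.
- by rewrite big_cons h4 /= addrC addrA subrK.
Qed.

Lemma variation_zip_pairs f c d s : itv_partition c d s ->
  variation c d f s = \sum_(u <- zip (c :: s) s) `|f u.2 - f u.1|.
Proof.
move=> cd; rewrite variation_zip //.
move: s c {cd}; elim => [|x s ih] c /=; first by rewrite !big_nil.
by rewrite !big_cons /= ih.
Qed.

(** On an interval shorter than the [d] belonging to e = 1 the variation is at most 1, and finitely
    many such intervals cover [a, b]. *)
Lemma abs_cont_bounded_variation f a b : abs_cont f -> a <= b ->
  bounded_variation a b f.
Proof.
move=> acf ab; have [d d0 hd] := acf 1 ltr01.
have small x y : x <= y -> y - x < d -> total_variation x y f \is a fin_num.
  move=> xy yxd; apply/bounded_variationP => //; exists 1 => _ [s xys <-].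
  have [h1 _ _ h4] := partition_nonoverlapping xys.
  by rewrite (variation_zip_pairs f xys); apply: hd => //; rewrite h4.
have step k : total_variation a (a + k%:R * (d / 2)) f \is a fin_num.
  elim: k => [|k ih]; first by rewrite mul0r addr0 total_variationxx.
  have h0 : 0 <= k%:R * (d / 2) by rewrite mulr_ge0 // divr_ge0 // ltW.
  rewrite (@total_variationD _ a _ (a + k%:R * (d / 2))).
  - rewrite fin_numD ih /=; apply: small; rewrite -[k.+1%:R]natr1; lra.
  - lra.
  - rewrite -[k.+1%:R]natr1; lra.
pose k := (Num.truncn ((b - a) / (d / 2))).+1.
have bk : b <= a + k%:R * (d / 2).
  rewrite -lerBlDl -ler_pdivrMr; last lra.
  exact/ltW/truncnS_gt.
apply: (bounded_variationl ab bk).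
apply/bounded_variationP; last exact: step.
exact: le_trans ab bk.
Qed.

(** Replacing an interval by any partition of it leaves the total length unchanged, so the same [d]
    serves; the supremum over partitions is then taken one interval at a time. *)
Lemma abs_cont_total_variation f e : abs_cont f -> 0 < e ->
  exists2 d, 0 < d & forall l, nonoverlapping l ->
    \sum_(u <- l) (u.2 - u.1) < d ->
    \sum_(u <- l) fine (total_variation u.1 u.2 f) <= e.
Proof.
move=> acf e0; have [d d0 hd] := acf e e0; exists d => // l nl ld.
(* [l0] collects the intervals already replaced by partitions, [l] those still measured by their
   total variation. *)
suff H : forall l0, nonoverlapping (l0 ++ l) ->
    \sum_(u <- l0 ++ l) (u.2 - u.1) < d ->
    \sum_(u <- l0) `|f u.2 - f u.1| +
    \sum_(u <- l) fine (total_variation u.1 u.2 f) <= e.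
  by have := H [::] nl ld; rewrite big_nil add0r.
elim: l {nl ld} => [|[x y] l ih] l0.
  by rewrite cats0 big_nil addr0; exact: hd.
move=> nl ld.
have xy : x <= y.
  by case/andP: nl => /allP /(_ (x, y)) /= h _; apply: h; rewrite mem_cat inE eqxx orbT.
rewrite big_cons /= addrCA -lerBrDr.
have [->|nxy] := eqVneq x y.
  rewrite total_variationxx /= subr_ge0; apply: ih.
    move: nl; rewrite /nonoverlapping !all_cat !pairwise_cat /=.
    rewrite allrel_consr.
    by move=> /andP[/andP[-> /andP[_ ->]]] /andP[/andP[_ ->]] /andP[-> /andP[_ ->]].
  apply: le_lt_trans ld; rewrite !big_cat big_cons /= lerD2l lerDr subr_ge0 //.
have {}nxy : x < y by rewrite lt_neqAle nxy.
have bv : bounded_variation x y f by exact: abs_cont_bounded_variation.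
rewrite -lee_fin fineK; last exact/bounded_variationP.
apply: ge_ereal_sup => _ /= [_ [s xys <-] <-]; rewrite lee_fin.
have [h1 h2 h3 h4] := partition_nonoverlapping xys.
rewrite (variation_zip_pairs f xys) lerBrDr addrA -big_cat /=.
apply: ih.
- move: nl h1; rewrite /nonoverlapping !all_cat !pairwise_cat /=.
  rewrite allrel_consr.
  move=> /andP[/andP[a1 /andP[a2 a3]]] /andP[/andP[a4 a5]] /andP[a6 /andP[a7 a8]].
  move=> /andP[b1 b2]; rewrite b1 a1 a3 b2 a6 a8 /= allrel_catl a5 /= !andbT.
  have hl (u : R * R) : u \in zip (x :: s) s -> x <= u.1 /\ u.2 <= y.
    by move=> us; split; [exact: (allP h2)|exact: (allP h3)].
  apply/andP; split; apply/allrelP => u v us vl; have [xu uy] := hl _ us.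
    have /= := allP a7 _ vl => /orP[] h.
      by rewrite (le_trans uy h).
    by rewrite (le_trans h xu) orbT.
  have /= := allP a4 _ vl => /orP[] h.
    by rewrite (le_trans h xu) orbT.
  by rewrite (le_trans uy h).
- apply: le_lt_trans ld.
  rewrite !big_cat /= big_cons /= h4; lra.
Qed.

End abs_cont_lipschitz.

(** * Densities of absolutely continuous monotone functions *)

Section density.
Context {R : realType}.
Implicit Types (f F : R -> R) (a b c x y e : R) (l : seq (R * R)).
Local Notation mu := (@lebesgue_measure R).

(** Finite measure bounds the distances between points of I, so its infimum and supremum are real
    endpoints. *)
Lemma open_interval_oo (I : set R) : open I -> is_interval I ->
  (mu I < +oo)%E -> exists u : R * R, u.1 <= u.2 /\ I = `]u.1, u.2[%classic.
Proof.
move=> oI iI fI; have mI : measurable I by exact: open_measurable.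
have [I0|/set0P[z Iz]] := eqVneq I set0.
  by exists (0, 0); rewrite lexx I0 set_itvoo0.
have sub u v : I u -> I v -> `]u, v[%classic `<=` I.
  move=> Iu Iv w /=; rewrite in_itv /= => /andP[uw wv].
  by apply: (iI u v) => //; rewrite !ltW.
have bd u v : I u -> I v -> u <= v -> v - u <= fine (mu I).
  move=> Iu Iv uv; rewrite -lee_fin fineK; last by rewrite ge0_fin_numE.
  apply: (@le_trans _ _ (mu `]u, v[%classic)).
    rewrite lebesgue_measure_itv /= lte_fin; case: ltP => // vu.
    by rewrite lee_fin; lra.
  by apply: le_measure; rewrite ?inE //; exact: sub.
have I0 : I !=set0 by exists z.
have m0 : 0 <= fine (mu I) by rewrite fine_ge0.
have hu : has_ubound I.
  exists (z + fine (mu I)) => v Iv; have [zv|vz] := leP z v; last lra.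
  have := bd _ _ Iz Iv zv; lra.
have hl : has_lbound I.
  exists (z - fine (mu I)) => v Iv; have [zv|vz] := leP v z; last lra.
  have := bd _ _ Iv Iz zv; lra.
exists (inf I, sup I) => /=; split.
  by apply: (@le_trans _ _ z); [exact: ge_inf|exact: ub_le_sup].
have nbhsI v : I v -> exists2 e, 0 < e & forall w, `|v - w| < e -> I w.
  move=> Iv; have /nbhs_ballP[e /= e0 he] := oI v Iv.
  by exists e => // w vw; apply: he; rewrite /ball /=.
apply/seteqP; split=> [v Iv|v] /=; rewrite in_itv /=.
  have [e e0 he] := nbhsI v Iv.
  have h1 : I (v - e / 2) by apply: he; rewrite opprB addrC subrK gtr0_norm; lra.
  have h2 : I (v + e / 2).
    by apply: he; rewrite opprD addrA subrr add0r normrN gtr0_norm; lra.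
  have := ge_inf hl h1; have := ub_le_sup hu h2 => ? ?; apply/andP; split; lra.
move=> /andP[/inf_lt-/(_ I0)[u Iu uv] /sup_gt-/(_ I0)[w Iw vw]].
by apply: (sub u w) => //=; rewrite in_itv /= uv vw.
Qed.

Lemma lebesgue_stieltjes_measure_oc (F : cumulative R R) x y : x <= y ->
  lebesgue_stieltjes_measure F `]x, y]%classic = (F y - F x)%:E.
Proof.
move=> xy; rewrite /lebesgue_stieltjes_measure/measure_extension.
by rewrite measurable_mu_extE/=; [rewrite wlength_itv_bnd|exact: is_ocitv].
Qed.

(** A null set is covered by an open set of measure below the [d] of absolute continuity, and F
    increases by at most e along any finitely many components of that open set. *)
Lemma abs_cont_null_dominates (F : cumulative R R) : abs_cont F ->
  lebesgue_stieltjes_measure F `<< mu.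
Proof.
move=> acF; apply/null_content_dominatesP => N mN N0.
apply/eqP; rewrite eq_le measure_ge0 andbT; apply/lee_addgt0Pr => e e0.
rewrite add0e; have [d d0 hd] := acF e e0.
have Noo : (mu N < +oo)%E by rewrite [X in (X < _)%E]N0 ltry.
have [U [oU NU UNd]] := lebesgue_regularity_outer mN Noo d0.
have mU : measurable U by exact: open_measurable.
have Ud : (mu U < d%:E)%E.
  rewrite -(setDUK NU) measureU //; last 2 first.
  - exact: measurableD.
  - by rewrite setDE setICA setICr setI0.
  by rewrite [X in (X + _)%E]N0 add0e.
apply: (@le_trans _ _ (lebesgue_stieltjes_measure F U)).
  by apply: le_measure; rewrite ?inE.
have := @open_disjoint_itv_bigcup _ U oU.
have := @open_disjoint_itv_trivIset _ U oU.
have := @open_disjoint_itv_is_interval _ U oU.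
have := @open_disjoint_itv_open _ U oU.
move: (open_disjoint_itv oU) => I oI iI tI UI.
have mI n : measurable (I n) by exact: open_measurable.
have IU n : I n `<=` U by rewrite UI; exact: bigcup_sup.
have fI n : (mu (I n) < +oo)%E.
  apply: (@le_lt_trans _ _ (mu U)); last exact: lt_trans Ud (ltry d).
  apply: le_measure; rewrite ?inE; [exact: mI|exact: mU|exact: IU].
have /choice[u hu] := fun n => open_interval_oo (oI n) (iI n) (fI n).
rewrite UI measure_bigcup //=; last by move=> *; exact: mI.
apply: lime_le; first exact: is_cvg_nneseries.
apply: nearW => n; rewrite (eq_bigl xpredT); last by move=> i; rewrite in_setT.
(* Empty components are left out: their degenerate endpoints could lie inside another component. *)
pose l := [seq u q | q <- index_iota 0 n & (u q).1 < (u q).2].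
apply: (@le_trans _ _ (\sum_(v <- l) (F v.2 - F v.1))%:E).
  rewrite /l big_map big_filter [leLHS](bigID (fun q => (u q).1 < (u q).2)) /=.
  rewrite [X in (_ + X)%E]big1 ?adde0; last first.
    move=> q; rewrite -leNgt => uq.
    by rewrite (hu q).2 set_itv_ge ?measure0 // bnd_simp -leNgt.
  rewrite -sumEFin; apply: lee_sum => q uq; rewrite -lebesgue_stieltjes_measure_oc; last exact: ltW.
  rewrite (hu q).2; apply: le_measure; rewrite ?inE //.
  by apply: subset_itvl; rewrite bnd_simp.
rewrite lee_fin.
have nl : nonoverlapping l.
  apply/andP; split.
    by apply/allP => v /mapP[q]; rewrite mem_filter => /andP[uq _ ->]; exact: ltW.
  rewrite /l pairwise_map.
  apply: (@sub_in_pairwise _ [pred q | (u q).1 < (u q).2] (fun i j => i != j)).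
  - move=> i j /= ui uj ij.
    have /trivIsetP/(_ i j Logic.I Logic.I ij) := tI.
    rewrite (hu i).2 (hu j).2 -subset0 => h.
    rewrite -[_ || _]negbK negb_or -!ltNge; apply/negP => /andP[h1 h2].
    (* The midpoint of the overlap would belong to two disjoint components. *)
    pose z := (Num.max (u i).1 (u j).1 + Num.min (u i).2 (u j).2) / 2.
    have := h z; apply.
    rewrite /= !in_itv /= /z /Num.max /Num.min; move: ui uj; rewrite !inE; do !case: ifPn; lra.
  - exact: filter_all.
  - by have := filter_uniq (fun q => (u q).1 < (u q).2) (iota_uniq 0 (n - 0)); rewrite uniq_pairwise.
apply: le_trans (hd l nl _).
  by apply: ler_sum => v _; exact: ler_norm.
rewrite -lte_fin; apply: le_lt_trans Ud.
rewrite UI measure_bigcup //=; last by move=> *; exact: mI.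
apply: (@le_trans _ _ (\sum_(0 <= i < n | i \in setT) mu (I i))%E); last first.
  exact: nneseries_lim_ge.
rewrite [leRHS](eq_bigl xpredT); last by move=> i; rewrite ?in_setT.
rewrite /l big_map big_filter [leRHS](bigID (fun q => (u q).1 < (u q).2)) /=.
rewrite -[leLHS]adde0 -sumEFin; apply: leeD; last exact: sume_ge0.
apply: lee_sum => q uq; rewrite (hu q).2 lebesgue_measure_itv /= lte_fin uq.
by rewrite EFinB.
Qed.

End density.

Section lipschitz.
Context {R : realType}.
Implicit Types (f F : R -> R) (a b c x y e : R) (l : seq (R * R)).
Local Notation mu := (@lebesgue_measure R).

Lemma abs_cont_continuous F : abs_cont F -> continuous F.
Proof.
move=> acF x; apply/cvgrPdist_le => e e0; have [d d0 hd] := acF e e0.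
near=> y.
have xyd : `|x - y| < d by near: y; exact: cvgr_dist_lt.
have [xy|yx] := leP x y.
  have := hd [:: (x, y)]; rewrite /nonoverlapping /= xy !big_seq1 /= => /(_ isT).
  by rewrite distrC; apply; apply: le_lt_trans xyd; rewrite distrC ler_norm.
have := hd [:: (y, x)]; rewrite /nonoverlapping /= ltW // !big_seq1 /= => /(_ isT).
by apply; apply: le_lt_trans xyd; rewrite ler_norm.
Unshelve. all: by end_near. Qed.

(** The density is the Radon-Nikodym derivative of the Stieltjes measure of F restricted to ]a,
    b]. *)
Lemma nondecreasing_abs_cont_density F a b : {homo F : x y / x <= y} ->
  abs_cont F -> a <= b ->
  exists phi : R -> R, mu.-integrable setT (EFin \o phi) /\
    forall x, a <= x <= b -> F x - F a = (\int[mu]_(t in `]a, x]) phi t)%R.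
Proof.
move=> ndF acF ab.
have rcF := right_continuousW (abs_cont_continuous acF).
pose G : cumulative R R := HB.pack F (isCumulative.Build R _ R F ndF rcF).
have mD : measurable (`]a, b]%classic : set (measurableTypeR R)).
  exact: measurable_itv.
have fD : (lebesgue_stieltjes_measure G `]a, b]%classic < +oo)%E.
  by rewrite lebesgue_stieltjes_measure_oc // ltry.
have dom : mfrestr mD fD `<< mu.
  apply/null_content_dominatesP => N mN N0.
  have h : lebesgue_stieltjes_measure G N = 0%E.
    by have /null_content_dominatesP := @abs_cont_null_dominates R G acF; apply.
  apply/eqP; rewrite -measure_le0 -h /mfrestr /mrestr.
  by apply: measureIl.
have [f [f0 ffin fint fE]] := radon_nikodym_sigma_finite dom.
exists (fine \o f); split.
  apply: eq_integrable fint => // x _ /=; by rewrite fineK.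
move=> x /andP[ax xb].
have mx : measurable (`]a, x]%classic : set (measurableTypeR R)).
  exact: measurable_itv.
have := fE _ mx.
rewrite /= /mfrestr /mrestr setIidl; last first.
  by apply: subset_itvl; rewrite bnd_simp.
rewrite lebesgue_stieltjes_measure_oc // => h.
rewrite /Rintegral; under eq_integral do rewrite /= fineK //.
by rewrite -h.
Qed.

(** Jordan decomposition: f is the difference of its variation function T and of N = T - f, both
    nondecreasing and absolutely continuous. *)
Lemma abs_cont_density f a b : a <= b -> locally_abs_cont f ->
  exists phi : R -> R, mu.-integrable setT (EFin \o phi) /\
    forall x, a <= x <= b -> f x - f a = (\int[mu]_(t in `]a, x]) phi t)%R.
Proof.
move=> ab /(clamp_abs_cont ab) acg.
pose g := f \o clamp a b; rewrite -/g in acg.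
pose T x := fine (total_variation a (clamp a b x) g).
have ca x : a <= clamp a b x by case/andP: (clamp_itv x ab).
have tvfin x y : x <= y -> total_variation x y g \is a fin_num.
  by move=> xy; apply/bounded_variationP => //; exact: abs_cont_bounded_variation.
have TD x y : x <= y ->
    T y - T x = fine (total_variation (clamp a b x) (clamp a b y) g).
  move=> xy; have cxy := clamp_le a b xy.
  rewrite /T (@total_variationD _ a (clamp a b y) (clamp a b x)) //.
  by rewrite fineD ?tvfin // addrC addKr.
have gclamp x : g (clamp a b x) = g x.
  by rewrite /g /= (@clamp_id _ a b (clamp a b x)) // clamp_itv.
have gT x y : x <= y -> `|g y - g x| <= T y - T x.
  move=> xy; rewrite TD // -(gclamp x) -(gclamp y) -lee_fin fineK; last first.
    by rewrite tvfin // clamp_le.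
  by apply: total_variation_ge; exact: clamp_le.
have acT : abs_cont T.
  move=> e e0; have [d d0 hd] := abs_cont_total_variation acg e0.
  exists d => // l nl ld.
  pose l' := [seq (clamp a b u.1, clamp a b u.2) | u <- l].
  have nl' : nonoverlapping l'.
    move: nl => /andP[h1 h2]; apply/andP; split.
      by rewrite all_map; apply/allP => u /(allP h1); exact: clamp_le.
    rewrite pairwise_map; apply: sub_pairwise h2 => u v /orP[] h /=.
      by rewrite clamp_le.
    by rewrite [X in _ || X]clamp_le ?orbT.
  have le_l u : u \in l -> u.1 <= u.2 by case/andP: nl => /allP + _; apply.
  apply: le_trans (hd l' nl' _).
    rewrite /l' big_map big_seq [leRHS]big_seq.
    apply: ler_sum => u ul; rewrite TD ?le_l // ger0_norm // fine_ge0 //.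
    by apply: total_variation_ge0; apply: clamp_le; exact: le_l.
  apply: le_lt_trans ld; rewrite /l' big_map big_seq [leRHS]big_seq.
  by apply: ler_sum => u ul; apply: clamp_sub; exact: le_l.
have ndT : {homo T : x y / x <= y}.
  by move=> x y xy; rewrite -subr_ge0; apply: le_trans (gT _ _ xy).
pose N x := T x - g x.
have ndN : {homo N : x y / x <= y}.
  move=> x y xy; have := gT _ _ xy; rewrite /N ler_norml => /andP[_]; lra.
have acN : abs_cont N.
  move=> e e0; have e2 : 0 < e / 2 by rewrite divr_gt0.
  have [d1 d10 hd1] := acT _ e2; have [d2 d20 hd2] := acg _ e2.
  exists (Num.min d1 d2); first by rewrite lt_min d10.
  move=> l nl; rewrite lt_min => /andP[l1 l2].
  have := hd1 l nl l1; have := hd2 l nl l2 => h1 h2.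
  rewrite (splitr e); apply: le_trans (lerD h2 h1); rewrite -big_split /=.
  apply: ler_sum => u _; rewrite /N.
  have -> : T u.2 - g u.2 - (T u.1 - g u.1) = (T u.2 - T u.1) - (g u.2 - g u.1).
    by ring.
  exact: ler_normB.
have [p1 [ip1 hp1]] := nondecreasing_abs_cont_density ndT acT ab.
have [p2 [ip2 hp2]] := nondecreasing_abs_cont_density ndN acN ab.
exists (fun t => p1 t - p2 t); split.
  by apply: eq_integrable (integrableB measurableT ip1 ip2).
move=> x axb; rewrite RintegralB //; last 2 first.
- exact: integrableS ip1.
- exact: integrableS ip2.
rewrite -hp1 // -hp2 // /N /g /= !clamp_id ?lexx //; ring.
Qed.

(** On [x, y] the function f is the integral of a density, equal to f' almost everywhere by Lebesgue
    differentiation, so an essential bound on f' controls the increments. For the Cantor function,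
    which is not absolutely continuous, this fails. *)
Lemma ess_sup_lipschitz f K : locally_abs_cont f ->
  (ess_sup_norm (derive1 f) <= K%:E)%E -> forall x y, `|f x - f y| <= K * `|x - y|.
Proof.
move=> acf fK0.
have K0 : 0 <= K.
  rewrite -lee_fin; apply: le_trans fK0; apply: ess_sup_gee; last by apply: nearW => t; rewrite lee_fin.
  apply: (@lt_le_trans _ _ (mu `]0, 1]%classic)).
    by rewrite lebesgue_measure_itv /= lte_fin ltr01 sube0 lte01.
  by apply: le_measure; rewrite ?inE.
have /ess_supP fK := fK0.
suff H x y : x < y -> `|f y - f x| <= K * (y - x).
  move=> x y; have [xy|yx|->] := ltgtP x y; last by rewrite !subrr normr0 mulr0.
    by rewrite distrC (distrC x) [`|y - x|]gtr0_norm ?subr_gt0 // H.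
  by rewrite [`|x - y|]gtr0_norm ?subr_gt0 // H.
move=> xy; have xy1 : x <= y by exact: ltW.
have [phi [iphi hphi]] := abs_cont_density xy1 acf.
have := @FTC1 R phi (BRight x).
have iphi' z : mu.-integrable [set` Interval (BRight x) (BRight z)] (EFin \o phi).
  exact: integrableS iphi.
have lphi : locally_integrable setT phi.
  by have := integrable_locally measurableT iphi; rewrite patch_setT.
move=> /(_ iphi' lphi) /= ae1.
have phiK : {ae mu, forall z, `]x, y[%classic z -> (`|phi z|%:E <= K%:E)%E}.
  apply: filterS2 fK ae1.
  move=> z /= + H; rewrite in_itv /= => + /andP[xz zy].
  have [dz <-] := H xz; rewrite !derive1E.
  suff -> : 'D_1 (fun z : R => (\int[mu]_(t in `]x, z]) phi t)%R) z = 'D_1 f z by [].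
  apply/esym; apply: derive_val.
  have dF := DeriveDef dz erefl.
  have dF' := is_deriveD (is_derive_cst (f x) z 1) dF; rewrite add0r in dF'.
  apply: near_eq_is_derive dF'.
  near=> t; rewrite /= fctE -hphi; first by rewrite addrC subrK.
  apply/andP; split; apply: ltW.
    by near: t; exact: lt_nbhsr.
  by near: t; exact: lt_nbhsl.
rewrite hphi ?lexx ?andbT //.
apply: le_trans (le_normr_Rintegral _ _) _ => //.
rewrite -Rintegral_itv_bndo_bndc; last first.
  apply: integrableS (integrable_abse iphi) => //.
rewrite -lee_fin fineK; last first.
  apply: integrable_fin_num => //.
  apply: integrableS (integrable_abse iphi) => //.
apply: (@le_trans _ _ (\int[mu]_(t in `]x, y[) cst K%:E t)%E); last first.
  by rewrite integral_cst //= lebesgue_measure_itv /= lte_fin xy.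
apply: ae_ge0_le_integral => //.
- by apply/measurable_int; apply: integrableS (integrable_abse iphi).
Unshelve. all: by end_near. Qed.
End lipschitz.

(** * Taylor's formula *)

Section calculus.
Context {R : realType}.
Implicit Types (f df : R -> R) (x y : R).

Lemma is_derive_continuous f df x : is_derive x 1 f (df x) ->
  {for x, continuous f}.
Proof. by move=> [dfx _]; exact/differentiable_continuous/derivable1_diffP. Qed.

Lemma is_derive_mvt f df x y : (forall z : R, is_derive z (1 : R) f (df z)) ->
  exists2 c, Num.min x y <= c <= Num.max x y & f y - f x = df c * (y - x).
Proof.
move=> fdf; have cf : continuous f.
  by move=> z; apply: is_derive_continuous (fdf z).
have H a b : a <= b -> exists2 c, a <= c <= b & f b - f a = df c * (b - a).
  move=> ab; have [|c] := @MVT_segment R f df a b ab (fun z _ => fdf z).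
    exact: continuous_subspaceT.
  by rewrite in_itv /=; exists c.
have [xy|yx] := leP x y; first by have [c ? ?] := H _ _ xy; exists c.
have [c ? e] := H _ _ (ltW yx); exists c => //.
by rewrite -opprB e -mulrN opprB.
Qed.

Lemma is_derive_lipschitz f df K : (forall z : R, is_derive z (1 : R) f (df z)) ->
  (forall z, `|df z| <= K) -> forall x y, `|f x - f y| <= K * `|x - y|.
Proof.
move=> fdf dfK x y; have [c _ ->] := is_derive_mvt y x fdf.
by rewrite normrM ler_wpM2r.
Qed.

Lemma is_derive_shift f (df x y : R) : is_derive (x + y) 1 f df ->
  is_derive x 1 (fun z => f (z + y)) df.
Proof.
move=> h.
have h2 : is_derive x (1 : R) (fun z : R => z + y) (1 : R).
  by apply: is_derive_eq; rewrite addr0.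
by have := @is_derive1_comp _ f (fun z => z + y) x _ _ h h2; rewrite mulr1.
Qed.

Lemma is_derive_add f g (df dg x : R) : is_derive x 1 f df ->
  is_derive x 1 g dg -> is_derive x 1 (fun z => f z + g z) (df + dg).
Proof. exact: is_deriveD. Qed.

Lemma is_derive_sub f g (df dg x : R) : is_derive x 1 f df ->
  is_derive x 1 g dg -> is_derive x 1 (fun z => f z - g z) (df - dg).
Proof. exact: is_deriveB. Qed.

Lemma is_derive_mul f g (df dg x : R) : is_derive x 1 f df ->
  is_derive x 1 g dg ->
  is_derive x 1 (fun z => f z * g z) (df * g x + f x * dg).
Proof.
move=> h1 h2; apply: is_derive_eq (is_deriveM h1 h2) _.
by rewrite addrC /GRing.scale /= [g x * _]mulrC.
Qed.

Lemma is_derive_scale (a : R) f (df x : R) : is_derive x 1 f df ->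
  is_derive x 1 (fun z => a * f z) (a * df).
Proof. exact: is_deriveZ. Qed.

Lemma is_derive_expn n x : is_derive x 1 (fun z : R => z ^+ n.+1) (n.+1%:R * x ^+ n).
Proof.
have -> : (fun z : R => z ^+ n.+1) = id ^+ n.+1.
  by apply/funext => z; rewrite exprfctE.
apply: is_derive_eq (is_deriveX n.+1 (is_derive_id x (1 : R))) _.
by rewrite /GRing.scale /= mulr1.
Qed.

Lemma is_derive_sumn n (F : 'I_n -> R -> R) (dF : 'I_n -> R) x :
  (forall i, is_derive x 1 (F i) (dF i)) ->
  is_derive x 1 (fun z => \sum_(i < n) F i z) (\sum_(i < n) dF i).
Proof.
move=> h; rewrite (_ : (fun z => _) = \sum_(i < n) F i); last first.
  by apply/funext => z; rewrite fct_sumE.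
exact: is_derive_sum.
Qed.

Lemma factS_inv n : n.+1%:R / n.+1`!%:R = (n`!%:R : R)^-1.
Proof.
by rewrite factS natrM invfM mulrA divff ?mul1r ?pnatr_eq0.
Qed.

Lemma is_derive_taylor_poly n (a : nat -> R) x :
  is_derive x 1 (fun z : R => \sum_(k < n.+1) a k * z ^+ k / k`!%:R)
    (\sum_(k < n) a k.+1 * x ^+ k / k`!%:R).
Proof.
have -> : (fun z : R => \sum_(k < n.+1) a k * z ^+ k / k`!%:R) =
    (fun z : R => a 0 + \sum_(k < n) (a k.+1 / k.+1`!%:R) * z ^+ k.+1).
  apply/funext => z; rewrite big_ord_recl expr0 mulr1 fact0 divr1; congr (_ + _).
  by apply: eq_bigr => i _; rewrite ?lift0 mulrAC.
rewrite -[X in is_derive _ _ _ X]add0r; apply: is_derive_add.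
apply: is_derive_sumn => i; apply: is_derive_eq.
  by apply: is_derive_scale; exact: is_derive_expn.
rewrite -(factS_inv i); move: (i.+1`!%:R^-1) (i.+1%:R : R) => u v; ring.
Qed.

(* [u] is the gap between the right-hand side and [F 0 - T], whose derivative is
   nonnegative by the induction hypothesis applied to the shifted sequence. *)
Lemma taylor_bound_ge0 p (F : nat -> R -> R) (w y M : R) :
  (forall k (z : R), (k < p)%N -> is_derive z (1 : R) (F k) (F k.+1 z)) ->
  0 <= y -> (forall t : R, 0 <= t <= y -> F p (w + t) <= M) ->
  F 0 (w + y) - \sum_(k < p) F k w * y ^+ k / k`!%:R <= M * y ^+ p / p`!%:R.
Proof.
elim: p F y => [|p ih] F y dF y0 FM.
  by rewrite big_ord0 subr0 expr0 mulr1 fact0 divr1; apply: FM; rewrite y0 lexx.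
pose a k := if k == p.+1 then M else F k w.
pose u t := \sum_(k < p.+2) a k * t ^+ k / k`!%:R - F 0 (t + w).
pose du t := \sum_(k < p.+1) a k.+1 * t ^+ k / k`!%:R - F 1 (t + w).
have dud (z : R) : is_derive z (1 : R) u (du z).
  apply: is_derive_sub; first exact: is_derive_taylor_poly.
  by apply: is_derive_shift; exact: dF.
have aF k : (k < p.+1)%N -> a k = F k w by move=> kp; rewrite /a ltn_eqF.
have uE t : u t = \sum_(k < p.+1) F k w * t ^+ k / k`!%:R + M * t ^+ p.+1 / p.+1`!%:R
    - F 0 (w + t).
  rewrite /u big_ord_recr /= {2}/a eqxx [t + w]addrC; congr (_ + _ - _).
  by apply: eq_bigr => i _; rewrite aF.
have [c] := is_derive_mvt 0 y dud.
rewrite min_l // max_r // => /andP[c0 cy] e.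
have u0 : u 0 = 0.
  rewrite uE addr0 big_ord_recl expr0 mulr1 fact0 divr1 big1.
    by rewrite expr0n /= mulr0 mul0r !addr0 subrr.
  by move=> i _; rewrite ?lift0 expr0n /= mulr0 mul0r.
have : 0 <= u y.
  move: e; rewrite u0 !subr0 => ->; rewrite mulr_ge0 // /du subr_ge0.
  have : F 1 (w + c) - \sum_(k < p) F k.+1 w * c ^+ k / k`!%:R <= M * c ^+ p / p`!%:R.
    apply: (ih (fun k => F k.+1)) => // [k z kp|t /andP[t0 tc]]; first exact: dF.
    by apply: FM; rewrite t0 (le_trans tc).
  rewrite big_ord_recr /= {2}/a eqxx [c + w]addrC lerBlDl addrC => h.
  rewrite (eq_bigr (fun i : 'I_p => F i.+1 w * c ^+ i / i`!%:R)) // => i _.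
  by rewrite aF // ltnS.
by rewrite uE subr_ge0 => h; rewrite lerBlDl.
Qed.

(** The one-sided bound applies to F and to -F. As [F p] may be discontinuous, no integral form of
    the remainder is available. *)
Lemma taylor_bound p (F : nat -> R -> R) (w y M : R) :
  (forall k (z : R), (k < p)%N -> is_derive z (1 : R) (F k) (F k.+1 z)) ->
  (forall t : R, Num.min 0 y <= t <= Num.max 0 y -> `|F p (w + t)| <= M) ->
  `|F 0 (w + y) - \sum_(k < p) F k w * y ^+ k / k`!%:R|
    <= M * `|y| ^+ p / p`!%:R.
Proof.
move=> dF FM.
have H (G : nat -> R -> R) (w' y' : R) :
    (forall k (z : R), (k < p)%N -> is_derive z (1 : R) (G k) (G k.+1 z)) ->
    0 <= y' -> (forall t : R, 0 <= t <= y' -> `|G p (w' + t)| <= M) ->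
    `|G 0 (w' + y') - \sum_(k < p) G k w' * y' ^+ k / k`!%:R|
      <= M * y' ^+ p / p`!%:R.
  move=> dG y0 GM; rewrite ler_norml; apply/andP; split; last first.
    apply: taylor_bound_ge0 => // t ty; apply: le_trans (GM _ ty); exact: ler_norm.
  have := @taylor_bound_ge0 p (fun k z => - G k z) w' y' M _ y0 _.
  rewrite lerNl opprB (eq_bigr (fun k : 'I_p => - (G k w' * y' ^+ k / k`!%:R))).
    rewrite sumrN opprK addrC; apply => [k z kp|t ty].
      by apply: is_deriveN; exact: dG.
    by apply: le_trans (GM _ ty); rewrite -normrN ler_norm.
  by move=> k _; rewrite !mulNr.
have [y0|y0] := leP 0 y.
  rewrite [`|y|]ger0_norm //; apply: H => // t ty; apply: FM.
  by rewrite min_l // max_r.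
rewrite [`|y|]ler0_norm; last exact: ltW.
(* A negative increment is reflected into a positive one; the signs (-1)^k keep each function the
   derivative of the preceding one. *)
have := H (fun k z => (-1) ^+ k * F k (- z)) (- w) (- y).
rewrite expr0 mul1r !opprD !opprK.
rewrite (eq_bigr (fun k : 'I_p => (F k w * y ^+ k / k`!%:R))); last first.
  by move=> k _; rewrite ?opprK [(- y) ^+ _]exprNn mulrACA -expr2 sqrr_sign mul1r //.
apply => [k z kp||t /andP[t0 ty]].
- rewrite exprS mulN1r mulNr -mulrN; apply: is_derive_scale.
  have := @is_derive1_comp _ (F k) -%R z _ _ (dF _ _ kp) (is_deriveNid z (1 : R)).
  by rewrite mulrN1.
- by rewrite oppr_ge0 ltW.
rewrite normrM normrX normrN1 expr1n mul1r opprD opprK; apply: FM.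
rewrite min_r ?(ltW y0) // max_l ?(ltW y0) //; apply/andP; split; lra.
Qed.
End calculus.

(** * Faa di Bruno's formula *)

Section faa_di_bruno.
Context {R : realType}.

(* The pair (k, [:: i_1; ...; i_k]) stands for the term
   h^(k)(g) g^(i_1) ... g^(i_k) of Faa di Bruno's formula. *)
Fixpoint derive_monomial (s : seq nat) : seq (seq nat) :=
  if s is i :: s' then (i.+1 :: s') :: [seq i :: t | t <- derive_monomial s']
  else [::].

(** Product rule: either the outer factor is differentiated, which brings in a new factor g', or one
    of the inner factors is. *)
Definition derive_term (t : nat * seq nat) : seq (nat * seq nat) :=
  (t.1.+1, 1 :: t.2) :: [seq (t.1, s) | s <- derive_monomial t.2].

Fixpoint faa_terms (m : nat) : seq (nat * seq nat) :=
  if m is m'.+1 then flatten [seq derive_term t | t <- faa_terms m']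
  else [:: (0, [::])].

Lemma size_derive_monomial s : size (derive_monomial s) = size s.
Proof. by elim: s => //= i s ih; rewrite size_map ih. Qed.

Lemma mem_derive_monomial s s' : s' \in derive_monomial s ->
  [/\ size s' = size s, sumn s' = (sumn s).+1 & all (leq 1) s -> all (leq 1) s'].
Proof.
elim: s s' => //= i s ih s'; rewrite inE => /orP[/eqP ->|/mapP[t ts ->]] /=.
  by split => // /andP[_].
by have [-> -> h] := ih _ ts; split => [//||/andP[-> /h]//]; rewrite addnS.
Qed.

Lemma mem_faa_terms m t : t \in faa_terms m ->
  [/\ size t.2 = t.1, sumn t.2 = m & all (leq 1) t.2].
Proof.
elim: m t => [|m ih] t /=; first by rewrite inE => /eqP ->.
move=> /flattenP[_ /mapP[u /ih[u1 u2 u3] ->]].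
rewrite inE => /orP[/eqP ->|/mapP[s /mem_derive_monomial[s1 s2 s3] ->]] /=.
  by rewrite u1 u2 u3.
by rewrite s1 s2 u1 u2 s3.
Qed.

Lemma stirling2_gt n k : (n < k)%N -> stirling2 n k = 0%N.
Proof.
elim: n k => [|n ih] [|k] //= nk.
by rewrite !ih ?muln0 //; exact: ltnW.
Qed.

(** A term with k inner factors produces one term with k + 1 factors and k terms with k factors.
    This is the recurrence of the Stirling numbers, which therefore count the terms with
    repetition. *)
Lemma sum_faa_terms (f : nat -> R) m :
  \sum_(t <- faa_terms m) f t.1 = \sum_(k < m.+1) (stirling2 m k)%:R * f k.
Proof.
elim: m f => [|m ih] f.
  by rewrite big_seq1 big_ord_recl big_ord0 /= addr0 mul1r.
rewrite /= big_flatten big_map /=.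
under eq_bigr => t _ do rewrite /derive_term big_cons big_map /= big_const_seq
  count_predT size_derive_monomial iter_addr_0.
rewrite (eq_big_seq (fun t => f t.1.+1 + t.1%:R * f t.1)); last first.
  by move=> t /mem_faa_terms[-> _ _]; rewrite mulr_natl.
rewrite (ih (fun k => f k.+1 + k%:R * f k)).
rewrite (eq_bigr (fun k : 'I_m.+1 => (stirling2 m k)%:R * f k.+1 +
  (stirling2 m k)%:R * (k%:R * f k))); last by move=> k _; rewrite mulrDr.
rewrite big_split /= [in RHS]big_ord_recl /= mul0r add0r.
have -> : \sum_(i < m.+1) (stirling2 m i)%:R * (i%:R * f i) =
    \sum_(i < m.+1) (i.+1%:R * (stirling2 m i.+1)%:R * f i.+1).
  rewrite big_ord_recl /= mul0r mulr0 add0r [RHS]big_ord_recr /=.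
  rewrite stirling2_gt // mulr0 mul0r addr0.
  by apply: eq_bigr => i _; rewrite ?lift0 /bump /= ?add1n; ring.
rewrite -big_split /=; apply: eq_bigr => i _.
by rewrite ?lift0 /bump /= ?add1n natrD natrM; ring.
Qed.

Lemma is_derive_monomial p (G : nat -> R -> R) (s : seq nat) (x : R) :
  (forall k (z : R), (k < p)%N -> is_derive z (1 : R) (G k) (G k.+1 z)) ->
  all (fun i => i < p)%N s ->
  is_derive x 1 (fun z => \prod_(i <- s) G i z)
    (\sum_(t <- derive_monomial s) \prod_(i <- t) G i x).
Proof.
move=> dG; elim: s => [_|i s ih /= /andP[ip sp]].
  rewrite big_nil; under eq_fun do rewrite big_nil; exact: is_derive_cst.
under eq_fun do rewrite big_cons.
rewrite /= !big_cons big_map /=.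
rewrite (eq_bigr (fun t => G i x * \prod_(j <- t) G j x)); last first.
  by move=> t _; rewrite big_cons.
rewrite -big_distrr /=.
by apply: is_derive_mul; [exact: dG|exact: ih].
Qed.

(** The derivatives occurring in a term of [Psi k] have order at most k < p, so that every factor
    can be differentiated once more. *)
Lemma faa_di_bruno p (H G : nat -> R -> R) :
  (forall k (z : R), (k < p)%N -> is_derive z (1 : R) (H k) (H k.+1 z)) ->
  (forall k (z : R), (k < p)%N -> is_derive z (1 : R) (G k) (G k.+1 z)) ->
  let Psi k x := \sum_(t <- faa_terms k) (H t.1 (G 0 x) * \prod_(i <- t.2) G i x) in
  forall k (z : R), (k < p)%N -> is_derive z (1 : R) (Psi k) (Psi k.+1 z).
Proof.
move=> dH dG Psi k z kp.
have -> : Psi k.+1 z = \sum_(t <- faa_terms k) (H t.1.+1 (G 0 z) * G 1 z *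
   \prod_(i <- t.2) G i z + H t.1 (G 0 z) *
     \sum_(s <- derive_monomial t.2) \prod_(i <- s) G i z).
  rewrite /Psi /= big_flatten big_map /=; apply: eq_bigr => t _.
  by rewrite /derive_term big_cons big_map /= big_cons mulrA big_distrr.
rewrite /Psi; under eq_fun do rewrite big_tnth.
rewrite big_tnth; apply: is_derive_sumn => i.
have := mem_tnth i (in_tuple (faa_terms k)); set t := tnth _ _ => /mem_faa_terms.
move=> [t1 t2 t3].
have p0 : (0 < p)%N by apply: leq_ltn_trans kp.
apply: is_derive_mul.
  apply: (@is_derive1_comp _ (H t.1) (G 0)); first last.
    exact: dG.
  apply: dH; apply: leq_ltn_trans kp; rewrite -t1 -t2.
  by elim: t.2 t3 => //= a l ih /andP[a1 /ih h]; rewrite -add1n leq_add.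
apply: (@is_derive_monomial p) => //; apply/allP => j jt.
apply: leq_ltn_trans kp; rewrite -t2.
elim: t.2 jt {t1 t2 t3} => //= a l ih; rewrite inE => /orP[/eqP ->|/ih h].
  exact: leq_addr.
by apply: leq_trans h _; exact: leq_addl.
Qed.

(** The inner orders of a term sum to p, so its inner product is at most Q^p whatever the term;
    grouping the terms by their number of factors gives the weights of [h_norm]. *)
Lemma faa_di_bruno_bound p (H G : nat -> R -> R) (K : nat -> R) (Q x : R) :
  (0 < p)%N -> 0 <= Q ->
  (forall k y, (0 < k <= p)%N -> `|H k y| <= K k) ->
  (forall k, (0 < k <= p)%N -> `|G k x| <= Q ^+ k) ->
  `|\sum_(t <- faa_terms p) (H t.1 (G 0 x) * \prod_(i <- t.2) G i x)|
    <= (\sum_(1 <= k < p.+1) (stirling2 p k)%:R * K k) * Q ^+ p.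
Proof.
move=> p0 Q0 HK GQ; apply: le_trans (ler_norm_sum _ _ _) _.
apply: (@le_trans _ _ (\sum_(t <- faa_terms p) K t.1 * Q ^+ p)).
  rewrite big_seq [leRHS]big_seq; apply: ler_sum => t /mem_faa_terms[t1 t2 t3].
  have t1p : (0 < t.1 <= p)%N.
    rewrite -t1 -[X in _ && (_ <= X)%N]t2; case: t.2 t2 t3 {t1} => [/= p00|a l _]; first by rewrite -p00 in p0.
    rewrite /= => /andP[a1]; elim: l => [_|b l ih /= /andP[b1 /ih]] /=; first by rewrite addn0.
    by rewrite addnCA -[(size l).+2]add1n; exact: leq_add.
  rewrite normrM; apply: ler_pM => //; first exact: HK.
  rewrite normr_prod -t2.
  have : all (fun i => 0 < i <= p)%N t.2.
    apply/allP => j jt; rewrite (allP t3 _ jt) /= -t2.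
    elim: t.2 jt {t1 t2 t3 t1p} => //= a l ih; rewrite inE => /orP[/eqP ->|/ih h].
      exact: leq_addr.
    by apply: leq_trans h _; exact: leq_addl.
  elim: t.2 {t1 t2 t3 t1p} => [|a l ih] /=; first by rewrite big_nil expr0.
  move=> /andP[a1 /ih h]; rewrite big_cons exprD; apply: ler_pM => //.
    exact: prodr_ge0.
  exact: GQ.
rewrite -big_distrl /= sum_faa_terms ler_wpM2r ?exprn_ge0 //.
rewrite big_add1 /= big_mkord big_ord_recl /=.
by case: p p0 {HK GQ} => // p _; rewrite mul0r add0r.
Qed.

End faa_di_bruno.

(** * Mollification *)

Section mollification.
Context {R : realType}.
Implicit Types (f h : R -> R) (e x y : R).
Local Notation mu := (@lebesgue_measure R).

Definition average f e x : R := e^-1 * (\int[mu]_(t in `]x, x + e]) f t)%R.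

Lemma continuous_itv_integrable f x y : continuous f ->
  mu.-integrable `[x, y] (EFin \o f).
Proof.
move=> cf; apply: continuous_compact_integrable; first exact: segment_compact.
exact: continuous_subspaceT.
Qed.

Lemma is_derive_average f e x : 0 < e -> continuous f ->
  is_derive x 1 (average f e) (e^-1 * (f (x + e) - f x)).
Proof.
move=> e0 cf; pose F y := (\int[mu]_(t in `[x - 1, y]) f t)%R.
have dF y : x - 1 < y -> is_derive y 1 F (f y).
  move=> xy; have y1 : y < y + 1 by rewrite ltrDl.
  have [] := @continuous_FTC1_closed R f (x - 1) y (y + 1) y1
    (continuous_itv_integrable _ _ cf) xy (cf y).
  by move=> dFy <-; rewrite derive1E; exact: DeriveDef.
have h : is_derive x 1 (fun y => e^-1 * (F (y + e) - F y)) (e^-1 * (f (x + e) - f x)).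
  apply: is_derive_scale; apply: is_derive_sub.
    by apply: is_derive_shift; apply: dF; lra.
  by apply: dF; lra.
apply: near_eq_is_derive h; near=> y.
have xy : x - 1 < y by near: y; apply: lt_nbhsr; lra.
rewrite /average /F; congr (_ * _); apply: Rintegral_itvB.
- exact: continuous_itv_integrable.
- by rewrite bnd_simp ltW.
- by rewrite bnd_simp; lra.
Unshelve. all: by end_near. Qed.

Lemma lipschitz_continuous f K :
  (forall x y, `|f x - f y| <= K * `|x - y|) -> continuous f.
Proof.
move=> lipf; have K0 : 0 <= K.
  have := lipf 1 0; rewrite subr0 normr1 mulr1; exact: le_trans.
move=> z; apply/cvgrPdist_le => eps eps0; near=> t.
apply: le_trans (lipf _ _) _.
have zt : `|z - t| < eps / (K + 1).
  by near: t; apply: cvgr_dist_lt => //; rewrite divr_gt0 //; lra.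
apply: (@le_trans _ _ (K * (eps / (K + 1)))); first by rewrite ler_wpM2l // ltW.
by rewrite mulrA ler_pdivrMr; [rewrite mulrC ler_wpM2l|]; lra.
Unshelve. all: by end_near. Qed.

Lemma average_dist f e K x : 0 < e -> (forall x y, `|f x - f y| <= K * `|x - y|) ->
  `|average f e x - f x| <= e * K.
Proof.
move=> e0 lipf.
have K0 : 0 <= K.
  have := lipf 1 0; rewrite subr0 normr1 mulr1; exact: le_trans.
have cf : continuous f by exact: lipschitz_continuous lipf.
have ioc f' : continuous f' -> mu.-integrable `]x, x + e] (EFin \o f').
  move=> cf'; apply: integrableS (continuous_itv_integrable x (x + e) cf') => //.
  by move=> z /=; rewrite !in_itv /= => /andP[/ltW -> ->].
have ifi := ioc _ cf.
have moc : mu `]x, (x + e)] = e%:E.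
  by rewrite lebesgue_measure_itv /= lte_fin ltrDl e0 -EFinB addrAC subrr add0r.
have icst (c : R) : mu.-integrable `]x, x + e] (EFin \o cst c).
  by apply: ioc => z; exact: cvg_cst.
have -> : average f e x - f x = e^-1 * (\int[mu]_(t in `]x, x + e]) (f t - cst (f x) t))%R.
  rewrite RintegralB //.
  rewrite Rintegral_cst // /average.
  by rewrite [X in fine X]moc /= mulrBr [f x * e]mulrC mulKf // gt_eqF.
rewrite normrM ger0_norm ?invr_ge0 ?(ltW e0) // ler_pdivrMl //.
apply: le_trans (le_normr_Rintegral _ _) _ => //.
  by apply: eq_integrable (integrableB _ ifi (icst (f x))).
apply: (@le_trans _ _ (\int[mu]_(t in `]x, x + e]) cst (e * K) t)%R); last first.
  by rewrite Rintegral_cst // [X in fine X]moc /= mulrC mulrA.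
apply: le_Rintegral => //.
  by apply: integrable_norm; apply: eq_integrable (integrableB _ ifi (icst (f x))).
move=> t /=; rewrite in_itv /= => /andP[xt te]; apply: le_trans (lipf _ _) _.
rewrite mulrC ler_wpM2r // gtr0_norm; lra.
Qed.

(** The k-th derivative of the moving average is a difference quotient of h^(k-1), hence at most the
    Lipschitz constant of h^(k-1), which the norm of h^(k) bounds; for k = p that norm is the
    essential supremum. The bounds [K] are chosen before the accuracy e, so e can tend to 0 at the
    end. *)
Lemma C_b_mollify p h : (0 < p)%N -> C_b p h ->
  exists2 K : nat -> R,
    forall k, (0 < k <= p)%N -> deriv_norm p h k = (K k)%:E /\ 0 <= K k &
  forall e, 0 < e -> exists H : nat -> R -> R,
    [/\ forall x, `|H 0 x - h x| <= e,
        forall k (x : R), (k < p)%N -> is_derive x (1 : R) (H k) (H k.+1 x) &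
        forall k x, (0 < k <= p)%N -> `|H k x| <= K k].
Proof.
move=> p0 [dh ach nh].
pose K k := fine (deriv_norm p h k).
have mT : (0 < mu setT)%E.
  apply: (@lt_le_trans _ _ (mu `]0, 1]%classic)).
    by rewrite lebesgue_measure_itv /= lte_fin ltr01 sube0 lte01.
  by apply: le_measure; rewrite ?inE.
have nh0 k : (0 <= deriv_norm p h k)%E.
  rewrite /deriv_norm; case: ifP => _.
    apply: (@le_trans _ _ (`|derive1n k h 0|%:E)); first by rewrite lee_fin.
    by apply: ereal_sup_ubound; exists 0.
  by apply: ess_sup_gee => //; apply: nearW => t; rewrite lee_fin.
have KE k : (0 < k <= p)%N -> deriv_norm p h k = (K k)%:E /\ 0 <= K k.
  by move=> kp; rewrite /K fineK ?ge0_fin_numE ?nh ?fine_ge0.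
exists K => // e e0.
have dh' k (x : R) : (k < p.-1)%N -> is_derive x (1 : R) (derive1n k h) (derive1n k.+1 h x).
  by move=> kp; rewrite derive1nS derive1E; apply: DeriveDef => //; exact: dh.
have lip k x y : (k < p)%N -> `|derive1n k h x - derive1n k h y| <= K k.+1 * `|x - y|.
  move=> kp; have [e1 _] : deriv_norm p h k.+1 = (K k.+1)%:E /\ 0 <= K k.+1 by exact: KE.
  have [kp1|kp1] := ltnP k p.-1.
    apply: (is_derive_lipschitz (df := derive1n k.+1 h)) => [z|z]; first exact: dh'.
    move: e1; rewrite /deriv_norm ifT; last by rewrite -(prednK p0) ltnS.
    by rewrite -lee_fin => <-; apply: ereal_sup_ubound; exists z.
  have kp2 : k = p.-1 by apply/eqP; rewrite eqn_leq kp1 -ltnS prednK // kp.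
  apply: ess_sup_lipschitz; first by rewrite kp2.
  rewrite -derive1nS; move: e1; rewrite /deriv_norm ifF; first by move->.
  by rewrite kp2 prednK // ltnn.
have K1 : 0 <= K 1%N by have [] := KE 1%N p0.
(* The average over a window of length d differs from h by at most d times [K 1]; the added 1 avoids
   a division by zero. *)
pose d := e / (K 1%N + 1).
have d0 : 0 < d by rewrite divr_gt0 // ltr_wpDl.
exists (fun k => if k is k'.+1 then
  (fun x => d^-1 * (derive1n k' h (x + d) - derive1n k' h x)) else average h d).
have lip0 x y : `|h x - h y| <= K 1%N * `|x - y| by exact: lip p0.
split.
- move=> x; have := average_dist x d0 lip0; move=> h1; apply: le_trans h1 _.
  have K1' : 0 < K 1%N + 1 by rewrite ltr_wpDl.
  by rewrite /d mulrAC ler_pdivrMr // ler_wpM2l ?(ltW e0) // lerDl.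
- move=> [|k] x kp.
    by apply: is_derive_average => //; exact: lipschitz_continuous lip0.
  have kp1 : (k < p.-1)%N by rewrite -ltnS prednK.
  apply: is_derive_scale; apply: is_derive_sub; last exact: dh'.
  by apply: is_derive_shift; exact: dh'.
- case=> [|k] x kp; first by rewrite ltnn in kp.
  rewrite normrM (@ger0_norm _ d^-1); last by rewrite invr_ge0 ltW.
  rewrite ler_pdivrMl; last exact: d0.
  have := lip k (x + d) x; rewrite addrAC subrr add0r (gtr0_norm d0) mulrC.
  by apply; case/andP: kp.
Qed.

End mollification.

(** * Decoupling independent variables *)

Section same_law.
Context {R : realType} {d1 d2 d : measure_display} {T1 : measurableType d1}
  {T2 : measurableType d2} {E : measurableType d}.
Variables (P1 : {measure set T1 -> \bar R}) (P2 : {measure set T2 -> \bar R}).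
Variables (V1 : T1 -> E) (V2 : T2 -> E).
Hypotheses (mV1 : measurable_fun setT V1) (mV2 : measurable_fun setT V2).

(** The variables may live on different spaces: decoupling, passage to a marginal of a product and
    replacement of a Gaussian variable by the Gaussian measure are all instances. *)
Definition same_law := forall A, measurable A -> P1 (V1 @^-1` A) = P2 (V2 @^-1` A).

Hypothesis V12 : same_law.
Local Open Scope ereal_scope.

Lemma same_law_ge0_integral (F : E -> \bar R) : measurable_fun setT F ->
  (forall x, 0 <= F x) -> \int[P1]_x F (V1 x) = \int[P2]_x F (V2 x).
Proof.
move=> mF F0.
have h1 := @ge0_integral_pushforward _ _ _ _ R _ mV1 P1 setT _ measurableT mF (fun x _ => F0 x).
have h2 := @ge0_integral_pushforward _ _ _ _ R _ mV2 P2 setT _ measurableT mF (fun x _ => F0 x).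
rewrite !preimage_setT in h1 h2; rewrite -[LHS]h1 -[RHS]h2.
by apply: eq_measure_integral => A mA _; exact: V12.
Qed.

Lemma same_law_integral (F : E -> \bar R) : measurable_fun setT F ->
  \int[P1]_x F (V1 x) = \int[P2]_x F (V2 x).
Proof.
move=> mF; rewrite integralE [RHS]integralE.
have pE T (V : T -> E) : (fun x => F (V x))^\+ = F^\+ \o V.
  by apply/funext => x; rewrite /= !funeposE.
have nE T (V : T -> E) : (fun x => F (V x))^\- = F^\- \o V.
  by apply/funext => x; rewrite /= !funenegE.
rewrite (pE _ V1) (pE _ V2) (nE _ V1) (nE _ V2) (same_law_ge0_integral (measurable_funepos mF)) //.
by rewrite (same_law_ge0_integral (measurable_funeneg mF)).
Qed.

Lemma same_law_integrable (F : E -> \bar R) : measurable_fun setT F ->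
  P1.-integrable setT (F \o V1) -> P2.-integrable setT (F \o V2).
Proof.
move=> mF /integrableP[_ h]; apply/integrableP; split.
  exact: measurableT_comp.
have mG : measurable_fun setT (abse \o F) by exact: measurableT_comp.
have e := same_law_ge0_integral mG (fun x => abse_ge0 (F x)).
by have := h; rewrite [X in X < _ -> _]e.
Qed.

Lemma same_law_Rintegral (F : E -> R) : measurable_fun setT F ->
  (\int[P1]_x F (V1 x) = \int[P2]_x F (V2 x))%R.
Proof.
move=> mF; rewrite /Rintegral; congr fine.
by apply: (same_law_integral (F := EFin \o F)); exact/measurable_EFinP.
Qed.

End same_law.

(** * Independence of generated sigma-algebras *)

Section independence.
Context {R : realType} {d : measure_display} {T : measurableType d}.
Variable P : probability T R.
Local Open Scope ereal_scope.

(** In A, both sides are finite measures that agree on a pi-system containing the whole space. *)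
Lemma independent_g_sigma_algebra_l (G : set (set T)) (B : set T) :
  measurable B -> G `<=` measurable -> setI_closed G -> G setT ->
  (forall A, G A -> P (A `&` B) = P A * P B) ->
  forall A, <<s G >> A -> P (A `&` B) = P A * P B.
Proof.
move=> mB mG IG GT GB A sA.
have PB0 : (0 <= fine (P B))%R by rewrite fine_ge0.
pose m2 := mscale (NngNum PB0) P.
have PBE : (fine (P B))%:E = P B by rewrite fineK // fin_num_measure.
have cov : \bigcup_(k : nat) (setT : set T) = setT.
  by rewrite bigcup_const //; exists 0%N.
have m2E C : m2 C = P C * P B by rewrite -PBE muleC.
suff : mrestr P mB A = m2 A by rewrite m2E.
apply: (@g_sigma_algebra_measure_unique d R T G mG (fun=> setT) (fun=> GT) cov) => //.
  by move=> C GC; exact: etrans (GB _ GC) (esym (m2E C)).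
by move=> _; rewrite [X in X < _](_ : _ = P (setT `&` B)) // setTI -ge0_fin_numE // fin_num_measure.
Qed.

Lemma independent_g_sigma_algebra (G1 G2 : set (set T)) :
  G1 `<=` measurable -> setI_closed G1 -> G1 setT ->
  G2 `<=` measurable -> setI_closed G2 -> G2 setT ->
  (forall A B, G1 A -> G2 B -> P (A `&` B) = P A * P B) ->
  forall A B, <<s G1 >> A -> <<s G2 >> B -> P (A `&` B) = P A * P B.
Proof.
move=> m1 I1 t1 m2 I2 t2 h A B sA sB.
have mB : measurable B.
  have : <<s G2 >> `<=` measurable.
    by apply: smallest_sub => //; exact: sigma_algebra_measurable.
  exact.
apply: (independent_g_sigma_algebra_l mB m1 I1 t1) sA => A' GA'.
rewrite setIC muleC; apply: (independent_g_sigma_algebra_l _ m2 I2 t2) sB.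
  exact: m1.
by move=> B' GB'; rewrite setIC muleC; exact: h.
Qed.

End independence.

Section decoupling.
Context {R : realType} {d d1 d2 : measure_display} {T : measurableType d}
  {E1 : measurableType d1} {E2 : measurableType d2}.
Variable P : probability T R.
Variables (V1 : T -> E1) (V2 : T -> E2).
Hypotheses (mV1 : measurable_fun setT V1) (mV2 : measurable_fun setT V2).
Hypothesis indep : forall A B, measurable A -> measurable B ->
  (P ((V1 @^-1` A) `&` (V2 @^-1` B)) = P (V1 @^-1` A) * P (V2 @^-1` B))%E.

Lemma measurable_fun_map_pair :
  measurable_fun setT (fun z : T * T => (V1 z.1, V2 z.2)).
Proof.
apply/measurable_fun_pairP; split => /=.
  exact: measurableT_comp mV1 measurable_fst.
exact: measurableT_comp mV2 measurable_snd.
Qed.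

(** Two independent variables may be evaluated at two different points of the product space. The
    laws agree on rectangles by independence, hence everywhere. *)
Lemma decoupling : same_law P (P \x P)%E
  (fun x => (V1 x, V2 x)) (fun z : T * T => (V1 z.1, V2 z.2)).
Proof.
move=> A mA.
have mV : measurable_fun setT (fun x => (V1 x, V2 x)).
  exact: measurable_fun_pair.
have mV' : measurable_fun setT (fun z : T * T => (V1 z.1, V2 z.2)).
  exact: measurable_fun_map_pair.
apply: (@measure_unique _ R (E1 * E2)%type
  [set A `*` B | A in measurable & B in measurable] (fun=> setT) _ _ _ _
  (pushforward P (fun x => (V1 x, V2 x)))
  (pushforward (P \x P)%E (fun z : T * T => (V1 z.1, V2 z.2)))) => //.
- exact: measurable_prod_measurableType.
- move=> _ _ [X1 mX1 [X2 mX2 <-]] [Y1 mY1 [Y2 mY2 <-]].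
  rewrite -setXI; exists (X1 `&` Y1); first exact: measurableI.
  by exists (X2 `&` Y2) => //; exact: measurableI.
- by move=> _; exists setT => //; exists setT => //; rewrite setXTT.
- by rewrite bigcup_const //; exists 0%N.
- move=> _ [X1 mX1 [X2 mX2 <-]].
  suff : (P (V1 @^-1` X1 `&` V2 @^-1` X2) =
    (P \x P) ((V1 @^-1` X1) `*` (V2 @^-1` X2)))%E by [].
  rewrite indep // product_measure1E //; rewrite -[X in measurable X]setTI.
    exact: mV1.
  exact: mV2.
- by move=> _; suff : (P setT < +oo)%E by []; rewrite probability_setT ltry.
Qed.

End decoupling.

(** * Fubini's theorem for real-valued integrals *)

Section fubini.
Context {R : realType} {d1 d2 : measure_display} {T1 : measurableType d1}
  {T2 : measurableType d2}.
Variables (P1 : {sigma_finite_measure set T1 -> \bar R})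
  (P2 : {sigma_finite_measure set T2 -> \bar R}).

(** Integrability is asked of every section, so that [fine] never turns an infinite inner integral
    into its default value. *)
Lemma Rintegral_prod (f : T1 * T2 -> R) : (P1 \x P2)%E.-integrable setT (EFin \o f) ->
  (forall x, P2.-integrable setT (fun y => (f (x, y))%:E)) ->
  (\int[(P1 \x P2)%E]_z f z = \int[P1]_x \int[P2]_y f (x, y))%R.
Proof.
move=> fi fyi; rewrite /Rintegral -(integral12_prod_meas1 fi); congr fine.
apply: eq_integral => x _; rewrite fineK //.
by apply: integrable_fin_num.
Qed.

Lemma Rintegral_prod2 (f : T1 * T2 -> R) : (P1 \x P2)%E.-integrable setT (EFin \o f) ->
  (forall y, P1.-integrable setT (fun x => (f (x, y))%:E)) ->
  (\int[(P1 \x P2)%E]_z f z = \int[P2]_y \int[P1]_x f (x, y))%R.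
Proof.
move=> fi fyi; rewrite /Rintegral -(integral21_prod_meas1 fi); congr fine.
apply: eq_integral => x _; rewrite fineK //.
by apply: integrable_fin_num.
Qed.

Lemma integrable_Rintegral_prod2 (f : T1 * T2 -> R) :
  (P1 \x P2)%E.-integrable setT (EFin \o f) ->
  (forall y, P1.-integrable setT (fun x => (f (x, y))%:E)) ->
  P2.-integrable setT (fun y => (\int[P1]_x f (x, y))%R%:E).
Proof.
move=> fi fyi.
have e y : fubini_G P1 (EFin \o f) y = (\int[P1]_x f (x, y))%R%:E.
  by rewrite /Rintegral /fubini_G fineK //; apply: integrable_fin_num.
have mf : measurable_fun setT (EFin \o f) by case/integrableP: (fi).
apply: (@eq_integrable _ _ _ P2 setT measurableT (fubini_G P1 (EFin \o f))) => //.
apply/integrableP; split; first exact: (measurable_fubini_G fi).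
apply: le_lt_trans ((integrable21ltyP P1 P2 mf).1 fi).
apply: ge0_le_integral => //.
- by apply: measurableT_comp => //; exact: (measurable_fubini_G fi).
- apply: (@measurable_fun_fubini_tonelli_G _ _ _ _ _ P1 (abse \o (EFin \o f))).
    exact: measurableT_comp.
  by move=> z; exact: abse_ge0.
- by move=> y _; apply: le_abse_integral => //; case/integrableP: (fyi y).
Qed.

(** Tonelli's theorem factors the integral of the dominating product into two finite ones. *)
Lemma integrable_prod_dominated (f : T1 * T2 -> R) (u : T1 -> R) (v : T2 -> R) :
  measurable_fun setT f ->
  P1.-integrable setT (EFin \o u) -> P2.-integrable setT (EFin \o v) ->
  (forall x y, `|f (x, y)| <= `|u x| * `|v y|) ->
  (P1 \x P2)%E.-integrable setT (EFin \o f).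
Proof.
move=> mf ui vi fuv.
have mu : measurable_fun setT u by apply/measurable_EFinP; exact: measurable_int ui.
have mv : measurable_fun setT v by apply/measurable_EFinP; exact: measurable_int vi.
have [_ uoo] := integrableP _ _ _ ui; have [_ voo] := integrableP _ _ _ vi.
apply: (@le_integrable _ _ _ _ _ measurableT _
  (fun z : T1 * T2 => (u z.1 * v z.2)%:E)) => //.
- exact/measurable_EFinP.
- by move=> [x y] _ /=; rewrite lee_fin normrM.
have muv : measurable_fun setT (fun z : T1 * T2 => (u z.1 * v z.2)%:E).
  apply/measurable_EFinP/measurable_funM.
    exact: measurableT_comp mu measurable_fst.
  exact: measurableT_comp mv measurable_snd.
have muv' : measurable_fun setT (fun z : T1 * T2 => `|(u z.1 * v z.2)%:E|%E).
  exact: measurableT_comp.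
apply/integrableP; split => //.
rewrite fubini_tonelli1 //=.
have -> : (fubini_F P2 (fun z : T1 * T2 => `|u z.1 * v z.2|%:E)) =
    (fun x => `|u x|%:E * \int[P2]_y `|v y|%:E)%E.
  apply/funext => x; rewrite /fubini_F /=.
  under eq_integral do rewrite normrM EFinM.
  rewrite ge0_integralZl //.
    by apply/measurable_EFinP; exact: measurableT_comp.
have -> : (\int[P2]_y `|v y|%:E)%E = (fine (\int[P2]_y `|v y|%:E)%E)%:E.
  by rewrite fineK // ge0_fin_numE // integral_ge0.
have c0 : 0 <= fine (\int[P2]_y `|v y|%:E)%E by rewrite fine_ge0 // integral_ge0.
rewrite ge0_integralZr //.
  by rewrite muleC lte_mul_pinfty.
by apply/measurable_EFinP; exact: measurableT_comp.
Qed.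

End fubini.

(** * Sub-sigma-algebras generated by blocks of independent variables *)

Section blocks.
Context {R : realType} {d : measure_display} {T : measurableType d}.
Variable P : probability T R.
Variables (I : finType) (X : I -> {RV P >-> R}).

Definition cylinders (J : {set I}) : set (set T) :=
  [set A | exists2 E : I -> set R, (forall i, measurable (E i)) &
    A = \bigcap_(i in [set` J]) (X i @^-1` E i)].

(* T with the sub-sigma-algebra generated by the X i with i in J *)
Definition block (J : {set I}) := g_sigma_algebraType (cylinders J).

Lemma measurable_preimage_RV (Y : {RV P >-> R}) (E : set R) : measurable E ->
  measurable (Y @^-1` E).
Proof.
by move=> mE; rewrite -[X in measurable X]setTI; exact: measurable_funPT.
Qed.

Lemma cylinders_measurable J : cylinders J `<=` measurable.
Proof.
move=> _ [E mE ->]; apply: fin_bigcap_measurable => //.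
by move=> i _; exact: measurable_preimage_RV.
Qed.

Lemma cylinders_setI J : setI_closed (cylinders J).
Proof.
move=> _ _ [E mE ->] [F mF ->]; exists (fun i => E i `&` F i).
  by move=> i; exact: measurableI.
by rewrite -bigcapI; apply: eq_bigcapr => i _; rewrite preimage_setI.
Qed.

Lemma cylinders_setT J : cylinders J setT.
Proof.
by exists (fun=> setT) => //; apply/esym; rewrite -subTset => x _ i _.
Qed.

Lemma measurable_block (J : {set I}) i : i \in J -> measurable_fun setT (X i : block J -> R).
Proof.
move=> iJ _ E mE; rewrite setTI; apply: sub_sigma_algebra.
exists (fun k => if k == i then E else setT) => [k|]; first by case: ifP.
apply/seteqP; split => [x Ex k _|x /(_ i iJ)] /=; last by rewrite eqxx.
by case: eqP => // ->.
Qed.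

Lemma measurable_to_block J : measurable_fun setT (fun x : T => x : block J).
Proof.
move=> _ A mA; rewrite setTI preimage_id.
have : <<s cylinders J >> `<=` measurable.
  apply: smallest_sub; first exact: sigma_algebra_measurable.
  exact: cylinders_measurable.
exact.
Qed.

Hypothesis indepX : mutually_independent X.

Lemma cylinders_independent (J1 J2 : {set I}) A B : (forall i, i \in J1 -> i \notin J2) ->
  cylinders J1 A -> cylinders J2 B -> (P (A `&` B) = P A * P B)%E.
Proof.
move=> J12 [E mE ->] [F mF ->].
rewrite indepX; last by move=> *; exact: mE.
rewrite indepX; last by move=> *; exact: mF.
pose G i := if i \in J1 then E i else F i.
have -> : \bigcap_(i in [set` J1]) (X i @^-1` E i) `&`
    \bigcap_(i in [set` J2]) (X i @^-1` F i) =
    \bigcap_(i in [set` J1 :|: J2]) (X i @^-1` G i).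
  apply/seteqP; split => [x [h1 h2] i /=|x h].
    rewrite inE /G => /orP[iJ|iJ]; first by rewrite iJ; exact: h1.
    by rewrite (negbTE (contraL (J12 i) iJ)); exact: h2.
  split => i /= iJ; have := h i; rewrite /= inE iJ ?orbT => /(_ isT);
    rewrite /G ?iJ //.
  by rewrite (negbTE (contraL (J12 i) iJ)).
rewrite indepX; last by move=> i _; rewrite /G; case: ifP.
rewrite (bigID (fun i => i \in J1)) /=; congr (_ * _)%E.
  apply: eq_big => [i|i]; rewrite inE.
    by case: (i \in J1); rewrite ?andbF.
  by move=> /andP[_ iJ]; rewrite /G iJ.
apply: eq_big => [i|i]; rewrite inE.
  by case: (boolP (i \in J1)) => [iJ|_]; rewrite /= ?andbT ?(negbTE (J12 i iJ)).
by move=> /andP[_ /negbTE iJ]; rewrite /G iJ.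
Qed.

(** Decoupling the identity maps into [block J1] and [block J2] decouples at once all pairs of
    functions measurable with respect to these two blocks, without naming the random vectors
    involved. *)
Lemma block_decoupling (J1 J2 : {set I}) : (forall i, i \in J1 -> i \notin J2) ->
  same_law P (P \x P)%E (fun x : T => (x : block J1, x : block J2))
    (fun z : T * T => (z.1 : block J1, z.2 : block J2)).
Proof.
move=> J12; apply: (@decoupling R d _ _ T (block J1) (block J2) P idfun idfun).
- exact: measurable_to_block.
- exact: measurable_to_block.
move=> A B mA mB; rewrite !preimage_id.
apply: (@independent_g_sigma_algebra _ _ _ P (cylinders J1) (cylinders J2)) => //.
- exact: cylinders_measurable.
- exact: cylinders_setI.
- exact: cylinders_setT.
- exact: cylinders_measurable.
- exact: cylinders_setI.
- exact: cylinders_setT.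
- by move=> A' B'; exact: cylinders_independent.
Qed.

End blocks.

(** * Polynomial growth and integrability *)

Section growth_functions.
Context {R : realType}.
Implicit Types (q x y w z : R).

(** For q >= 0 a weight comparable with 1 + |x|^q, but with gam(x + y) <= gam(x) gam(y): the
    domination of a function of V + Y factors into one of V and one of Y. *)
Definition gam q x : R := (1 + `|x|) `^ q.

Lemma gam_base_gt0 x : 0 < 1 + `|x|.
Proof. by rewrite ltr_pwDl. Qed.

Lemma gam_gt0 q x : 0 < gam q x.
Proof. by rewrite powR_gt0 // gam_base_gt0. Qed.

Lemma gam_ge0 q x : 0 <= gam q x.
Proof. exact/ltW/gam_gt0. Qed.

Lemma gam_le q q' x : q <= q' -> gam q x <= gam q' x.
Proof. by move=> qq; apply: ler_powR => //; rewrite lerDl. Qed.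

Lemma gam_ge1 q x : 0 <= q -> 1 <= gam q x.
Proof. by move=> q0; apply: le_trans (gam_le x q0); rewrite /gam powRr0. Qed.

Lemma gamD q q' x : gam (q + q') x = gam q x * gam q' x.
Proof. by rewrite /gam powRD //; apply/implyP => _; rewrite gt_eqF // gam_base_gt0. Qed.

Lemma gam_mulD q s c w z : 0 <= q -> `|s| <= 1 -> `|c| <= 1 ->
  gam q (s * w + c * z) <= gam q w * gam q z.
Proof.
move=> q0 s1 c1; rewrite /gam -powRM ?addr_ge0 //.
apply: ge0_ler_powR => //; rewrite ?nnegrE ?addr_ge0 ?mulr_ge0 ?addr_ge0 //.
have := ler_normD (s * w) (c * z); rewrite !normrM.
have h1 : `|s| * `|w| <= `|w| by rewrite ler_piMl.
have h2 : `|c| * `|z| <= `|z| by rewrite ler_piMl.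
have : 0 <= `|w| * `|z| by rewrite mulr_ge0.
lra.
Qed.

Lemma gam_add q w z : 0 <= q -> gam q (w + z) <= gam q w * gam q z.
Proof.
by move=> q0; have := @gam_mulD q 1 1 w z q0; rewrite !mul1r normr1; apply.
Qed.

Lemma gam_scale q s w : 0 <= q -> `|s| <= 1 -> gam q (s * w) <= gam q w.
Proof.
move=> q0 s1; have := @gam_mulD q s 0 w 0 q0 s1.
by rewrite mul0r addr0 normr0 {3}/gam normr0 addr0 powR1 mulr1; apply.
Qed.

(** The maximum is kept because, for r < 1, passing to the sum of the two powers would exceed the
    constant allowed in the splitting below. *)
Lemma powR_add_max q (a b : R) : 0 <= q -> 0 <= a -> 0 <= b ->
  (a + b) `^ q <= 2 `^ q * Num.max a b `^ q.
Proof.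
move=> q0 a0 b0; rewrite -powRM // ?le_max ?a0 //.
apply: ge0_ler_powR => //; rewrite ?nnegrE ?addr_ge0 ?mulr_ge0 ?le_max ?a0 //.
by rewrite /Num.max; case: ifP; lra.
Qed.

Lemma powR_max_le q (a b : R) : Num.max a b `^ q <= a `^ q + b `^ q.
Proof. by rewrite /Num.max; case: ifP => _; rewrite ?lerDl ?lerDr powR_ge0. Qed.

Lemma powR_add_le q (a b : R) : 0 <= q -> 0 <= a -> 0 <= b ->
  (a + b) `^ q <= 2 `^ q * (a `^ q + b `^ q).
Proof.
move=> q0 a0 b0; apply: le_trans (powR_add_max q0 a0 b0) _.
by rewrite ler_wpM2l ?powR_ge0 // powR_max_le.
Qed.

Lemma gam_le_powR q x : 0 <= q -> gam q x <= 2 `^ q * (1 + `|x| `^ q).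
Proof. by move=> q0; have := @powR_add_le q 1 `|x| q0; rewrite powR1; apply. Qed.

Lemma gam_add_le q x y : 0 <= q -> gam q (x + y) <= 2 `^ q * (gam q x + gam q y).
Proof.
move=> q0; apply: le_trans (powR_add_le _ _ _) => //; rewrite ?addr_ge0 //.
apply: ge0_ler_powR; rewrite ?nnegrE ?addr_ge0 //.
have := ler_normD x y; lra.
Qed.

Lemma powR_le_gam q x : 0 <= q -> `|x| `^ q <= gam q x.
Proof.
move=> q0; apply: ge0_ler_powR; rewrite ?nnegrE ?addr_ge0 //; lra.
Qed.

Lemma exprn_le_gam k x : `|x| ^+ k <= gam k%:R x.
Proof. by rewrite -powR_mulrn // powR_le_gam. Qed.

Lemma norm_le_gam x : `|x| <= gam 1 x.
Proof. by have := exprn_le_gam 1 x; rewrite expr1. Qed.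

Lemma measurable_gam q : measurable_fun setT (gam q).
Proof.
apply: (measurableT_comp (measurable_powR q)); apply: measurable_funD => //.
Qed.

End growth_functions.

Section integrability.
Context {R : realType} {d : measure_display} {T : measurableType d}.
Variable P : {measure set T -> \bar R}.

Lemma integrable_dominated (f g : T -> R) : measurable_fun setT f ->
  P.-integrable setT (EFin \o g) -> (forall x, `|f x| <= g x) ->
  P.-integrable setT (EFin \o f).
Proof.
move=> mf ig fg; apply: (@le_integrable _ _ _ _ _ measurableT _ (EFin \o g)) => //.
  exact/measurable_EFinP.
by move=> x _ /=; rewrite lee_fin; apply: le_trans (fg x) (ler_norm _).
Qed.

Lemma integrable_measurable (f : T -> R) : P.-integrable setT (EFin \o f) ->
  measurable_fun setT f.
Proof. by move=> /(measurable_int _)/measurable_EFinP. Qed.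

Lemma integrable_scale c (f : T -> R) : P.-integrable setT (EFin \o f) ->
  P.-integrable setT (EFin \o (fun x => c * f x)).
Proof. by move=> fi; apply: eq_integrable (integrableZl measurableT c fi). Qed.

Lemma integrable_add (f g : T -> R) : P.-integrable setT (EFin \o f) ->
  P.-integrable setT (EFin \o g) -> P.-integrable setT (EFin \o (fun x => f x + g x)).
Proof. by move=> fi gi; apply: eq_integrable (integrableD measurableT fi gi). Qed.

Lemma integrable_sub (f g : T -> R) : P.-integrable setT (EFin \o f) ->
  P.-integrable setT (EFin \o g) -> P.-integrable setT (EFin \o (fun x => f x - g x)).
Proof. by move=> fi gi; apply: eq_integrable (integrableB measurableT fi gi). Qed.

Lemma integrable_sumn n (f : 'I_n -> T -> R) :
  (forall i, P.-integrable setT (EFin \o f i)) ->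
  P.-integrable setT (EFin \o (fun x => \sum_(i < n) f i x)).
Proof.
move=> fi; have := @integrable_sum _ _ _ P setT measurableT 'I_n (index_enum _)
  xpredT (fun i => EFin \o f i) (fun i _ => fi i).
by apply: eq_integrable => // x _ /=; rewrite sumEFin.
Qed.

Lemma Rintegral_sumn n (f : 'I_n -> T -> R) :
  (forall i, P.-integrable setT (EFin \o f i)) ->
  (\int[P]_x (\sum_(i < n) f i x) = \sum_(i < n) \int[P]_x f i x)%R.
Proof.
elim: n f => [|n ih] f fi.
  rewrite big_ord0; under eq_Rintegral do rewrite big_ord0.
  by rewrite Rintegral_cst // mul0r.
rewrite big_ord_recl -ih //; under eq_Rintegral do rewrite big_ord_recl.
by rewrite RintegralD //; apply: integrable_sumn.
Qed.

Lemma le_norm_Rintegral (f : T -> R) : P.-integrable setT (EFin \o f) ->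
  (`|(\int[P]_x f x)%R|%:E <= \int[P]_x `|f x|%:E)%E.
Proof. by move=> fi; rewrite EFin_normr_Rintegral // le_abse_integral //; case/integrableP: fi. Qed.

End integrability.

(** * One summand *)

Section stein_step.
Context {R : realType} {d : measure_display} {T : measurableType d}.
Variable P : probability T R.

(* Integrate [(y^2 - c) (phi |y| - phi (sqrt c)) >= 0]. *)
Lemma second_moment_monotone (Y : T -> R) (phi : R -> R) (c : R) :
  measurable_fun setT Y -> measurable_fun setT phi ->
  0 <= c -> P.-integrable setT (EFin \o (fun x => Y x ^+ 2)) ->
  (\int[P]_x (Y x ^+ 2) = c)%R ->
  (forall t, 0 <= t -> 0 <= phi t) ->
  (forall s t, 0 <= s -> s <= t -> phi s <= phi t) ->
  (c%:E * \int[P]_x (phi `|Y x|)%:E <= \int[P]_x (Y x ^+ 2 * phi `|Y x|)%:E)%E.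
Proof.
move=> mY mphi c0 iY EY phi0 ndphi; set t0 := Num.sqrt c.
have t00 : 0 <= t0 by exact: sqrtr_ge0.
have mp : measurable_fun setT (fun x => phi `|Y x|).
  by apply: (measurableT_comp mphi); exact: measurableT_comp.
have mY2 : measurable_fun setT (fun x => Y x ^+ 2) by exact: measurable_funX.
have pt x : c * phi `|Y x| + phi t0 * Y x ^+ 2 <=
    Y x ^+ 2 * phi `|Y x| + c * phi t0.
  have cE : c = t0 ^+ 2 by rewrite sqr_sqrtr.
  have [yt|ty] := leP `|Y x| t0.
    have h1 : Y x ^+ 2 <= c by rewrite cE -[leLHS]ger0_norm ?sqr_ge0 // normrX lerXn2r // nnegrE.
    have := ndphi _ _ (normr_ge0 _) yt; nra.
  have h1 : c <= Y x ^+ 2 by rewrite cE -[leRHS]ger0_norm ?sqr_ge0 // normrX lerXn2r ?nnegrE // ltW.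
  have := ndphi _ _ t00 (ltW ty); nra.
have e2 : (\int[P]_x (Y x ^+ 2)%:E = c%:E)%E.
  by rewrite -EY /Rintegral fineK //; apply: integrable_fin_num.
rewrite -(@leeD2rE _ (phi t0 * c)%:E) //.
have -> : (c%:E * \int[P]_x (phi `|Y x|)%:E + (phi t0 * c)%:E =
   \int[P]_x (c * phi `|Y x| + phi t0 * Y x ^+ 2)%:E)%E.
  under [RHS]eq_integral do rewrite EFinD.
  rewrite ge0_integralD //; last first.
  - by apply/measurable_EFinP; exact: measurable_funM.
  - by move=> x _; rewrite lee_fin mulr_ge0 ?sqr_ge0 // phi0.
  - by apply/measurable_EFinP; exact: measurable_funM.
  - by move=> x _; rewrite lee_fin mulr_ge0 // phi0.
  congr (_ + _)%E.
    under [RHS]eq_integral do rewrite EFinM.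
    rewrite ge0_integralZl //; first exact/measurable_EFinP.
    by move=> x _; rewrite lee_fin phi0.
  under [RHS]eq_integral do rewrite EFinM.
  rewrite ge0_integralZl ?e2 //; first exact/measurable_EFinP.
    by move=> x _; rewrite lee_fin sqr_ge0.
  by rewrite lee_fin phi0.
have -> : (\int[P]_x (Y x ^+ 2 * phi `|Y x|)%:E + (phi t0 * c)%:E =
   \int[P]_x (Y x ^+ 2 * phi `|Y x| + c * phi t0)%:E)%E.
  under [RHS]eq_integral do rewrite EFinD.
  rewrite ge0_integralD //.
  - congr (_ + _)%E; rewrite (@integral_cst _ _ _ P setT measurableT (c * phi t0)%:E).
    by rewrite [X in (_ * X)%E]probability_setT mule1 mulrC.
  - by move=> x _; rewrite lee_fin mulr_ge0 ?sqr_ge0 // phi0.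
  - by apply/measurable_EFinP; exact: measurable_funM.
  - by move=> x _; rewrite lee_fin mulr_ge0 // phi0.
apply: ge0_le_integral => //.
- by move=> x _; rewrite lee_fin addr_ge0 // mulr_ge0 ?sqr_ge0 // phi0.
- by apply/measurable_EFinP; apply: measurable_funD; exact: measurable_funM.
- by apply/measurable_EFinP; apply: measurable_funD => //; exact: measurable_funM.
by move=> x _; rewrite lee_fin; exact: pt.
Qed.


(** The recurrence turns a_(k+1) E Y^(k+2) / (k+1)! into c a_(k+1) E Y^k / k!, which is the k-th
    term of the second polynomial; the leading term of the first vanishes as E Y = 0. *)
Lemma taylor_moment_cancel p1 (Y : T -> R) (c : R) (a : nat -> R) :
  (0 < p1)%N ->
  (forall k, (k <= p1.+1)%N -> P.-integrable setT (EFin \o (fun x => Y x ^+ k))) ->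
  (\int[P]_x Y x = 0)%R ->
  (forall k, (k < p1)%N ->
    (\int[P]_x (Y x ^+ k.+2) = k.+1%:R * c * \int[P]_x (Y x ^+ k))%R) ->
  let q y := y * (\sum_(k < p1.+1) a k * y ^+ k / k`!%:R) -
    c * (\sum_(k < p1) a k.+1 * y ^+ k / k`!%:R) in
  P.-integrable setT (EFin \o (q \o Y)) /\ (\int[P]_x q (Y x) = 0)%R.
Proof.
move=> p10 iY Y1 Yrec q.
have i1 (k : 'I_p1.+1) : P.-integrable setT
    (EFin \o (fun x => a k / k`!%:R * Y x ^+ k.+1)).
  by apply: integrable_scale; exact: iY.
have i2 (k : 'I_p1) : P.-integrable setT
    (EFin \o (fun x => c * a k.+1 / k`!%:R * Y x ^+ k)).
  by apply: integrable_scale; apply: iY; exact: leqW (ltnW (ltn_ord k)).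
have qE x : q (Y x) = \sum_(k < p1.+1) a k / k`!%:R * Y x ^+ k.+1 -
    \sum_(k < p1) c * a k.+1 / k`!%:R * Y x ^+ k.
  rewrite /q !mulr_sumr; congr (_ - _); apply: eq_bigr => k _.
    by rewrite exprS; ring.
  by ring.
have -> : q \o Y = fun x => \sum_(k < p1.+1) a k / k`!%:R * Y x ^+ k.+1 -
    \sum_(k < p1) c * a k.+1 / k`!%:R * Y x ^+ k.
  by apply/funext.
split; first by apply: integrable_sub; exact: integrable_sumn.
under eq_Rintegral do rewrite qE.
rewrite RintegralB //; [|exact: integrable_sumn|exact: integrable_sumn].
rewrite !Rintegral_sumn //.
rewrite big_ord_recl /= RintegralZl //; last by apply: (iY 1%N); exact: ltnW.
under eq_Rintegral do rewrite expr1.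
rewrite Y1 mulr0 add0r -sumrB big1 // => k _.
rewrite !RintegralZl //; first last.
- by apply: iY; rewrite ltnS.
- by apply: iY; exact: leqW (ltnW (ltn_ord k)).
rewrite Yrec // /bump /= add1n -(factS_inv k).
set u := (Rintegral _ _ _); move: (k.+1`!%:R^-1) (k.+1%:R : R) => v w; ring.
Qed.

(** After decoupling, both functions are expanded around V and the Taylor polynomials have
    expectation zero. [B] depends on |Y| monotonically, which is what allows the remainder of a',
    weighted by c = E Y^2, to be compared with that of Y a. The bound lives in the extended reals,
    so no integrability is asked of [B] here. The order p is [p1.+1]. *)
Lemma stein_step p1 (Y V : T -> R) (c q Q C : R) (a : nat -> R -> R) (B : R -> R -> R) :
  (0 < p1)%N -> 0 <= c -> 0 <= q -> q + 1 <= Q -> p1.+1%:R <= Q ->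
  measurable_fun setT Y -> measurable_fun setT V ->
  P.-integrable setT (EFin \o (gam Q \o Y)) ->
  P.-integrable setT (EFin \o (gam q \o V)) ->
  same_law P (P \x P)%E (fun x => (Y x, V x)) (fun z : T * T => (Y z.1, V z.2)) ->
  (\int[P]_x Y x = 0)%R ->
  (forall k, (k < p1)%N ->
    (\int[P]_x (Y x ^+ k.+2) = k.+1%:R * c * \int[P]_x (Y x ^+ k))%R) ->
  (forall k (x : R), (k < p1.+1)%N -> is_derive x (1 : R) (a k) (a k.+1 x)) ->
  (forall k x, (k <= p1)%N -> `|a k x| <= C * gam q x) ->
  measurable_fun setT (fun z : R * R => B z.1 z.2) ->
  (forall w t, 0 <= t -> 0 <= B w t) ->
  (forall w s t, 0 <= s -> s <= t -> B w s <= B w t) ->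
  (forall w y s : R, `|s| <= `|y| -> `|a p1.+1 (w + s)| <= B w `|y|) ->
  (`| (\int[P]_x (Y x * a 0 (V x + Y x)))%R - c * (\int[P]_x (a 1 (V x + Y x)))%R |%:E
   <= (p1.+2%:R / p1.+1`!%:R)%:E *
      \int[P]_v \int[P]_x (`|Y x| ^+ p1.+2 * B (V v) `|Y x|)%:E)%E.
Proof.
move=> p10 c0 q0 qQ pQ mY mV iY iV law Y1 Yrec da aC mB B0 ndB aB.
have Q0 : 0 <= Q by apply: le_trans pQ.
have C0 : 0 <= C.
  have := le_trans (normr_ge0 _) (aC 0 0 isT).
  by rewrite pmulr_lge0 // gam_gt0.
have ma k : (k <= p1)%N -> measurable_fun setT (a k).
  by move=> kp; apply: continuous_measurable_fun => x; exact: is_derive_continuous (da k x kp).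
(* Domination by a product weight: stable under linear combinations, and sufficient for
   integrability over the product space. *)
pose dom (f : R * R -> R) := measurable_fun setT f /\
  exists2 K, 0 <= K & forall y v, `|f (y, v)| <= K * gam Q y * gam q v.
have domI f : dom f -> (P \x P)%E.-integrable setT (fun z => (f (Y z.1, V z.2))%:E).
  move=> [mf [K K0 fK]].
  apply: (integrable_prod_dominated (u := fun x => K * gam Q (Y x)) (v := gam q \o V)) => //.
  - apply: measurableT_comp mf _; exact: measurable_fun_map_pair.
  - exact: integrable_scale.
  - move=> x y /=; rewrite [`|K * _|]ger0_norm ?[`|gam _ _|]ger0_norm ?mulr_ge0 ?gam_ge0 //.
have domI1 f : dom f -> P.-integrable setT (fun x => (f (Y x, V x))%:E).
  move=> df; have [mf _] := df.
  apply: (@same_law_integrable _ _ _ _ _ _ _ _ _ _ _ _ _ _ (EFin \o f) _ (domI f df)).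
  - exact: measurable_fun_map_pair.
  - exact: measurable_fun_pair.
  - by move=> A mA; rewrite law.
  - exact/measurable_EFinP.
have dom_sub f g : dom f -> dom g -> dom (fun z => f z - g z).
  move=> [mf [K K0 fK]] [mg [K' K0' gK]]; split; first exact: measurable_funB.
  exists (K + K'); first exact: addr_ge0.
  move=> y v; apply: le_trans (ler_normB _ _) _; rewrite !mulrDl; exact: lerD.
have dom_scale k f : dom f -> dom (fun z => k * f z).
  move=> [mf [K K0 fK]]; split; first exact: measurable_funM.
  exists (`|k| * K); first exact: mulr_ge0.
  by move=> y v; rewrite normrM -!mulrA ler_wpM2l // mulrA.
have dom_sum n (f : 'I_n -> R * R -> R) : (forall i, dom (f i)) ->
    dom (fun z => \sum_(i < n) f i z).
  elim: n f => [|n ih] f df.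
    split; first by under eq_fun do rewrite big_ord0; exact: measurable_cst.
    by exists 0 => // y v; rewrite big_ord0 normr0 !mul0r.
  have [mf [K K0 fK]] := df ord0.
  have [mg [K' K0' gK]] := ih (fun i => f (lift ord0 i)) (fun i => df _).
  split; first by under eq_fun do rewrite big_ord_recl; exact: measurable_funD.
  exists (K + K'); first exact: addr_ge0.
  move=> y v; rewrite big_ord_recl.
  by apply: le_trans (ler_normD _ _) _; rewrite !mulrDl; exact: lerD.
have m1 : measurable_fun setT (fst : R * R -> R) by exact: measurable_fst.
have m2 : measurable_fun setT (snd : R * R -> R) by exact: measurable_snd.
have dom_a k e : (k <= p1)%N -> (e <= 1)%N -> dom (fun z => z.1 ^+ e * a k (z.2 + z.1)).
  move=> kp e1; split.
    apply: measurable_funM; first exact: measurable_funX.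
    by apply: measurableT_comp; [exact: ma|exact: measurable_funD].
  exists C => // y v /=; rewrite normrM normrX.
  have h1 : `|y| ^+ e * gam q y <= gam Q y.
    apply: le_trans (gam_le y qQ); rewrite addrC gamD ler_wpM2r ?gam_ge0 //.
    by apply: le_trans (exprn_le_gam _ _) _; apply: gam_le; rewrite lern1.
  apply: (@le_trans _ _ (`|y| ^+ e * (C * (gam q v * gam q y)))).
    rewrite ler_wpM2l ?exprn_ge0 //; apply: le_trans (aC _ _ kp) _.
    by rewrite ler_wpM2l // gam_add.
  have -> : `|y| ^+ e * (C * (gam q v * gam q y)) = C * gam q v * (`|y| ^+ e * gam q y).
    by ring.
  by rewrite [leRHS]mulrAC ler_wpM2l // mulr_ge0 ?gam_ge0.
have dom_t k e (b : R) : (k <= p1)%N -> (e <= p1.+1)%N -> dom (fun z => b * (a k z.2 * z.1 ^+ e)).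
  move=> kp ep; apply: dom_scale; split.
    apply: measurable_funM; last exact: measurable_funX.
    by apply: measurableT_comp; [exact: ma|].
  exists C => // y v /=; rewrite normrM normrX.
  rewrite [leRHS]mulrAC; apply: ler_pM => //; rewrite ?exprn_ge0 //; first exact: aC.
  apply: le_trans (exprn_le_gam _ _) _; apply: gam_le; apply: le_trans pQ.
  by rewrite ler_nat.
pose F (z : R * R) := z.1 * a 0 (z.2 + z.1) - c * a 1 (z.2 + z.1).
pose S0 (y v : R) := \sum_(k < p1.+1) a k v * y ^+ k / k`!%:R.
pose S1 (y v : R) := \sum_(k < p1) a k.+1 v * y ^+ k / k`!%:R.
pose q' (z : R * R) := z.1 * S0 z.1 z.2 - c * S1 z.1 z.2.
have dF1 : dom (fun z => z.1 * a 0 (z.2 + z.1)).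
  by have := dom_a 0 1 isT isT; under eq_fun do rewrite expr1.
have dF2 : dom (fun z => c * a 1 (z.2 + z.1)).
  apply: dom_scale; have := dom_a 1%N 0%N p10 isT.
  by under eq_fun do rewrite expr0 mul1r.
have dF : dom F by exact: dom_sub.
have dq : dom q'.
  have -> : q' = fun z => \sum_(k < p1.+1) k`!%:R^-1 * (a k z.2 * z.1 ^+ k.+1) -
      \sum_(k < p1) (c / k`!%:R) * (a k.+1 z.2 * z.1 ^+ k).
    apply/funext => z; rewrite /q' /S0 /S1 !mulr_sumr; congr (_ - _).
      by apply: eq_bigr => k _; rewrite exprS; ring.
    by apply: eq_bigr => k _; ring.
  apply: dom_sub; apply: dom_sum => k; apply: dom_t => //; last exact: leqW (ltnW (ltn_ord k)).
  by rewrite -ltnS.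
have iDq : (P \x P)%E.-integrable setT (fun z => (F (Y z.1, V z.2) - q' (Y z.1, V z.2))%:E).
  by apply: (domI (fun z => F z - q' z)); exact: dom_sub.
have intq : (\int[(P \x P)%E]_z q' (Y z.1, V z.2) = 0)%R.
  have iYk k : (k <= p1.+1)%N -> P.-integrable setT (EFin \o (fun x => Y x ^+ k)).
    move=> kp; apply: integrable_dominated iY _; first exact: measurable_funX.
    move=> x /=; rewrite normrX; apply: le_trans (exprn_le_gam _ _) _.
    by apply: gam_le; apply: le_trans pQ; rewrite ler_nat.
  have cancel v := @taylor_moment_cancel p1 Y c (fun k => a k v) p10 iYk Y1 Yrec.
  rewrite (@Rintegral_prod2 R _ _ T T P P (fun z => q' (Y z.1, V z.2))); last 2 first.
  - exact: domI.
  - by move=> y; case: (cancel (V y)).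
  transitivity (\int[P]_(y in setT) cst 0 y)%R; last by rewrite Rintegral_cst // mul0r.
  by apply: eq_Rintegral => y _; exact: (cancel (V y)).2.
have -> : ((\int[P]_x (Y x * a 0 (V x + Y x))) - c * (\int[P]_x (a 1 (V x + Y x))) =
    \int[(P \x P)%E]_z (F (Y z.1, V z.2) - q' (Y z.1, V z.2)))%R.
  rewrite RintegralB //; [|exact: domI|exact: domI].
  rewrite intq subr0.
  rewrite -(@same_law_Rintegral _ _ _ _ _ _ _ _ _ _ _ _ _ law F); last 3 first.
  - exact: measurable_fun_pair.
  - exact: measurable_fun_map_pair.
  - by case: dF.
  rewrite RintegralB //; [|exact: (domI1 _ dF1)|exact: (domI1 _ dF2)].
  rewrite RintegralZl //; have := domI1 _ (dom_a 1%N 0%N p10 isT).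
  by under eq_fun do rewrite expr0 mul1r.
(* The expansion has p terms for a and p - 1 terms for a', so both remainders involve the p-th
   derivative of a, bounded by [B] on the whole segment. *)
have DB y v : `|F (y, v) - q' (y, v)| <=
    B v `|y| * (`|y| ^+ p1.+2 / p1.+1`!%:R + c * `|y| ^+ p1 / p1`!%:R).
  have -> : F (y, v) - q' (y, v) =
      y * (a 0 (v + y) - S0 y v) - c * (a 1 (v + y) - S1 y v).
    by rewrite /F /q' /=; ring.
  apply: le_trans (ler_normB _ _) _; rewrite !normrM mulrDr (ger0_norm c0).
  have hs s : Num.min 0 y <= s <= Num.max 0 y -> `|s| <= `|y|.
    rewrite /Num.min /Num.max; case: ifPn => y0 /andP[s1 s2].
      by rewrite (gtr0_norm y0) ger0_norm.
    have y0' : y <= 0 by rewrite leNgt.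
    by rewrite (ler0_norm y0') ler0_norm // lerN2.
  apply: lerD.
    have := @taylor_bound R p1.+1 a v y (B v `|y|) (fun k z => da k z)
      (fun s h => aB _ _ _ (hs s h)).
    move=> /(ler_wpM2l (normr_ge0 y)) h; apply: le_trans h _.
    by rewrite [`|y| ^+ p1.+2]exprS; rewrite le_eqVlt; apply/orP; left; apply/eqP; ring.
  have := @taylor_bound R p1 (fun k => a k.+1) v y (B v `|y|) (fun k z kp => da k.+1 z kp)
    (fun s h => aB _ _ _ (hs s h)).
  move=> /(ler_wpM2l c0) h; apply: le_trans h _.
  by rewrite le_eqVlt; apply/orP; left; apply/eqP; ring.
pose bnd (z : R * R) := B z.2 `|z.1| * (`|z.1| ^+ p1.+2 / p1.+1`!%:R + c * `|z.1| ^+ p1 / p1`!%:R).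
have bnd0 z : 0 <= bnd z.
  rewrite /bnd mulr_ge0 ?B0 // addr_ge0 // ?divr_ge0 ?mulr_ge0 ?exprn_ge0 //.
have mn : measurable_fun setT (fun z : R * R => `|z.1|) by exact: measurableT_comp.
have mB' : measurable_fun setT (fun z : R * R => B z.2 `|z.1|).
  exact: (measurableT_comp mB (measurable_fun_pair m2 mn)).
have mbnd : measurable_fun setT bnd.
  apply: measurable_funM => //; apply: measurable_funD; apply: measurable_funM => //.
    exact: measurable_funX.
  by apply: measurable_funM => //; exact: measurable_funX.
have mYV := measurable_fun_map_pair mY mV.
apply: le_trans (le_norm_Rintegral iDq) _.
apply: (@le_trans _ _ (\int[(P \x P)%E]_z (bnd (Y z.1, V z.2))%:E)%E).
  apply: ge0_le_integral => //.
  - apply/measurable_EFinP; apply: measurableT_comp => //.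
    exact: integrable_measurable iDq.
  - apply/measurable_EFinP; exact: measurableT_comp mbnd mYV.
  - by move=> z _; rewrite lee_fin; exact: DB.
have mbndYV : measurable_fun setT (fun z => (bnd (Y z.1, V z.2))%:E).
  apply/measurable_EFinP; exact: measurableT_comp mbnd mYV.
rewrite fubini_tonelli2 //; last by move=> z; rewrite lee_fin.
pose G0 (z : T * T) := `|Y z.1| ^+ p1.+2 * B (V z.2) `|Y z.1|.
have mG0 : measurable_fun setT (fun z => (G0 z)%:E).
  apply/measurable_EFinP; apply: measurable_funM.
    apply: measurable_funX; apply: measurableT_comp => //; exact: measurableT_comp mY measurable_fst.
  exact: measurableT_comp mB' mYV.
have G00 z : (0 <= (G0 z)%:E)%E by rewrite lee_fin mulr_ge0 ?exprn_ge0 ?B0.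
have inner v : (\int[P]_x (bnd (Y x, V v))%:E <=
    (p1.+2%:R / p1.+1`!%:R)%:E * \int[P]_x (G0 (x, v))%:E)%E.
  have G1 x : bnd (Y x, V v) = p1.+1`!%:R^-1 * G0 (x, v) +
      p1`!%:R^-1 * (c * (`|Y x| ^+ p1 * B (V v) `|Y x|)).
    by rewrite /bnd /G0 /=; ring.
  have mBv : measurable_fun setT (fun t => B (V v) t).
    exact: (measurable_fun_pair2 (V v) mB).
  have mYn : measurable_fun setT (fun x => `|Y x|) by exact: measurableT_comp.
  have mG0v : measurable_fun setT (fun x => (G0 (x, v))%:E).
    exact: (measurable_fun_pair1 v mG0).
  (* With this phi, c E phi(|Y|) is the remainder with |Y|^(p-1), and E Y^2 phi(|Y|) the one with
     |Y|^(p+1). *)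
  pose phi t := t ^+ p1 * B (V v) t.
  have mphi : measurable_fun setT phi by apply: measurable_funM => //; exact: measurable_funX.
  have mphiY : measurable_fun setT (fun x => (phi `|Y x|)%:E).
    by apply/measurable_EFinP; exact: measurableT_comp mphi mYn.
  have phi0 t : 0 <= t -> 0 <= phi t by move=> t0; rewrite mulr_ge0 ?exprn_ge0 ?B0.
  have iYk k : (k <= p1.+1)%N -> P.-integrable setT (EFin \o (fun x => Y x ^+ k)).
    move=> kp; apply: integrable_dominated iY _; first exact: measurable_funX.
    move=> x /=; rewrite normrX; apply: le_trans (exprn_le_gam _ _) _.
    by apply: gam_le; apply: le_trans pQ; rewrite ler_nat.
  have Y2 : (\int[P]_x (Y x ^+ 2) = c)%R.
    rewrite Yrec // mul1r; under eq_Rintegral do rewrite expr0.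
    by rewrite (@Rintegral_cst _ _ _ P setT measurableT 1) [X in fine X]probability_setT mul1r mulr1.
  have mono := @second_moment_monotone Y phi c mY mphi c0 (iYk 2%N p10) Y2 phi0 _.
  under eq_integral do rewrite G1 EFinD.
  rewrite ge0_integralD //; last 4 first.
  - by move=> x _; rewrite lee_fin mulr_ge0 ?invr_ge0 //; exact: G00 (x, v).
  - apply/measurable_EFinP; apply: measurable_funM => //; exact/measurable_EFinP.
  - by move=> x _; rewrite lee_fin mulr_ge0 ?invr_ge0 // mulr_ge0 // phi0.
  - apply/measurable_EFinP; apply: measurable_funM => //; apply: measurable_funM => //.
    exact/measurable_EFinP.
  (* The weights 1/p! and 1/(p-1)! of the two remainders add up to (p+1)/p!. *)
  have -> : (p1.+2%:R / p1.+1`!%:R)%:E = ((p1.+1`!%:R)^-1%:E + (p1`!%:R)^-1%:E)%E :> \bar R.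
    rewrite -EFinD; congr EFin; rewrite -(factS_inv p1) -[p1.+2]addn1 natrD.
    by rewrite mulrDl addrC mul1r.
  rewrite ge0_muleDl ?lee_fin ?invr_ge0 //; apply: leeD.
    under eq_integral do rewrite EFinM.
    by rewrite ge0_integralZl // lee_fin.
  under eq_integral do rewrite EFinM.
  rewrite ge0_integralZl //; last 2 first.
  - apply/measurable_EFinP; apply: measurable_funM => //; exact/measurable_EFinP.
  - by move=> x _; rewrite lee_fin mulr_ge0 // phi0.
  apply: lee_wpmul2l; first by rewrite lee_fin.
  under eq_integral do rewrite EFinM.
  rewrite ge0_integralZl //; last by move=> x _; rewrite lee_fin phi0.
  have -> : (\int[P]_x (G0 (x, v))%:E = \int[P]_x (Y x ^+ 2 * phi `|Y x|)%:E)%E.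
    apply: eq_integral => x _; congr EFin; rewrite /G0 /phi /= mulrA.
    by rewrite -[Y x ^+ 2]real_normK ?num_real // -exprD add2n.
  apply: mono => s t s0 st; apply: ler_pM; rewrite ?exprn_ge0 ?B0 //.
    by rewrite lerXn2r // nnegrE // (le_trans s0).
  exact: ndB.
have mI : measurable_fun setT (fun v => \int[P]_x (G0 (x, v))%:E)%E.
  refine (@measurable_fun_fubini_tonelli_G _ _ _ _ _ P _ mG0 G00).
have mI' : measurable_fun setT (fun v => \int[P]_x (bnd (Y x, V v))%:E)%E.
  refine (@measurable_fun_fubini_tonelli_G _ _ _ _ _ P _ mbndYV _) => z; by rewrite lee_fin.
have I0 v : (0 <= \int[P]_x (G0 (x, v))%:E)%E.
  by apply: integral_ge0 => x _; exact: G00 (x, v).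
have I0' v : (0 <= \int[P]_x (bnd (Y x, V v))%:E)%E.
  by apply: integral_ge0 => x _; rewrite lee_fin.
have k0 : 0 <= p1.+2%:R / p1.+1`!%:R :> R by rewrite divr_ge0.
have -> : ((p1.+2%:R / p1.+1`!%:R)%:E * \int[P]_v \int[P]_x (G0 (x, v))%:E =
    \int[P]_v ((p1.+2%:R / p1.+1`!%:R)%:E * \int[P]_x (G0 (x, v))%:E))%E.
  by rewrite ge0_integralZl.
apply: ge0_le_integral => //.
- by move=> v _; exact: I0'.
- exact: measurable_funeM.
by move=> v _; exact: inner.
Qed.

End stein_step.

(** * Splitting the growth of a summand *)

Section powR_inequalities.
Context {R : realType}.

(** Convexity of t^m in the form of a tangent at a. Young's inequality and Jensen's inequality are
    both drawn from it. *)
Lemma powR_tangent (m t a : R) : 1 <= m -> 0 <= t -> 0 <= a ->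
  a `^ m + m * a `^ (m - 1) * (t - a) <= t `^ m.
Proof.
move=> m1 t0 a0; have m0 : 0 < m by lra.
have [->|ma] := eqVneq m 1.
  by rewrite subrr powRr0 !powRr1 //; lra.
have m10 : m - 1 != 0 by lra.
have [->|an] := eqVneq a 0.
  by rewrite (powR0 (lt0r_neq0 m0)) (powR0 m10) mulr0 mul0r addr0 powR_ge0.
have {an}a0 : 0 < a by rewrite lt_neqAle eq_sym an.
have pm x : 0 < x -> x `^ (m - 1) * x = x `^ m.
  move=> x0; rewrite -{2}[x]powRr1 ?ltW // -powRD; first by rewrite subrK.
  by apply/implyP => _; rewrite gt_eqF.
have [->|tn] := eqVneq t 0.
  rewrite powR0 ?gt_eqF // sub0r mulrN -mulrA pm //.
  have := powR_ge0 a m; nra.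
have {tn}t0 : 0 < t by rewrite lt_neqAle eq_sym tn.
have H x y : 0 < x -> x < y -> exists2 c, x <= c <= y & y `^ m - x `^ m = m * c `^ (m - 1) * (y - x).
  move=> x0 xy.
  have d z : z \in `]x, y[ -> is_derive z (1 : R) (fun z => z `^ m) (m * z `^ (m - 1)).
    by rewrite in_itv /= => /andP[xz _]; apply: is_derive1_powR; exact: lt_trans xz.
  have [|c] := MVT xy d.
    apply: continuous_in_subspaceT => z; rewrite inE /= in_itv /= => /andP[xz _].
    apply: (@is_derive_continuous R (fun z => z `^ m) (fun z => m * z `^ (m - 1))).
    by apply: is_derive1_powR; exact: lt_le_trans xz.
  by rewrite in_itv /= => /andP[/ltW xc /ltW cy] e; exists c; rewrite ?xc.
have mon x y : 0 < x -> x <= y -> x `^ (m - 1) <= y `^ (m - 1).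
  move=> x0 xy; apply: ge0_ler_powR; rewrite ?nnegrE; lra.
have [ta|at_|->] := ltgtP t a; last by rewrite subrr mulr0 addr0.
  have [c /andP[tc ca] e] := H _ _ t0 ta.
  have := mon _ _ (lt_le_trans t0 tc) ca => h.
  have : m * c `^ (m - 1) * (a - t) <= m * a `^ (m - 1) * (a - t).
    by rewrite ler_wpM2r ?subr_ge0 ?(ltW ta) // ler_wpM2l // ltW.
  lra.
have [c /andP[ac ct] e] := H _ _ a0 at_.
have h := mon _ _ a0 ac.
have : m * a `^ (m - 1) * (t - a) <= m * c `^ (m - 1) * (t - a).
  by rewrite ler_wpM2r ?subr_ge0 ?(ltW at_) // ler_wpM2l // ltW.
lra.
Qed.

(** The tangent inequality for t^((q+r)/q) at the point b^q, evaluated at a^q. *)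
Lemma powR_young (q r a b : R) : 0 < q -> 0 <= r -> 0 <= a -> 0 <= b ->
  a `^ q * b `^ r <= (q / (q + r)) * a `^ (q + r) + (r / (q + r)) * b `^ (q + r).
Proof.
move=> q0 r0 a0 b0; have qr0 : 0 < q + r by lra.
have m1 : 1 <= (q + r) / q by rewrite ler_pdivlMr //; lra.
have := powR_tangent m1 (powR_ge0 a q) (powR_ge0 b q).
rewrite -!powRrM.
have -> : q * ((q + r) / q) = q + r by field; lra.
have -> : q * ((q + r) / q - 1) = r by field; lra.
have e : b `^ r * b `^ q = b `^ (q + r).
  have [b1|b1] := eqVneq b 0; last by rewrite -powRD 1?addrC //; apply/implyP.
  by rewrite b1 [0 `^ q]powR0 ?gt_eqF // mulr0 powR0 // gt_eqF.
move=> h; rewrite -(ler_pM2l (_ : 0 < (q + r) / q)) ?divr_gt0 //.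
have -> : (q + r) / q * (q / (q + r) * a `^ (q + r) + r / (q + r) * b `^ (q + r)) =
    a `^ (q + r) + r / q * b `^ (q + r) by field; lra.
apply: le_trans (_ : _ <= a `^ (q + r) - b `^ (q + r) + (q + r) / q * b `^ (q + r)) _.
  rewrite -e; nra.
by rewrite le_eqVlt; apply/orP; left; apply/eqP; field; lra.
Qed.

Lemma ln2_ge : 2^-1 <= ln 2 :> R.
Proof.
rewrite -ler_expR lnK ?posrE //.
have := expR_ge1Dx (- 2^-1 : R); rewrite expRN => h.
have e0 := expR_gt0 (2^-1 : R).
by rewrite -[leRHS]invrK -[leLHS]invrK lef_pV2 ?posrE ?invr_gt0 //; lra.
Qed.

(** Since ln 2 >= 1/2. It absorbs the loss r/2 of [powR_mul_max] into one factor 2^r. *)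
Lemma powR2_ge (r : R) : 0 <= r -> 1 + r / 2 <= 2 `^ r.
Proof.
move=> r0; rewrite /powR ifF; last by rewrite gt_eqF.
by apply: le_trans (expR_ge1Dx _); rewrite lerD2l ler_wpM2l // ln2_ge.
Qed.

(* Young's inequality makes the loss in replacing [max a b] by [a] of order r,
   which is what keeps the constant below [2 `^ r]. *)
Lemma powR_mul_max (q r a b : R) : 2 <= q -> 0 <= r -> 0 <= a -> 0 <= b ->
  a `^ q * Num.max a b `^ r <= a `^ (q + r) + (r / 2) * b `^ (q + r).
Proof.
move=> q2 r0 a0 b0; have q0 : 0 < q by lra.
have [ba|ab] := leP b a.
  have e : a `^ q * a `^ r = a `^ (q + r).
    by rewrite -powRD //; apply/implyP => /eqP; lra.
  by rewrite e lerDl mulr_ge0 ?powR_ge0 // divr_ge0.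
apply: le_trans (powR_young q0 r0 a0 b0) _; apply: lerD.
  by rewrite ler_piMl ?powR_ge0 // ler_pdivrMr; lra.
rewrite ler_wpM2r ?powR_ge0 // ler_wpM2l // lef_pV2 ?posrE; lra.
Qed.

End powR_inequalities.

(** The price of separating V from Y in |V + Y|^r. It is higher for r < 1, but subadditivity then
    makes the other splitting, of |s w + c z|^r, free of charge ([add_const]): the two constants
    multiply to 4^r in either case. *)
Definition split_const (R : realType) (r : R) : R :=
  if r < 1 then 2 `^ r * 2 `^ r else 2 `^ r.

Lemma measurable_Rintegral_param (R : realType) (d1 d2 : measure_display)
    (T1 : measurableType d1) (T2 : measurableType d2)
    (P : {sigma_finite_measure set T2 -> \bar R}) (f : T1 * T2 -> R) :
  measurable_fun setT f -> (forall z, 0 <= f z) ->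
  (forall t, P.-integrable setT (fun x => (f (t, x))%:E)) ->
  measurable_fun setT (fun t => \int[P]_x f (t, x))%R.
Proof.
move=> mf f0 fi; apply/measurable_EFinP.
have mF : measurable_fun setT (EFin \o f) by exact/measurable_EFinP.
have fE0 z : (0 <= (EFin \o f) z)%E by rewrite lee_fin.
have := @measurable_fun_fubini_tonelli_F _ _ T1 T2 R P (EFin \o f) mF fE0.
apply: eq_measurable_fun => t _ /=.
by rewrite /Rintegral /fubini_F fineK //; apply: integrable_fin_num.
Qed.

Section splitting.
Context {R : realType} {d : measure_display} {T : measurableType d}.
Variable P : probability T R.
Variables (Y V : T -> R) (r q : R).
Hypotheses (r0 : 0 <= r) (q2 : 2 <= q).
Hypotheses (mY : measurable_fun setT Y) (mV : measurable_fun setT V).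
Hypothesis iY : P.-integrable setT (EFin \o (gam (q + r) \o Y)).
Hypothesis iV : P.-integrable setT (EFin \o (gam r \o V)).
Hypothesis law : same_law P (P \x P)%E
  (fun x => (Y x, V x)) (fun z : T * T => (Y z.1, V z.2)).
Hypothesis Y1 : (\int[P]_x Y x = 0)%R.

(** The growth is separated into a part in w and a part in |y|, uniformly over |s| <= |y|, each part
    being charged to a moment of the final bound. In the application q is p + 1. *)
Let splittable := exists g1 g2 : R -> R,
  [/\ measurable_fun setT g1 /\ measurable_fun setT g2,
      (forall w, 0 <= g1 w) /\ (forall t, 0 <= g2 t),
      (forall s t, 0 <= s -> s <= t -> g2 s <= g2 t),
      (forall w s y : R, `|s| <= `|y| -> `|w + s| `^ r <= g1 w + g2 `|y|) &
  [/\ P.-integrable setT (EFin \o (g1 \o V)),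
      (\int[P]_x g1 (V x) <= split_const r * \int[P]_x (`|V x + Y x| `^ r))%R,
      P.-integrable setT (EFin \o (fun x => `|Y x| `^ q * g2 `|Y x|)) &
      (\int[P]_x (`|Y x| `^ q * g2 `|Y x|) <=
        split_const r * \int[P]_x (`|Y x| `^ (q + r)))%R]].

Let q0 : 0 < q. Proof. by move: q2; lra. Qed.

Let mpow e (f : T -> R) : measurable_fun setT f ->
  measurable_fun setT (fun x => `|f x| `^ e).
Proof. by move=> mf; apply: (measurableT_comp (measurable_powR e)); exact: measurableT_comp. Qed.

Let iYpow e : 0 <= e <= q + r -> P.-integrable setT (EFin \o (fun x => `|Y x| `^ e)).
Proof.
move=> /andP[e0 eq]; apply: integrable_dominated iY _; first exact: mpow.
move=> x /=; rewrite ger0_norm ?powR_ge0 //.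
by apply: le_trans (powR_le_gam _ e0) _; exact: gam_le.
Qed.

Let iVpow : P.-integrable setT (EFin \o (fun x => `|V x| `^ r)).
Proof.
apply: integrable_dominated iV _; first exact: mpow.
by move=> x /=; rewrite ger0_norm ?powR_ge0 // powR_le_gam.
Qed.

Let iYr : P.-integrable setT (EFin \o (gam r \o Y)).
Proof.
apply: integrable_dominated iY _; first exact: measurableT_comp (measurable_gam r) mY.
by move=> x /=; rewrite ger0_norm ?gam_ge0 // gam_le // lerDr ltW.
Qed.

Let iW : P.-integrable setT (EFin \o (fun x => `|V x + Y x| `^ r)).
Proof.
have mVY : measurable_fun setT (fun x => V x + Y x) by exact: measurable_funD.
apply: (integrable_dominated (g := fun x => 2 `^ r * (gam r (V x) + gam r (Y x)))).
- exact: mpow.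
- by apply: integrable_scale; exact: integrable_add.
move=> x /=; rewrite ger0_norm ?powR_ge0 //.
by apply: le_trans (powR_le_gam _ r0) _; exact: gam_add_le.
Qed.

Let YqM e x : 0 <= e -> `|Y x| `^ q * `|Y x| `^ e = `|Y x| `^ (q + e).
Proof.
move=> e0; rewrite -powRD //; apply/implyP => /eqP h.
by have := ltr_wpDr e0 q0; rewrite h ltxx.
Qed.

(** As Y has mean zero, Jensen's inequality gives |v|^r <= E|v + Y|^r for every v, and integrating
    over v = V gives E|V|^r <= E|V + Y|^r after decoupling. *)
Lemma splittable_ge1 : 1 <= r -> splittable.
Proof.
move=> r1; have kE : split_const r = 2 `^ r by rewrite /split_const ltNge r1.
exists (fun w => 2 `^ r * `|w| `^ r), (fun t => 2 `^ r * `|t| `^ r); rewrite kE.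
have mp : measurable_fun setT (fun t : R => 2 `^ r * `|t| `^ r).
  apply: measurable_funM => //; apply: (measurableT_comp (measurable_powR r)) => //.
split.
- by split; exact: mp.
- by split => t; rewrite mulr_ge0 ?powR_ge0.
- move=> s t s0 st; rewrite ler_wpM2l ?powR_ge0 //.
  by apply: ge0_ler_powR; rewrite ?nnegrE // ?ger0_norm // (le_trans s0).
- move=> w s y sy; rewrite normr_id -mulrDr.
  apply: le_trans (powR_add_le r0 (normr_ge0 w) (normr_ge0 y)).
  apply: ge0_ler_powR; rewrite ?nnegrE ?addr_ge0 //.
  by apply: le_trans (ler_normD _ _) _; rewrite lerD2l.
split.
- exact: integrable_scale.
- rewrite RintegralZl; [|exact: measurableT|exact: iVpow].
  apply: ler_wpM2l; first exact: powR_ge0.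
  rewrite (@same_law_Rintegral _ _ _ _ _ _ _ _ _ _ _ _ _ law (fun z => `|z.2 + z.1| `^ r)); last 3 first.
  - exact: measurable_fun_pair.
  - exact: measurable_fun_map_pair.
  - apply: (measurableT_comp (measurable_powR r)); apply: measurableT_comp => //.
    by apply: measurable_funD; [exact: measurable_snd|exact: measurable_fst].
  have iYv (v : R) : P.-integrable setT (fun x => (`|v + Y x| `^ r)%:E).
    apply: (integrable_dominated (g := fun x => gam r v * gam r (Y x))).
    - apply: mpow; exact: measurable_funD.
    - exact: integrable_scale.
    - move=> x /=; rewrite ger0_norm ?powR_ge0 //.
      by apply: le_trans (powR_le_gam _ r0) _; exact: gam_add.
  have jensen (v : R) : `|v| `^ r <= (\int[P]_x (`|v + Y x| `^ r))%R.
    have iY1 : P.-integrable setT (EFin \o Y).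
      apply: integrable_dominated iY _ => // x /=.
      apply: le_trans (norm_le_gam _) _; apply: gam_le; move: q2 r0; lra.
    have icst (c : R) : P.-integrable setT (EFin \o cst c).
      exact: finite_measure_integrable_cst.
    have ivY : P.-integrable setT (EFin \o (fun x => v + Y x)).
      by apply: integrable_add => //; exact: icst.
    have ivYn : P.-integrable setT (EFin \o (fun x => `|v + Y x|)).
      exact: integrable_norm ivY.
    have cstE (c : R) : (\int[P]_x cst c x = c)%R.
      by rewrite Rintegral_cst // [X in fine X]probability_setT mulr1.
    set m := (\int[P]_x `|v + Y x|)%R.
    have m0 : 0 <= m by exact: Rintegral_ge0.
    have vm : `|v| <= m.
      have -> : v = (\int[P]_x (v + Y x))%R.
        by rewrite (RintegralD _ (icst v)) // cstE Y1 addr0.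
      exact: le_normr_Rintegral.
    apply: (@le_trans _ _ (m `^ r)); first by apply: ge0_ler_powR; rewrite ?nnegrE.
    have i1 : P.-integrable setT (EFin \o (fun x => r * m `^ (r - 1) * (`|v + Y x| - m))).
      by apply: integrable_scale; apply: integrable_sub => //; exact: icst.
    (* The tangent to t^r at m = E|v + Y| has expectation m^r along |v + Y|. *)
    have <- : (\int[P]_x (m `^ r + r * m `^ (r - 1) * (`|v + Y x| - m)))%R = m `^ r.
      rewrite (RintegralD _ (icst (m `^ r))) // cstE RintegralZl //; last first.
        by apply: integrable_sub => //; exact: icst.
      by rewrite (RintegralB _ ivYn (icst m)) // cstE -/m subrr mulr0 addr0.
    apply: le_Rintegral => //.
    - by apply: integrable_add => //; exact: icst.
    - exact: iYv.
    - by move=> x _; exact: powR_tangent.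
  pose f (z : T * T) := `|V z.2 + Y z.1| `^ r.
  have fi : (P \x P)%E.-integrable setT (EFin \o f).
    apply: (@same_law_integrable _ _ _ _ _ _ _ _ _ _ _ _ _ law (EFin \o (fun z : R * R => `|z.2 + z.1| `^ r))) => //.
    + exact: measurable_fun_pair.
    + exact: measurable_fun_map_pair.
    + apply/measurable_EFinP; apply: (measurableT_comp (measurable_powR r)); apply: measurableT_comp => //.
      by apply: measurable_funD; [exact: measurable_snd|exact: measurable_fst].
  rewrite (Rintegral_prod2 (f := f) fi (fun v => iYv (V v))).
  apply: le_Rintegral => //.
    exact: (integrable_Rintegral_prod2 fi (fun v => iYv (V v))).
- rewrite (_ : _ \o _ = EFin \o (fun x => 2 `^ r * `|Y x| `^ (q + r))).
    by apply: integrable_scale; apply: iYpow; rewrite lexx andbT addr_ge0 // ltW.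
  by apply/funext => x /=; rewrite normr_id mulrCA YqM.
rewrite -RintegralZl //; last by apply: iYpow; rewrite lexx andbT addr_ge0 // ltW.
by under eq_Rintegral do rewrite normr_id mulrCA YqM //.
Qed.

(** For x = a and x = b, x = x^r x^(1-r) <= x^r (a + b)^(1-r); the two inequalities are added. *)
Lemma powR_subadditive (a b : R) : r <= 1 -> 0 <= a -> 0 <= b ->
  (a + b) `^ r <= a `^ r + b `^ r.
Proof.
move=> r1 a0 b0; have [->|an] := eqVneq a 0; first by rewrite add0r lerDr powR_ge0.
have s0 : 0 < a + b by rewrite ltr_wpDr // lt_neqAle eq_sym an.
have r1' : 0 <= 1 - r by rewrite subr_ge0.
have split_pow x : 0 < x -> x = x `^ r * x `^ (1 - r).
  move=> x0; rewrite -powRD; first by rewrite addrC subrK powRr1 // ltW.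
  by apply/implyP => _; rewrite gt_eqF.
have part x : 0 <= x -> x <= a + b -> x <= x `^ r * (a + b) `^ (1 - r).
  move=> x0 xs; have [->|xn] := eqVneq x 0; first by rewrite mulr_ge0 ?powR_ge0.
  rewrite {1}(split_pow x); last by rewrite lt_neqAle eq_sym xn.
  by rewrite ler_wpM2l ?powR_ge0 //; apply: ge0_ler_powR; rewrite ?nnegrE // ltW.
rewrite -(ler_pM2r (powR_gt0 (1 - r) s0)) -split_pow // mulrDl.
by apply: lerD; apply: part; rewrite ?lerDl ?lerDr.
Qed.

(** From |w + s| <= |w + Y'| + (|y| + |Y'|) and subadditivity. At w = V the first term has
    expectation exactly E|V + Y|^r by decoupling, and the second contributes at most 2^r max(|y|,
    |Y'|)^r. *)
Lemma splittable_lt1 : r < 1 -> splittable.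
Proof.
move=> r1; have kE : split_const r = 2 `^ r * 2 `^ r by rewrite /split_const r1.
have r2 : 1 <= 2 `^ r.
  by apply: le_trans (powR2_ge r0); rewrite lerDl divr_ge0.
have mYn : measurable_fun setT (fun x => `|Y x|) by exact: measurableT_comp.
have cstE (c : R) : (\int[P]_x cst c x = c)%R.
  by rewrite Rintegral_cst // [X in fine X]probability_setT mulr1.
have icst (c : R) : P.-integrable setT (EFin \o cst c).
  exact: finite_measure_integrable_cst.
have iYv (v : R) : P.-integrable setT (fun x => (`|v + Y x| `^ r)%:E).
  apply: (integrable_dominated (g := fun x => gam r v * gam r (Y x))).
  - apply: mpow; exact: measurable_funD.
  - exact: integrable_scale.
  - move=> x /=; rewrite ger0_norm ?powR_ge0 //.
    by apply: le_trans (powR_le_gam _ r0) _; exact: gam_add.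
have mmax (t : R) : measurable_fun setT (fun x => Num.max `|t| `|Y x| `^ r).
  apply: (measurableT_comp (measurable_powR r)); exact: measurable_maxr.
have imax (t : R) : P.-integrable setT (EFin \o (fun x => Num.max `|t| `|Y x| `^ r)).
  apply: (integrable_dominated (g := fun x => `|t| `^ r + `|Y x| `^ r)) => //.
    apply: integrable_add; first exact: icst.
    by apply: iYpow; rewrite r0 lerDr ltW.
  by move=> x; rewrite ger0_norm ?powR_ge0 // powR_max_le.
pose G (t : R) := (\int[P]_x (Num.max `|t| `|Y x| `^ r))%R.
exists (fun w : R => (\int[P]_x (`|w + Y x| `^ r))%R), (fun t => 2 `^ r * G t); rewrite kE.
have G0 t : 0 <= G t by apply: Rintegral_ge0 => x _; exact: powR_ge0.
have mY2 : measurable_fun setT (fun z : R * T => Y z.2).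
  exact: measurableT_comp mY measurable_snd.
have mG : measurable_fun setT G.
  apply: (@measurable_Rintegral_param _ _ _ R T P (fun z => Num.max `|z.1| `|Y z.2| `^ r)).
  - apply: (measurableT_comp (measurable_powR r)); apply: measurable_maxr.
      by apply: measurableT_comp => //; exact: measurable_fst.
    exact: measurableT_comp.
  - by move=> z; exact: powR_ge0.
  - exact: imax.
split.
- split; last exact: measurable_funM.
  apply: (@measurable_Rintegral_param _ _ _ R T P (fun z => `|z.1 + Y z.2| `^ r)).
  - apply: (measurableT_comp (measurable_powR r)); apply: measurableT_comp => //.
    by apply: measurable_funD => //; exact: measurable_fst.
  - by move=> z; exact: powR_ge0.
  - exact: iYv.
- split => t; first by apply: Rintegral_ge0 => x _; exact: powR_ge0.
  by rewrite mulr_ge0 ?powR_ge0.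
- move=> s t s0 st.
  have hm x : Num.max `|s| `|Y x| <= Num.max `|t| `|Y x|.
    have st' : `|s| <= `|t| by rewrite (ger0_norm s0) (ger0_norm (le_trans s0 st)).
    by rewrite ge_max !le_max st' lexx orbT.
  apply: ler_wpM2l; first exact: powR_ge0.
  apply: le_Rintegral; [exact: measurableT|exact: imax|exact: imax|].
  by move=> x _; apply: ge0_ler_powR; rewrite ?nnegrE ?hm // le_max normr_ge0.
- move=> w s y sy.
  have <- : (\int[P]_x cst (`|w + s| `^ r) x = `|w + s| `^ r)%R by exact: cstE.
  have iS := integrable_scale (2 `^ r) (imax `|y|).
  rewrite /G -(RintegralZl _ measurableT (imax `|y|)) -(RintegralD measurableT (iYv w) iS).
  apply: le_Rintegral; [exact: measurableT|exact: icst|exact: (integrable_add (iYv w) iS)|].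
  move=> x _; apply: (@le_trans _ _ ((`|w + Y x| + (`|y| + `|Y x|)) `^ r)).
    apply: ge0_ler_powR; rewrite ?nnegrE ?addr_ge0 //.
    have -> : w + s = (w + Y x) + (s - Y x) by ring.
    apply: le_trans (ler_normD _ _) _; rewrite lerD2l.
    by apply: le_trans (ler_normB _ _) _; rewrite lerD2r.
  apply: le_trans (powR_subadditive (ltW r1) (normr_ge0 _) _) _; first by rewrite addr_ge0.
  by rewrite lerD2l normr_id; apply: powR_add_max.
have fi : (P \x P)%E.-integrable setT (EFin \o (fun z : T * T => `|V z.2 + Y z.1| `^ r)).
  apply: (@same_law_integrable _ _ _ _ _ _ _ _ _ _ _ _ _ law (EFin \o (fun z : R * R => `|z.2 + z.1| `^ r))) => //.
  + exact: measurable_fun_pair.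
  + exact: measurable_fun_map_pair.
  + apply/measurable_EFinP; apply: (measurableT_comp (measurable_powR r)); apply: measurableT_comp => //.
    by apply: measurable_funD; [exact: measurable_snd|exact: measurable_fst].
pose M := (\int[P]_x (`|Y x| `^ (q + r)))%R.
have iM : P.-integrable setT (EFin \o (fun x => `|Y x| `^ (q + r))).
  by apply: iYpow; rewrite lexx andbT addr_ge0 // ltW.
have M0 : 0 <= M by apply: Rintegral_ge0 => x _; exact: powR_ge0.
(* [powR_mul_max] leaves the moment of the copy with weight r/2; after integration over Y the total
   weight 1 + r/2 is at most 2^r. *)
have Ymax x : `|Y x| `^ q * (2 `^ r * G `|Y x|) <=
    2 `^ r * (`|Y x| `^ (q + r) + r / 2 * M).
  rewrite mulrCA ler_wpM2l ?powR_ge0 // /G -RintegralZl //.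
  rewrite -[X in X + _]cstE /M -RintegralZl // -(RintegralD _ (icst _)) //; last exact: integrable_scale.
  apply: le_Rintegral => //; first exact: integrable_scale.
    by apply: integrable_add; [exact: icst|exact: integrable_scale].
  by move=> x' _; rewrite normr_id; exact: powR_mul_max.
have iB : P.-integrable setT (EFin \o (fun x => 2 `^ r * (`|Y x| `^ (q + r) + r / 2 * M))).
  by apply: integrable_scale; apply: integrable_add => //; exact: icst.
have iL : P.-integrable setT (EFin \o (fun x => `|Y x| `^ q * (2 `^ r * G `|Y x|))).
  apply: (integrable_dominated _ iB) => [|x].
    apply: measurable_funM; first exact: mpow.
    by apply: measurable_funM => //; exact: measurableT_comp mG mYn.
  by rewrite ger0_norm // mulr_ge0 ?powR_ge0 // mulr_ge0 ?powR_ge0.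
split.
- exact: (integrable_Rintegral_prod2 fi (fun v => iYv (V v))).
- rewrite -(Rintegral_prod2 fi (fun v => iYv (V v))).
  rewrite -(@same_law_Rintegral _ _ _ _ _ _ _ _ _ _ _ _ _ law (fun z => `|z.2 + z.1| `^ r)); last 3 first.
  - exact: measurable_fun_pair.
  - exact: measurable_fun_map_pair.
  - apply: (measurableT_comp (measurable_powR r)); apply: measurableT_comp => //.
    by apply: measurable_funD; [exact: measurable_snd|exact: measurable_fst].
  rewrite ler_peMl //; first by apply: Rintegral_ge0 => x _; exact: powR_ge0.
  by rewrite -[X in X <= _]mul1r ler_pM.
- exact: iL.
apply: (@le_trans _ _ (\int[P]_x (2 `^ r * (`|Y x| `^ (q + r) + r / 2 * M)))%R).
  exact: le_Rintegral.
rewrite RintegralZl //; last by apply: integrable_add => //; exact: icst.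
rewrite (RintegralD _ iM (icst _)) // cstE -/M -mulrA ler_wpM2l ?powR_ge0 //.
by rewrite -[X in X + _]mul1r -mulrDl ler_wpM2r // powR2_ge.
Qed.

Lemma splitting : splittable.
Proof. by have [/splittable_ge1|/splittable_lt1] := leP 1 r. Qed.

End splitting.

(** * One standardised sum *)

Lemma measurable_sum_cond (R : realType) (d : measure_display) (T : measurableType d)
    (I : Type) (s : seq I) (A : pred I) (h : I -> T -> R) :
  (forall i, A i -> measurable_fun setT (h i)) ->
  measurable_fun setT (fun x => \sum_(i <- s | A i) h i x).
Proof.
move=> mh; elim: s => [|i s ih]; first by under eq_fun do rewrite big_nil; exact: measurable_cst.
have [Ai|/negbTE Ai] := boolP (A i); under eq_fun do rewrite big_cons Ai; last exact: ih.
by apply: measurable_funD => //; exact: mh.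
Qed.

(** For products of dependent variables, such as a summand and the whole sum, where a domination
    cannot be factored: one more moment of each is used instead. *)
Lemma gam_mul_le (R : realType) (q x y : R) :
  0 <= q -> gam 1 x * gam q y <= gam (q + 1) x + gam (q + 1) y.
Proof.
have mono e : 0 <= e -> forall u v : R, `|u| <= `|v| -> gam e u <= gam e v.
  by move=> e0 u v uv; rewrite ge0_ler_powR ?nnegrE ?addr_ge0 ?lerD2l.
move=> q0; have [xy|/ltW yx] := leP `|x| `|y|.
  apply: (@le_trans _ _ (gam (q + 1) y)); last by rewrite lerDr gam_ge0.
  by rewrite gamD mulrC ler_wpM2l ?gam_ge0 // mono.
apply: (@le_trans _ _ (gam (q + 1) x)); last by rewrite lerDl gam_ge0.
by rewrite gamD mulrC ler_wpM2r ?gam_ge0 // mono.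
Qed.

Section column.
Context {R : realType} {d : measure_display} {T : measurableType d}.
Variable P : probability T R.

Lemma integrable_cst_prob (c : R) : P.-integrable setT (EFin \o cst c).
Proof. exact: finite_measure_integrable_cst. Qed.

Lemma Rintegral_cst_prob (c : R) : (\int[P]_x cst c x = c)%R.
Proof. by rewrite Rintegral_cst // [X in fine X]probability_setT mulr1. Qed.

Lemma integral_EFin_Rintegral (f : T -> R) : P.-integrable setT (EFin \o f) ->
  (\int[P]_x (f x)%:E = (\int[P]_x f x)%R%:E)%E.
Proof. by move=> fi; rewrite /Rintegral fineK //; apply: integrable_fin_num. Qed.

Lemma integrable_gam_le (f : T -> R) (q q' : R) : q <= q' -> measurable_fun setT f ->
  P.-integrable setT (EFin \o (gam q' \o f)) -> P.-integrable setT (EFin \o (gam q \o f)).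
Proof.
move=> qq mf fi; apply: integrable_dominated fi _.
  exact: measurableT_comp (measurable_gam q) mf.
by move=> x /=; rewrite ger0_norm ?gam_ge0 // gam_le.
Qed.

Lemma integrable_gam_sum (I : Type) (s : seq I) (A : pred I) (X : I -> T -> R) (q : R) :
  0 <= q -> (forall i, measurable_fun setT (X i)) ->
  (forall i, P.-integrable setT (EFin \o (gam q \o X i))) ->
  P.-integrable setT (EFin \o (gam q \o (fun x => \sum_(i <- s | A i) X i x))).
Proof.
move=> q0 mX iX; elim: s => [|i s ih].
  have -> : gam q \o (fun x => \sum_(i <- [::] | A i) X i x) = cst (gam q 0).
    by apply/funext => x /=; rewrite big_nil.
  exact: integrable_cst_prob.
have [Ai|Ai] := boolP (A i); last first.
  by apply: eq_integrable ih => // x _ /=; rewrite big_cons (negbTE Ai).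
apply: (integrable_dominated (g := fun x => 2 `^ q * (gam q (X i x) +
    gam q (\sum_(i <- s | A i) X i x)))).
- apply: (measurableT_comp (measurable_gam q)); exact: measurable_sum_cond.
- apply: integrable_scale; exact: integrable_add (iX i) ih.
- by move=> x /=; rewrite ger0_norm ?gam_ge0 // big_cons Ai gam_add_le.
Qed.

Variables (n : nat) (X : 'I_n -> {RV P >-> R}).
Hypotheses (n0 : (0 < n)%N) (indepX : mutually_independent X).

Definition col_sum (x : T) : R := (Num.sqrt n%:R)^-1 * \sum_(i < n) X i x.

Let s : R := Num.sqrt n%:R.
Let Y i x : R := s^-1 * X i x.
Let V i x : R := s^-1 * \sum_(k < n | k != i) X k x.

Let s0 : 0 < s. Proof. by rewrite sqrtr_gt0 ltr0n. Qed.
Let s1 : `|s^-1| <= 1.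
Proof.
rewrite ger0_norm ?invr_ge0 ?(ltW s0) // invf_le1 //.
by rewrite /s -[leLHS]sqrtr1 ler_sqrt ?ler1n // ltr0n.
Qed.

Let mX i : measurable_fun setT (X i). Proof. exact: measurable_funPT. Qed.
Let mY i : measurable_fun setT (Y i). Proof. exact: measurable_funM. Qed.
Let mV i : measurable_fun setT (V i).
Proof. apply: measurable_funM => //; exact: measurable_sum_cond. Qed.

Let col_sumE i x : col_sum x = V i x + Y i x.
Proof. by rewrite /col_sum /V /Y -mulrDr (bigD1 i) //= addrC. Qed.

Let YV_law i : same_law P (P \x P)%E
  (fun x => (Y i x, V i x)) (fun z : T * T => (Y i z.1, V i z.2)).
Proof.
have disj k : k \in [set i]%SET -> k \notin (~: [set i])%SET.
  by rewrite !inE => ->.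
pose f (z : block X [set i]%SET * block X (~: [set i])%SET) := (Y i z.1, V i z.2).
have mf : measurable_fun setT f.
  have m1 : measurable_fun setT (Y i : block X [set i]%SET -> R).
    by apply: measurable_funM => //; apply: measurable_block; rewrite inE.
  have m2 : measurable_fun setT (V i : block X (~: [set i])%SET -> R).
    apply: measurable_funM => //; apply: measurable_sum_cond => k ki.
    by apply: measurable_block; rewrite !inE.
  apply: measurable_fun_pair.
    exact: measurableT_comp m1 measurable_fst.
  exact: measurableT_comp m2 measurable_snd.
move=> A mA; have mfA : measurable (f @^-1` A).
  by rewrite -[X in measurable X]setTI; exact: mf.
exact: (block_decoupling indepX disj mfA).
Qed.

Variables (p1 : nat) (r : R) (m : nat -> R).
Hypotheses (p10 : (0 < p1)%N) (r0 : 0 <= r).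
Hypothesis mX1 : forall i, (\int[P]_x X i x = 0)%R.
Hypothesis mXk : forall i k, (k <= p1.+1)%N -> (\int[P]_x (X i x ^+ k) = m k)%R.
Hypothesis mrec : forall k, (k < p1)%N -> m k.+2 = k.+1%:R * m k.
Hypothesis iX : forall i, P.-integrable setT (EFin \o (gam (p1.+2%:R + r) \o X i)).

Let iY i : P.-integrable setT (EFin \o (gam (p1.+2%:R + r) \o Y i)).
Proof.
apply: integrable_dominated (iX i) _.
  exact: measurableT_comp (measurable_gam _) (mY i).
by move=> x /=; rewrite ger0_norm ?gam_ge0 // gam_scale // addr_ge0.
Qed.

Let q : R := p1.+1%:R + r.
Let q0 : 0 <= q. Proof. by rewrite addr_ge0. Qed.
Let q1 : q + 1 = p1.+2%:R + r.
Proof. by rewrite /q addrAC natr1. Qed.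

Let iXq i : P.-integrable setT (EFin \o (gam q \o X i)).
Proof. by apply: (integrable_gam_le _ _ (iX i)); rewrite // -q1 lerDl. Qed.

Let iV i : P.-integrable setT (EFin \o (gam q \o V i)).
Proof.
have iS := @integrable_gam_sum 'I_n (index_enum 'I_n) (fun k => k != i)
  (fun k => X k : T -> R) q q0 mX iXq.
apply: integrable_dominated iS _.
  exact: measurableT_comp (measurable_gam _) (mV i).
by move=> x /=; rewrite ger0_norm ?gam_ge0 // gam_scale.
Qed.

Let qr0 : 0 <= p1.+2%:R + r. Proof. by rewrite addr_ge0. Qed.

Lemma integrable_gam_col_sum :
  P.-integrable setT (EFin \o (gam (p1.+2%:R + r) \o col_sum)).
Proof.
have iS := @integrable_gam_sum 'I_n (index_enum 'I_n) predT
  (fun k => X k : T -> R) _ qr0 mX iX.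
apply: integrable_dominated iS _.
  apply: (measurableT_comp (measurable_gam _)); apply: measurable_funM => //.
  exact: measurable_sum_cond.
by move=> x /=; rewrite ger0_norm ?gam_ge0 // gam_scale.
Qed.

Let c : R := n%:R^-1.
Let cE : c = s^-1 ^+ 2.
Proof. by rewrite /c exprVn sqr_sqrtr. Qed.
Let c0 : 0 <= c. Proof. by rewrite invr_ge0. Qed.

Let iXk i k : (k <= p1.+2)%N -> P.-integrable setT (EFin \o (fun x => X i x ^+ k)).
Proof.
move=> kp; apply: integrable_dominated (iX i) _; first exact: measurable_funX.
move=> x /=; rewrite normrX; apply: le_trans (exprn_le_gam _ _) _.
by apply: gam_le; rewrite ler_wpDr // ler_nat.
Qed.

Let Y1 i : (\int[P]_x Y i x = 0)%R.
Proof. by rewrite RintegralZl //; [rewrite mX1 mulr0|exact: (iXk i (k := 1))]. Qed.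

Let Yrec i k : (k < p1)%N ->
  (\int[P]_x (Y i x ^+ k.+2) = k.+1%:R * c * \int[P]_x (Y i x ^+ k))%R.
Proof.
move=> kp; have e l : (l <= p1.+1)%N -> (\int[P]_x (Y i x ^+ l) = s^-1 ^+ l * m l)%R.
  move=> lp; under eq_Rintegral do rewrite exprMn.
  by rewrite RintegralZl // ?mXk //; apply: iXk; exact: leqW.
rewrite !e ?mrec //; last exact: leqW (ltnW kp).
by rewrite cE -[k.+2]addn2 exprD; ring.
Qed.

Let s_powR (e : R) : s `^ e = n%:R `^ (e / 2).
Proof. by rewrite /s -powR12_sqrt // -powRrM mulrC. Qed.

Let abs_Y_powR i (e : R) x :
  `|Y i x| `^ e = (n%:R `^ (e / 2))^-1 * `|X i x| `^ e.
Proof.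
rewrite /Y normrM powRM // ger0_norm ?invr_ge0 ?(ltW s0) //.
by rewrite -s_powR -powRN -[s^-1]powR_inv1 ?(ltW s0) // -powRrM mulN1r.
Qed.

Let iXpow i (e : R) : 0 <= e <= p1.+2%:R + r ->
  P.-integrable setT (EFin \o (fun x => `|X i x| `^ e)).
Proof.
move=> /andP[e0 ee]; apply: integrable_dominated (iX i) _.
  by apply: (measurableT_comp (measurable_powR e)); exact: measurableT_comp.
by move=> x /=; rewrite ger0_norm ?powR_ge0 // (le_trans (powR_le_gam _ e0)) // gam_le.
Qed.

(** E W a(W) is the sum of the E Y_i a(W), and E a'(W) the sum of n copies of c E a'(W) with c = 1/n
    = E Y_i^2, so [stein_step] applies to each summand. The powers of n come from Y_i = X_i / sqrt
    n. *)
Lemma column_stein (al be C : R) (a : nat -> R -> R) : 0 <= al -> 0 <= be ->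
  (forall k (x : R), (k < p1.+1)%N -> is_derive x (1 : R) (a k) (a k.+1 x)) ->
  (forall k x, (k <= p1)%N -> `|a k x| <= C * gam q x) ->
  (forall x, `|a p1.+1 x| <= al + be * `|x| `^ r) ->
  `|(\int[P]_x (col_sum x * a 0 (col_sum x)))%R - (\int[P]_x (a 1 (col_sum x)))%R| <=
  p1.+2%:R / p1.+1`!%:R * \sum_(i < n) (n%:R `^ (p1.+2%:R / 2))^-1 *
    (al * (\int[P]_x (`|X i x| ^+ p1.+2))%R + be * (split_const r *
      ((\int[P]_x (`|X i x| ^+ p1.+2))%R * (\int[P]_x (`|col_sum x| `^ r))%R +
       (n%:R `^ (r / 2))^-1 * (\int[P]_x (`|X i x| `^ (p1.+2%:R + r)))%R))).
Proof.
move=> al0 be0 da aC aB.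
set W := col_sum.
have ma k : (k <= p1)%N -> measurable_fun setT (a k).
  by move=> kp; apply: continuous_measurable_fun => x; exact: is_derive_continuous (da k x kp).
have mW : measurable_fun setT W.
  by apply: measurable_funM => //; exact: measurable_sum_cond.
have C0 : 0 <= C.
  have := le_trans (normr_ge0 _) (aC 0 0 isT).
  by rewrite pmulr_lge0 // gam_gt0.
have iWq : P.-integrable setT (EFin \o (gam q \o W)).
  apply: (@integrable_gam_le W q (p1.+2%:R + r)) => //; last exact: integrable_gam_col_sum.
  by rewrite -q1 lerDl.
have ia k : (k <= p1)%N -> P.-integrable setT (EFin \o (fun x => a k (W x))).
  move=> kp; apply: (integrable_dominated (g := fun x => C * gam q (W x))).
  - exact: measurableT_comp (ma k kp) mW.
  - exact: integrable_scale iWq.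
  - by move=> x; exact: aC.
have law i := @YV_law i.
have ipow i : P.-integrable setT (EFin \o (fun x => `|X i x| ^+ p1.+2)).
  have /iXpow h : 0 <= (p1.+2%:R : R) <= p1.+2%:R + r by rewrite ler0n lerDl.
  apply: eq_integrable (h i) => // x _ /=; by rewrite powR_mulrn.
have MY i : (\int[P]_x (`|Y i x| ^+ p1.+2))%R =
    (n%:R `^ (p1.+2%:R / 2))^-1 * (\int[P]_x (`|X i x| ^+ p1.+2))%R.
  rewrite -(@RintegralZl _ _ _ P _ _ _ measurableT (ipow i)).
  by apply: eq_Rintegral => x _; rewrite -!powR_mulrn // abs_Y_powR.
have MYr i : (\int[P]_x (`|Y i x| `^ (p1.+2%:R + r)))%R = (n%:R `^ (p1.+2%:R / 2))^-1 *
    ((n%:R `^ (r / 2))^-1 * (\int[P]_x (`|X i x| `^ (p1.+2%:R + r)))%R).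
  rewrite mulrA -invfM -powRD; last by apply/implyP => _; rewrite pnatr_eq0 -lt0n.
  rewrite -mulrDl -(@RintegralZl _ _ _ P _ _ _ measurableT (iXpow i (e := p1.+2%:R + r) _)) ?qr0 ?lexx //.
  by apply: eq_Rintegral => x _; rewrite abs_Y_powR.
have iYp i : P.-integrable setT (EFin \o (fun x => `|Y i x| ^+ p1.+2)).
  have := integrable_scale (n%:R `^ (p1.+2%:R / 2))^-1 (ipow i).
  by apply: eq_integrable => // x _ /=; rewrite -!powR_mulrn // abs_Y_powR.
have split_i i : `|(\int[P]_x (Y i x * a 0 (W x)))%R - c * (\int[P]_x a 1 (W x))%R| <=
  p1.+2%:R / p1.+1`!%:R * ((n%:R `^ (p1.+2%:R / 2))^-1 *
    (al * (\int[P]_x (`|X i x| ^+ p1.+2))%R + be * (split_const r *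
      ((\int[P]_x (`|X i x| ^+ p1.+2))%R * (\int[P]_x (`|W x| `^ r))%R +
       (n%:R `^ (r / 2))^-1 * (\int[P]_x (`|X i x| `^ (p1.+2%:R + r)))%R)))).
  have q2 : 2 <= (p1.+2%:R : R) by rewrite ler_nat.
  have iVr : P.-integrable setT (EFin \o (gam r \o V i)).
    by apply: (@integrable_gam_le (V i) r q) => //; rewrite /q lerDr.
  have [g1 [g2 [[mg1 mg2] [g10 g20] nd g12 [ig1 lg1 ig2 lg2]]]] :=
    splitting r0 q2 (mY i) (mV i) (iY i) iVr (law i) (Y1 i).
  (* The splitting makes [B] a sum of a function of V and a function of |Y|, whose integrals
     separate. *)
  pose B w t := al + be * (g1 w + g2 t).
  have qQ : q + 1 <= p1.+2%:R + r by rewrite q1.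
  have pQ : p1.+1%:R <= p1.+2%:R + r by rewrite ler_wpDr // ler_nat.
  have mB : measurable_fun setT (fun z : R * R => B z.1 z.2).
    apply: measurable_funD => //; apply: measurable_funM => //; apply: measurable_funD.
      exact: measurableT_comp mg1 measurable_fst.
    exact: measurableT_comp mg2 measurable_snd.
  have B0 (w t : R) : 0 <= t -> 0 <= B w t.
    by move=> _; rewrite addr_ge0 // mulr_ge0 // addr_ge0.
  have ndB (w u t : R) : 0 <= u -> u <= t -> B w u <= B w t.
    by move=> u0 ut; rewrite lerD2l ler_wpM2l // lerD2l nd.
  have aBB (w y u : R) : `|u| <= `|y| -> `|a p1.+1 (w + u)| <= B w `|y|.
    move=> uy; apply: le_trans (aB _) _; rewrite /B lerD2l ler_wpM2l //. exact: g12.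
  have := stein_step p10 c0 q0 qQ pQ (mY i) (mV i) (iY i) (iV i) (law i) (Y1 i)
    (@Yrec i) da aC mB B0 ndB aBB.
  pose G2 := (\int[P]_x (`|Y i x| `^ p1.+2%:R * g2 `|Y i x|))%R.
  pose My := (\int[P]_x (`|Y i x| ^+ p1.+2))%R.
  have inner v : (\int[P]_x (`|Y i x| ^+ p1.+2 * B (V i v) `|Y i x|)%:E =
      ((al * My + be * G2) + be * My * g1 (V i v))%:E)%E.
    have e : (fun x => `|Y i x| ^+ p1.+2 * B (V i v) `|Y i x|) =
        (fun x => (al + be * g1 (V i v)) * `|Y i x| ^+ p1.+2 +
          be * (`|Y i x| `^ p1.+2%:R * g2 `|Y i x|)).
      by apply/funext => x; rewrite powR_mulrn // /B; ring.
    have j1 := integrable_scale (al + be * g1 (V i v)) (iYp i).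
    have j2 := integrable_scale be ig2.
    rewrite integral_EFin_Rintegral e; last exact: integrable_add j1 j2.
    rewrite (RintegralD measurableT j1 j2) // (RintegralZl _ measurableT (iYp i)) // (RintegralZl _ measurableT ig2) //.
    by rewrite -/My -/G2; congr EFin; ring.
  have j3 := integrable_scale (be * My) ig1.
  have j4 := integrable_cst_prob (al * My + be * G2).
  rewrite (eq_integral _ _ (fun v _ => inner v)) integral_EFin_Rintegral; last first.
    exact: integrable_add j4 j3.
  rewrite (RintegralD measurableT j4 j3) // Rintegral_cst_prob (RintegralZl _ measurableT ig1) // -EFinM lee_fin.
  have WE : (fun x => V i x + Y i x) = W by apply/funext => x; rewrite /W (col_sumE i).
  have -> : (fun x => Y i x * a 0 (V i x + Y i x)) = (fun x => Y i x * a 0 (W x)).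
    by apply/funext => x; rewrite /W (col_sumE i).
  have -> : (fun x => a 1 (V i x + Y i x)) = (fun x => a 1 (W x)).
    by apply/funext => x; rewrite /W (col_sumE i).
  move=> /le_trans; apply; apply: ler_wpM2l; first by rewrite divr_ge0.
  have My0 : 0 <= My by apply: Rintegral_ge0 => x _; exact: exprn_ge0.
  have lg1' : (\int[P]_x g1 (V i x) <= split_const r * \int[P]_x (`|W x| `^ r))%R.
    apply: le_trans lg1 _; rewrite le_eqVlt; apply/orP; left; apply/eqP; congr (_ * _).
    by apply: eq_Rintegral => x _; rewrite /W (col_sumE i).
  move: lg1' lg2; rewrite -/G2 MYr; set X1 := (\int[P]_x g1 (V i x))%R => lg1' lg2.
  apply: (@le_trans _ _ (al * My + be * (split_const r * ((n%:R `^ (p1.+2%:R / 2))^-1 *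
       ((n%:R `^ (r / 2))^-1 * \int[P]_x (`|X i x| `^ (p1.+2%:R + r)))%R)) +
       be * My * (split_const r * (\int[P]_x (`|W x| `^ r))%R))).
    by rewrite lerD // ?ler_wpM2l ?mulr_ge0 // lerD2l ler_wpM2l.
  by rewrite /My MY le_eqVlt; apply/orP; left; apply/eqP; ring.
have iYa i : P.-integrable setT (EFin \o (fun x => Y i x * a 0 (W x))).
  have iYq : P.-integrable setT (EFin \o (gam (q + 1) \o Y i)) by rewrite q1; exact: iY.
  have iWq1 : P.-integrable setT (EFin \o (gam (q + 1) \o W)).
    by rewrite q1; exact: integrable_gam_col_sum.
  apply: integrable_dominated (integrable_scale C (integrable_add iYq iWq1)) _.
    by apply: measurable_funM => //; exact: measurableT_comp (ma 0 isT) mW.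
  move=> x /=; apply: (@le_trans _ _ (C * (gam 1 (Y i x) * gam q (W x)))); last first.
    by rewrite ler_wpM2l // gam_mul_le.
  rewrite normrM mulrCA ler_pM // ?norm_le_gam //; exact: aC.
have -> : (\int[P]_x (W x * a 0 (W x)))%R = \sum_(i < n) (\int[P]_x (Y i x * a 0 (W x)))%R.
  rewrite -Rintegral_sumn //; apply: eq_Rintegral => x _.
  by rewrite -mulr_suml /Y -mulr_sumr.
have -> : (\int[P]_x a 1 (W x))%R = \sum_(i < n) c * (\int[P]_x a 1 (W x))%R.
  rewrite sumr_const card_ord -mulr_natl mulrA /c mulfV ?mul1r // pnatr_eq0 -lt0n //.
rewrite -sumrB; apply: le_trans (ler_norm_sum _ _ _) _.
by rewrite mulr_sumr; apply: ler_sum => i _; exact: split_i.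
Qed.
End column.

(** * Gaussian measure *)

Section density.
Context {R : realType} {d : measure_display} {T : measurableType d}.
Variables (m mu : {measure set T -> \bar R}) (w : T -> R).
Hypotheses (mw : measurable_fun setT w) (w0 : forall x, 0 <= w x).
Hypothesis mE : forall A, measurable A -> m A = (\int[mu]_(x in A) (w x)%:E)%E.
Local Open Scope ereal_scope.

Let mwE : measurable_fun setT (EFin \o w). Proof. exact/measurable_EFinP. Qed.

Import HBNNSimple.

Let density_nnsfun (f : {nnsfun T >-> R}) :
  \int[m]_x (f x)%:E = \int[mu]_x ((f x)%:E * (w x)%:E).
Proof.
under [LHS]eq_integral do rewrite fimfunE -fsumEFin//.
rewrite [LHS]ge0_integral_fsum//; last 2 first.
- by move=> r; exact/measurable_EFinP/measurableT_comp.
- by move=> n x _; rewrite EFinM nnfun_muleindic_ge0.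
under [RHS]eq_integral.
  move=> x _; rewrite fimfunE -fsumEFin// ge0_mule_fsuml; last first.
    by move=> r; rewrite EFinM nnfun_muleindic_ge0.
  over.
rewrite [RHS]ge0_integral_fsum//; last 2 first.
- move=> r; apply: emeasurable_funM => //.
  by apply/measurable_EFinP; do 2 apply/measurableT_comp => //.
- move=> n x _; rewrite mule_ge0 ?lee_fin //.
  by have := @nnfun_muleindic_ge0 _ _ _ f n x; rewrite -EFinM lee_fin.
apply: eq_fsbigr => r /= /[!inE] -[t _ <-].
have mf : measurable (f @^-1` [set f t]) by [].
rewrite (@integralZl_indic_nnsfun _ _ _ m setT) // integral_indic // setIT mE //.
transitivity (\int[mu]_x ((f t)%:E * ((w x)%:E * (\1_(f @^-1` [set f t]) x)%:E))); last first.
  by apply: eq_integral => x _; rewrite EFinM -muleA [X in _ * X]muleC.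
rewrite ge0_integralZl //; last 3 first.
- apply: emeasurable_funM => //; exact/measurable_EFinP.
- by move=> x _; rewrite mule_ge0 // lee_fin.
- by rewrite lee_fin.
congr (_ * _); rewrite [LHS]integral_mkcond; apply: eq_integral => x _.
rewrite patchE indicE; case: ifPn => _; first by rewrite mule1.
by rewrite mule0.
Qed.

Lemma ge0_integral_density (f : T -> \bar R) : measurable_fun setT f ->
  (forall x, 0 <= f x) -> \int[m]_x f x = \int[mu]_x (f x * (w x)%:E).
Proof.
move=> mf f0; pose f_ := nnsfun_approx measurableT mf.
transitivity (lim (\int[m]_x (f_ n x)%:E @[n --> \oo])).
  rewrite -monotone_convergence//=.
  - apply: eq_integral => ? /[!inE] xD; apply/esym/cvg_lim => //=.
    exact: cvg_nnsfun_approx.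
  - by move=> n; exact/measurable_EFinP/measurable_funTS.
  - by move=> n ? _; rewrite lee_fin.
  - by move=> ? _ ? ? mn; rewrite lee_fin; exact/lefP/nd_nnsfun_approx.
transitivity (lim (\int[mu]_x ((f_ n x)%:E * (w x)%:E) @[n --> \oo])); last first.
  rewrite -monotone_convergence//=.
  - apply: eq_integral => x _; apply: cvg_lim => //.
    by apply: cvgeZr => //; exact: cvg_nnsfun_approx.
  - move=> n; apply: emeasurable_funM => //.
    exact/measurable_EFinP/measurable_funTS.
  - by move=> n x _; rewrite mule_ge0 ?lee_fin.
  - move=> x _ ? ? mn; rewrite -!EFinM lee_fin.
    by apply: ler_wpM2r => //; exact/lefP/nd_nnsfun_approx.
by apply: congr_lim; apply/funext => n /=; exact: density_nnsfun.
Qed.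

End density.

Lemma is_derive_Rintegral {R : realType} {d : measure_display} {Y : measurableType d}
    (mu : {measure set Y -> \bar R}) (f df : R -> Y -> R) (a u v : R) (g : Y -> R) :
  u < a < v ->
  (forall t, u < t < v -> mu.-integrable setT (EFin \o f t)) ->
  (forall t y, u < t < v -> is_derive t (1 : R) (f ^~ y) (df t y)) ->
  (forall t y, u < t < v -> `|df t y| <= g y) ->
  mu.-integrable setT (EFin \o g) ->
  is_derive a (1 : R) (fun t => \int[mu]_y f t y)%R (\int[mu]_y df a y)%R.
Proof.
move=> auv fi fd fg gi.
have Ia : [set` `]u, v[] a by rewrite /= in_itv.
have fi' t : [set` `]u, v[] t -> mu.-integrable setT (EFin \o f t).
  by rewrite /= in_itv; exact: fi.
have fd' t y : [set` `]u, v[] t -> [set: Y] y -> derivable (f ^~ y) t 1.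
  by rewrite /= in_itv => /(fd _ y) [].
have e t y : u < t < v -> partial1of2 f t y = df t y.
  by move=> /(fd t y) h; rewrite partial1of2E; exact: derive_val.
have g0 y : 0 <= g y by apply: le_trans (fg a y auv).
have fg' t y : [set` `]u, v[] t -> [set: Y] y -> `|partial1of2 f t y| <= g y.
  by rewrite /= in_itv => tuv _; rewrite e //; exact: fg.
have h1 := derivable_under_integral measurableT Ia fi' fd' g0 gi fg'.
have h2 := differentiation_under_integral measurableT Ia fi' fd' g0 gi fg'.
split=> //; rewrite -derive1E h2; apply: eq_Rintegral => y _; exact: e.
Qed.

(** * The Cameron-Martin formula and Gaussian integration by parts *)

Section gaussian.
Variable R : realType.
Local Notation leb := (@lebesgue_measure R).

Definition gaussian : probability (measurableTypeR R) R := normal_prob (0 : R) 1.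

Let gamma := normal_pdf (0 : R) 1.

Let pdf_shift (t z : R) : normal_pdf t 1 z = gamma z * expR (t * z - t ^+ 2 / 2).
Proof.
rewrite /gamma !normal_pdfE ?oner_neq0 // /normal_fun -mulrA -expRD; congr (_ * expR _).
by rewrite expr1n; field.
Qed.

Lemma ge0_integral_gaussian (f : R -> \bar R) : measurable_fun setT f ->
  (forall x, (0 <= f x)%E) -> (\int[gaussian]_x f x = \int[leb]_x (f x * (gamma x)%:E))%E.
Proof.
move=> mf f0; apply: ge0_integral_density => //.
- exact: measurable_normal_pdf.
- exact: normal_pdf_ge0.
Qed.

(** exp(t z - t^2/2) is the density of N(t, 1) with respect to N(0, 1). *)
Lemma gaussian_mgf (t : R) : (\int[gaussian]_z (expR (t * z - t ^+ 2 / 2))%:E = 1)%E.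
Proof.
rewrite ge0_integral_gaussian; last 2 first.
- apply/measurable_EFinP; apply: measurableT_comp => //; apply: measurable_funB => //.
- by move=> x; rewrite lee_fin expR_ge0.
rewrite -(integral_normal_pdf t 1); apply: eq_integral => z _.
by rewrite pdf_shift -EFinM mulrC.
Qed.

Lemma integrable_expR_gaussian (t : R) :
  gaussian.-integrable setT (EFin \o (fun z => expR (t * z))).
Proof.
have h : gaussian.-integrable setT (EFin \o (fun z => expR (t * z - t ^+ 2 / 2))).
  apply/integrableP; split.
    by apply/measurable_EFinP; apply: measurableT_comp => //; apply: measurable_funB.
  rewrite [X in (X < _)%E](_ : _ = 1%E) ?ltry // -(gaussian_mgf t).
  by apply: eq_integral => x _ /=; rewrite ger0_norm ?expR_ge0.
have := integrable_scale (expR (t ^+ 2 / 2)) h.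
by apply: eq_integrable => // z _ /=; rewrite -expRD addrC subrK.
Qed.

Lemma gam_le_expR (q x : R) : 0 <= q -> gam q x <= expR (q * `|x|).
Proof.
move=> q0; rewrite /gam /powR gt_eqF ?ltr_pwDl // ler_expR ler_wpM2l //.
by rewrite le_ln1Dx // (lt_le_trans _ (normr_ge0 _)) // oppr_lt0.
Qed.

Lemma integrable_expR_norm_gaussian (q : R) : 0 <= q ->
  gaussian.-integrable setT (EFin \o (fun z => expR (q * `|z|))).
Proof.
move=> q0; have h1 := integrable_expR_gaussian q; have h2 := integrable_expR_gaussian (- q).
apply: integrable_dominated (integrable_add h1 h2) _.
  by apply: measurableT_comp => //; apply: measurable_funM => //; exact: measurableT_comp.
move=> z; rewrite ger0_norm ?expR_ge0 //.
have [z0|z0] := leP 0 z; first by rewrite (ger0_norm z0) lerDl expR_ge0.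
by rewrite (ltr0_norm z0) mulrN mulNr lerDr expR_ge0.
Qed.

Lemma integrable_gam_expR_gaussian (q t : R) : 0 <= q -> 0 <= t ->
  gaussian.-integrable setT (EFin \o (fun z => gam q z * expR (t * `|z|))).
Proof.
move=> q0 t0; apply: integrable_dominated (integrable_expR_norm_gaussian (addr_ge0 q0 t0)) _.
  apply: measurable_funM; first exact: measurable_gam.
  by apply: measurableT_comp => //; apply: measurable_funM => //; exact: measurableT_comp.
move=> z; rewrite ger0_norm ?mulr_ge0 ?gam_ge0 ?expR_ge0 // mulrDl expRD.
by rewrite ler_wpM2r ?expR_ge0 // gam_le_expR.
Qed.

Lemma integrable_gam_gaussian (q : R) : 0 <= q ->
  gaussian.-integrable setT (EFin \o gam q).
Proof.
move=> q0; have := integrable_gam_expR_gaussian q0 (lexx 0).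
by apply: eq_integrable => // z _ /=; rewrite mul0r expR0 mulr1.
Qed.

(** Substitution z + t in the Lebesgue integral against the density of N(t, 1). *)
Let cameron_martin_ge0 (t : R) (G : R -> R) : continuous G -> (forall x, 0 <= G x) ->
  (\int[gaussian]_z (G (z + t))%:E =
   \int[gaussian]_z (G z * expR (t * z - t ^+ 2 / 2))%:E)%E.
Proof.
move=> cG G0.
have cst : continuous (fun z : R => z + t).
  by move=> z; apply: cvgD; [exact: cvg_id|exact: cvg_cst].
have mG : measurable_fun setT G by exact: continuous_measurable_fun.
rewrite ge0_integral_gaussian; last 2 first.
- apply/measurable_EFinP; apply: measurableT_comp mG _; exact: measurable_funD.
- by move=> x; rewrite lee_fin.
rewrite ge0_integral_gaussian; last 2 first.
- apply/measurable_EFinP; apply: measurable_funM => //.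
  by apply: measurableT_comp => //; apply: measurable_funB.
- by move=> x; rewrite lee_fin mulr_ge0 ?expR_ge0.
have e z : ((G z * expR (t * z - t ^+ 2 / 2))%:E * (gamma z)%:E =
    (G z * normal_pdf t 1 z)%:E)%E.
  by rewrite pdf_shift -EFinM; congr EFin; ring.
transitivity (\int[leb]_z (G z * normal_pdf t 1 z)%:E)%E; last first.
  by apply: eq_integral => z _; rewrite e.
have F' : (fun z : R => z + t)^`()%classic = (fun=> 1).
  apply/funext => z; rewrite derive1E deriveD //.
  by rewrite derive_id derive_cst addr0.
rewrite (@increasing_ge0_integration_by_substitutionT R (fun z => z + t)
  (fun z => G z * normal_pdf t 1 z)).
- apply: eq_integral => z _; rewrite -EFinM; congr EFin.
  rewrite /= F' mulr1; congr (_ * _).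
  by rewrite /gamma !normal_pdfE ?oner_neq0 // /normal_fun addrK subr0.
- by move=> x y xy; rewrite ltrD2r.
- by rewrite F'; exact: cst_continuous.
- by rewrite F'; exact: is_cvg_cst.
- by rewrite F'; exact: is_cvg_cst.
- by move=> z; apply: derivableD.
- exact: cvg_addrr_Ny.
- exact: cvg_addrr.
- by move=> z; apply: cvgM; [exact: cG|apply: continuous_normal_pdf; exact: oner_neq0].
- by move=> z; rewrite mulr_ge0 // normal_pdf_ge0.
Qed.

Section ibp.
Variables (q C : R) (G G' : R -> R).
Hypotheses (q0 : 0 <= q) (dG : forall x : R, is_derive x (1 : R) G (G' x)).
Hypotheses (GC : forall x, `|G x| <= C * gam q x) (G'C : forall x, `|G' x| <= C * gam q x).

Let C0 : 0 <= C.
Proof.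
by have := le_trans (normr_ge0 _) (GC 0); rewrite pmulr_lge0 // gam_gt0.
Qed.

Let cG : continuous G. Proof. by move=> x; exact: is_derive_continuous (dG x). Qed.

Let igam_shift (t : R) : gaussian.-integrable setT (EFin \o (fun z => C * gam q (z + t))).
Proof.
have h := integrable_scale (C * gam q t) (integrable_gam_gaussian q0).
apply: integrable_dominated h _.
  apply: measurable_funM => //; apply: (measurableT_comp (measurable_gam q)).
  exact: measurable_funD.
move=> z; rewrite ger0_norm ?mulr_ge0 ?gam_ge0 // -mulrA ler_wpM2l // mulrC.
exact: gam_add.
Qed.

Let igam_exp (t : R) :
  gaussian.-integrable setT (EFin \o (fun z => C * gam q z * expR (t * z - t ^+ 2 / 2))).
Proof.
have h := integrable_scale C (integrable_gam_expR_gaussian q0 (normr_ge0 t)).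
apply: integrable_dominated h _.
  apply: measurable_funM; first by apply: measurable_funM => //; exact: measurable_gam.
  by apply: measurableT_comp => //; apply: measurable_funB.
move=> z; rewrite ger0_norm ?mulr_ge0 ?gam_ge0 ?expR_ge0 // -mulrA ler_wpM2l //.
rewrite ler_wpM2l ?gam_ge0 // ler_expR.
have := ler_norm (t * z); rewrite normrM; have : 0 <= t ^+ 2 by exact: sqr_ge0.
move: (`|t| * `|z|) (t * z) (t ^+ 2) => u v w; lra.
Qed.

(** G = (|G| + G) - |G| is a difference of continuous nonnegative functions, and the growth bound
    makes all the integrals finite. *)
Lemma cameron_martin (t : R) :
  (\int[gaussian]_z G (z + t) = \int[gaussian]_z (G z * expR (t * z - t ^+ 2 / 2)))%R.
Proof.
have aux (H : R -> R) : continuous H -> (forall x, 0 <= H x) ->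
    (\int[gaussian]_z H (z + t) = \int[gaussian]_z (H z * expR (t * z - t ^+ 2 / 2)))%R.
  by move=> cH H0; rewrite /Rintegral cameron_martin_ge0.
have cN : continuous (fun x => `|G x|).
  by move=> x; apply: cvg_norm; exact: cG.
pose H x := `|G x| + G x.
have cH : continuous H by move=> x; apply: cvgD; [exact: cN|exact: cG].
have H0 x : 0 <= H x by have := ler_norm (- G x); rewrite normrN /H; lra.
have mN : measurable_fun setT (fun x => `|G x|) by exact: continuous_measurable_fun.
have mH : measurable_fun setT H by exact: continuous_measurable_fun.
have HC x : `|H x| <= 2 * (C * gam q x).
  by apply: le_trans (ler_normD _ _) _; rewrite normr_id; have := GC x; lra.
have mt : measurable_fun setT (fun z : R => z + t) by exact: measurable_funD.
have me : measurable_fun setT (fun z : R => expR (t * z - t ^+ 2 / 2)).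
  by apply: measurableT_comp => //; apply: measurable_funB.
have i1 : gaussian.-integrable setT (EFin \o (fun z => H (z + t))).
  apply: integrable_dominated (integrable_scale 2 (igam_shift t)) _.
    exact: measurableT_comp mH mt.
  by move=> z; exact: HC.
have i2 : gaussian.-integrable setT (EFin \o (fun z => `|G (z + t)|)).
  apply: integrable_dominated (igam_shift t) _; first exact: measurableT_comp mN mt.
  by move=> z; rewrite normr_id.
have i3 : gaussian.-integrable setT (EFin \o (fun z => H z * expR (t * z - t ^+ 2 / 2))).
  apply: integrable_dominated (integrable_scale 2 (igam_exp t)) _; first exact: measurable_funM.
  by move=> z; rewrite normrM (ger0_norm (expR_ge0 _)) mulrA ler_wpM2r ?expR_ge0.
have i4 : gaussian.-integrable setT (EFin \o (fun z => `|G z| * expR (t * z - t ^+ 2 / 2))).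
  apply: integrable_dominated (igam_exp t) _; first exact: measurable_funM.
  by move=> z; rewrite normrM normr_id (ger0_norm (expR_ge0 _)) ler_wpM2r ?expR_ge0.
transitivity (\int[gaussian]_z (H (z + t) - `|G (z + t)|))%R.
  by apply: eq_Rintegral => z _; rewrite /H addrAC subrr add0r.
rewrite (RintegralB measurableT i1 i2) aux // (aux (fun x => `|G x|)) //.
rewrite -(RintegralB measurableT i3 i4); apply: eq_Rintegral => z _.
by rewrite /H mulrDl addrAC subrr add0r.
Qed.

Let mG : measurable_fun setT G. Proof. exact: continuous_measurable_fun. Qed.

(* Differentiate the Cameron-Martin formula at t = 0. *)
Lemma gaussian_ibp : (\int[gaussian]_z (z * G z) = \int[gaussian]_z G' z)%R.
Proof.
pose e (t z : R) := expR (t * z - t ^+ 2 / 2).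
have dl : is_derive (0 : R) (1 : R) (fun t => \int[gaussian]_z G (z + t))%R
    (\int[gaussian]_z G' (z + 0))%R.
  apply: (@is_derive_Rintegral R _ _ gaussian (fun t z => G (z + t))
    (fun t z => G' (z + t)) 0 (- 1) 1 (fun z => C * gam q 1 * gam q z)).
  - by rewrite oppr_lt0 ltr01.
  - move=> t _; apply: integrable_dominated (igam_shift t) _ => //.
    by apply: measurableT_comp mG _; exact: measurable_funD.
  - move=> t z _; under eq_fun do rewrite addrC.
    by apply: is_derive_shift; rewrite addrC; exact: dG.
  - move=> t z /andP[t1 t2]; apply: le_trans (G'C _) _; rewrite -mulrA ler_wpM2l //.
    rewrite addrC; apply: le_trans (gam_add _ _ q0) _.
    rewrite ler_wpM2r ?gam_ge0 // ge0_ler_powR ?nnegrE ?addr_ge0 // lerD2l normr1.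
    by rewrite ler_norml (ltW t1) (ltW t2).
  - apply: integrable_scale; exact: integrable_gam_gaussian.
have de (t z : R) : is_derive t (1 : R) (e ^~ z) ((z - t) * e t z).
  have h : is_derive t (1 : R) (fun t => t * z - t ^+ 2 / 2) (z - t).
    have -> : (fun t => t * z - t ^+ 2 / 2) = (fun t => z * t - 2^-1 * t ^+ 2).
      by apply/funext => u; ring.
    apply: is_derive_eq (is_derive_sub (is_derive_scale z (is_derive_id t (1 : R)))
      (is_derive_scale 2^-1 (is_derive_expn 1 t))) _.
    by field.
  have := @is_derive1_comp _ expR (fun t => t * z - t ^+ 2 / 2) t _ _
    (is_derive_expR _) h.
  by rewrite -/(e t z) mulrC.
have dr : is_derive (0 : R) (1 : R) (fun t => \int[gaussian]_z (G z * e t z))%R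
    (\int[gaussian]_z (G z * ((z - 0) * e 0 z)))%R.
  have i1 := integrable_scale (2 * C) (integrable_gam_expR_gaussian (addr_ge0 q0 ler01) ler01).
  apply: (@is_derive_Rintegral R _ _ gaussian (fun t z => G z * e t z)
    (fun t z => G z * ((z - t) * e t z)) 0 (- 1) 1
    (fun z => 2 * C * (gam (q + 1) z * expR (1 * `|z|)))) => //.
  - by rewrite oppr_lt0 ltr01.
  - move=> t _; apply: integrable_dominated (igam_exp t) _.
      apply: measurable_funM => //; apply: measurableT_comp => //; exact: measurable_funB.
    by move=> z; rewrite normrM (ger0_norm (expR_ge0 _)) ler_wpM2r ?expR_ge0.
  - move=> t z /andP[t1 t2]; rewrite !normrM (ger0_norm (expR_ge0 _)).
    have t1' : `|t| <= 1 by rewrite ler_norml (ltW t1) (ltW t2).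
    rewrite gamD -[2 * C]mulrC -!mulrA; apply: (@le_trans _ _
      (C * gam q z * (2 * gam 1 z * expR `|z|))); last first.
      by rewrite le_eqVlt mul1r; apply/orP; left; apply/eqP; ring.
    apply: ler_pM => //; apply: ler_pM => //; rewrite ?expR_ge0 //.
      rewrite /gam powRr1 ?addr_ge0 //; apply: le_trans (ler_normB _ _) _.
      have := normr_ge0 z; move: (`|z|) (`|t|) t1' => a b; lra.
    rewrite ler_expR; apply: (@le_trans _ _ (t * z)).
      by rewrite gerBl mulrA divr_ge0 // -expr2 sqr_ge0.
    by apply: le_trans (ler_norm _) _; rewrite normrM ler_piMl.
have eq : (fun t => \int[gaussian]_z G (z + t))%R = (fun t => \int[gaussian]_z (G z * e t z))%R.
  by apply/funext => t; exact: cameron_martin.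
rewrite eq in dl.
case: dl => _ h; case: dr => _; rewrite {}h => h.
transitivity (\int[gaussian]_z (G z * ((z - 0) * e 0 z)))%R.
  apply: eq_Rintegral => z _; rewrite /e expr0n /= mul0r mul0r subr0 subr0 expR0; ring.
by rewrite -h; apply: eq_Rintegral => z _; rewrite addr0.
Qed.

End ibp.
End gaussian.

(** * Moments of the standard Gaussian law *)

Section gaussian_moments.
Variable R : realType.
Local Notation N := (gaussian R).

Lemma integrable_exprn_gaussian k : N.-integrable setT (EFin \o (fun z => z ^+ k)).
Proof.
apply: integrable_dominated (integrable_gam_gaussian (ler0n R k)) _.
  exact: measurable_funX.
by move=> z; rewrite normrX exprn_le_gam.
Qed.

Lemma integrable_powR_gaussian (r : R) : 0 <= r ->
  N.-integrable setT (EFin \o (fun z => `|z| `^ r)).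
Proof.
move=> r0; apply: integrable_dominated (integrable_gam_gaussian r0) _.
  by apply: (measurableT_comp (measurable_powR r)); exact: normr_measurable.
by move=> z; rewrite ger0_norm ?powR_ge0 // powR_le_gam.
Qed.

(** Integration by parts with G = z^(k+1). Matching moments hand this recurrence down to the
    summands X_ij. *)
Lemma gaussian_moment_rec k :
  (\int[N]_z (z ^+ k.+2) = k.+1%:R * \int[N]_z (z ^+ k))%R.
Proof.
rewrite -(RintegralZl _ measurableT (integrable_exprn_gaussian k)).
transitivity (\int[N]_z (z * z ^+ k.+1))%R.
  by apply: eq_Rintegral => z _; rewrite exprS.
apply: (@gaussian_ibp R k.+1%:R k.+1%:R) => [|z|z|z]; first by [].
- exact: is_derive_expn.
- rewrite normrX; apply: le_trans (exprn_le_gam _ _) _.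
  by rewrite ler_peMl ?gam_ge0 // ler1n.
- rewrite normrM normrX ger0_norm // ler_wpM2l //.
  by apply: le_trans (exprn_le_gam _ _) (gam_le _ _); rewrite ler_nat.
Qed.

Lemma gaussian_mean : (\int[N]_z z = 0)%R.
Proof.
transitivity (\int[N]_z (z * cst 1 z))%R.
  by apply: eq_Rintegral => z _; rewrite mulr1.
rewrite (@gaussian_ibp R 0 1 (cst 1) (cst 0)) //.
- by rewrite Rintegral_cst_prob.
- by move=> x; rewrite normr1 mul1r /gam powRr0.
- by move=> x; rewrite normr0 mulr_ge0 // gam_ge0.
Qed.

(** |z| <= (1 + z^2)/2, and the second moment is 1. *)
Lemma gaussian_mean_norm_le1 : (\int[N]_z `|z| <= 1)%R.
Proof.
have i2 := integrable_exprn_gaussian 2.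
have i1 : N.-integrable setT (EFin \o (fun z => `|z|)).
  have := integrable_powR_gaussian (@ler01 R).
  by apply: eq_integrable => // z _ /=; rewrite powRr1.
have e2 : (\int[N]_z (z ^+ 2) = 1)%R.
  by rewrite gaussian_moment_rec mul1r (Rintegral_cst_prob N 1).
have i3 := integrable_scale 2^-1 (integrable_add (integrable_cst_prob N 1) i2).
have -> : 1 = (\int[N]_z (2^-1 * (cst 1 z + z ^+ 2)))%R.
  rewrite (RintegralZl _ measurableT (integrable_add (integrable_cst_prob N 1) i2)).
  rewrite (RintegralD measurableT (integrable_cst_prob N 1) i2) Rintegral_cst_prob e2.
  by field.
apply: le_Rintegral => // z _; rewrite /cst -real_normK ?num_real //.
have : 0 <= (`|z| - 1) ^+ 2 by exact: sqr_ge0.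
by move: (`|z|) => a; nra.
Qed.

(* Chebyshev's association inequality for the monotone functions t and t `^ r. *)
Lemma gaussian_moment_assoc (r : R) : 0 <= r ->
  (\int[N]_z `|z|)%R * (\int[N]_z (`|z| `^ r))%R <= (\int[N]_z (`|z| `^ (r + 1)))%R.
Proof.
move=> r0; set m := (\int[N]_z `|z|)%R.
have i1 : N.-integrable setT (EFin \o (fun z => `|z|)).
  have := integrable_powR_gaussian (@ler01 R).
  by apply: eq_integrable => // z _ /=; rewrite powRr1.
have ir := integrable_powR_gaussian r0.
have ir1 := integrable_powR_gaussian (addr_ge0 r0 ler01).
have m0 : 0 <= m by apply: Rintegral_ge0.
have j1 := integrable_scale m ir; have j2 := integrable_scale (m `^ r) i1.
have j3 := integrable_cst_prob N (m * m `^ r).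
have : (\int[N]_z (m * `|z| `^ r + m `^ r * `|z|) <=
    \int[N]_z (`|z| `^ (r + 1) + cst (m * m `^ r) z))%R.
  apply: le_Rintegral => //; [exact: integrable_add j1 j2|exact: integrable_add ir1 j3|].
  move=> z _; rewrite /cst powRD; last by apply/implyP; rewrite gt_eqF // ltr_wpDl.
  rewrite powRr1 // -subr_ge0.
  have -> : `|z| `^ r * `|z| + m * m `^ r - (m * `|z| `^ r + m `^ r * `|z|) =
    (`|z| `^ r - m `^ r) * (`|z| - m) by ring.
  have [zm|/ltW mz] := leP `|z| m.
    by rewrite mulr_le0 // subr_le0 // ge0_ler_powR ?nnegrE.
  by rewrite mulr_ge0 // subr_ge0 // ge0_ler_powR ?nnegrE.
rewrite (RintegralD measurableT j1 j2) (RintegralD measurableT ir1 j3) Rintegral_cst_prob.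
rewrite (RintegralZl _ measurableT ir) (RintegralZl _ measurableT i1) -/m.
by rewrite (mulrC m (m `^ r)) lerD2r.
Qed.

End gaussian_moments.

(** * Gaussian interpolation *)

Lemma is_derive_comp {R : realType} (f g : R -> R) (df dg x : R) :
  is_derive (g x) (1 : R) f df -> is_derive x (1 : R) g dg ->
  is_derive x (1 : R) (fun z => f (g z)) (df * dg).
Proof. exact: is_derive1_comp. Qed.

Lemma is_derive_affine_map {R : realType} (a b x : R) :
  is_derive x (1 : R) (fun z => a + b * z) b.
Proof.
apply: is_derive_eq (is_derive_add (is_derive_cst a x (1 : R))
  (is_derive_scale b (is_derive_id x (1 : R)))) _.
by rewrite mulr1 add0r.
Qed.

(** The derivative is the pointwise limit of the difference quotients with step 1/(n+1). This covers
    the top derivative of Psi, which may be discontinuous. *)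
Lemma is_derive_measurable {R : realType} (f df : R -> R) :
  (forall x : R, is_derive x (1 : R) f (df x)) -> measurable_fun setT df.
Proof.
move=> fd; have mf : measurable_fun setT f.
  by apply: continuous_measurable_fun => x; exact: is_derive_continuous (fd x).
pose h (n : nat) x := (harmonic n)^-1 * (f (harmonic n + x) - f x).
apply: (@measurable_fun_cvg _ _ _ _ h) => [n|x _].
  apply: measurable_funM => //; apply: measurable_funB => //.
  by apply: measurableT_comp mf _; exact: measurable_funD.
have [dx <-] := fd x.
have /cvgr_dnbhsP : (fun t : R => t^-1 *: (f (t + x) - f x)) @ 0^' --> 'D_1 f x.
  by under eq_fun do rewrite -[X in f (X + _)]mulr1; exact: dx.
apply; split=> [n|]; last exact: cvg_harmonic.
by rewrite gt_eqF // harmonic_gt0.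
Qed.

Section growth_of_primitives.
Context {R : realType}.

Lemma gam_mono (e u v : R) : 0 <= e -> `|u| <= `|v| -> gam e u <= gam e v.
Proof. by move=> e0 uv; rewrite ge0_ler_powR ?nnegrE ?addr_ge0 ?lerD2l. Qed.

Lemma primitive_growth (f df : R -> R) (C e : R) : 0 <= C -> 0 <= e ->
  (forall x : R, is_derive x (1 : R) f (df x)) ->
  (forall x, `|df x| <= C * gam e x) ->
  forall x, `|f x| <= (`|f 0| + C) * gam (e + 1) x.
Proof.
move=> C0 e0 fd dfC x; have [c /andP[c1 c2] fx] := is_derive_mvt 0 x fd.
have cx : `|c| <= `|x|.
  move: c1 c2; rewrite ge_min le_max ler_norml.
  have [x0|/ltW x0] := leP 0 x.
    by rewrite ger0_norm //; move=> /orP[] h1 /orP[] h2; apply/andP; split; lra.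
  by rewrite ler0_norm //; move=> /orP[] h1 /orP[] h2; apply/andP; split; lra.
have -> : f x = f 0 + df c * x by move: fx; rewrite subr0 => <-; rewrite addrC subrK.
apply: le_trans (ler_normD _ _) _; rewrite mulrDl lerD //.
  by rewrite ler_peMr // gam_ge1 // addr_ge0.
rewrite normrM gamD mulrA ler_pM ?norm_le_gam //.
by apply: le_trans (dfC c) _; rewrite ler_wpM2l // gam_mono.
Qed.

(** Integration downwards from the top derivative costs one power of growth per step. The constant
    [C] serves integrability alone and does not enter the final bound. *)
Lemma derivatives_growth (p : nat) (Psi : nat -> R -> R) (al be r : R) :
  0 <= al -> 0 <= be -> 0 <= r ->
  (forall k (x : R), (k < p)%N -> is_derive x (1 : R) (Psi k) (Psi k.+1 x)) ->
  (forall x, `|Psi p x| <= al + be * `|x| `^ r) ->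
  exists2 C, 0 <= C & forall k x, (k <= p)%N -> `|Psi k x| <= C * gam (p%:R + r) x.
Proof.
move=> al0 be0 r0 dPsi Pp.
have h j : (j <= p)%N -> exists2 C, 0 <= C &
    forall k x, (p - j <= k <= p)%N -> `|Psi k x| <= C * gam (j%:R + r) x.
  elim: j => [|j ih] jp.
    exists (al + be) => [|k x]; first exact: addr_ge0.
    rewrite subn0 -eqn_leq => /eqP <-; apply: le_trans (Pp x) _.
    rewrite add0r mulrDl lerD //; first by rewrite ler_peMr // gam_ge1.
    by rewrite ler_wpM2l // powR_le_gam.
  have [C C0 hC] := ih (ltnW jp).
  have kp : (p - j.+1 < p)%N by rewrite subnSK // leq_subr.
  have dk x := dPsi (p - j.+1)%N x kp.
  have bk x : `|Psi (p - j.+1).+1 x| <= C * gam (j%:R + r) x.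
    by apply: hC; rewrite subnSK // leqnn leq_subr.
  have hk := primitive_growth C0 (addr_ge0 (ler0n R j) r0) dk bk.
  exists (`|Psi (p - j.+1)%N 0| + C); first exact: addr_ge0.
  move=> k x /andP[]; rewrite leq_eqVlt => /orP[/eqP <- _|kj kp'].
    by have := hk x; rewrite addrAC natr1.
  have h1 : (p - j <= k <= p)%N by rewrite kp' andbT -subnSK.
  apply: le_trans (hC k x h1) _; apply: ler_pM; rewrite ?gam_ge0 ?lerDr //.
  by apply: gam_le; rewrite lerD2r ler_nat.
have [C C0 hC] := h p (leqnn p).
by exists C => // k x kp; apply: hC; rewrite subnn.
Qed.

End growth_of_primitives.

(** * Averages of s w + c Z over a Gaussian Z *)

Section smoothing.
Context {R : realType}.
Local Notation N := (gaussian R).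
Variables (s c : R).
Hypotheses (s1 : `|s| <= 1) (c1 : `|c| <= 1).

Lemma measurable_affine w : measurable_fun setT (fun z : R => s * w + c * z).
Proof. by apply: measurable_funD => //; exact: measurable_funM. Qed.

Lemma integrable_smoothing (F : R -> R) (C q w : R) (e : nat) : 0 <= C -> 0 <= q ->
  measurable_fun setT F -> (forall x, `|F x| <= C * gam q x) ->
  N.-integrable setT (EFin \o (fun z => z ^+ e * F (s * w + c * z))).
Proof.
move=> C0 q0 mF FC; have qe : 0 <= e%:R + q by rewrite addr_ge0.
apply: integrable_dominated
  (integrable_scale (C * gam q w) (integrable_gam_gaussian qe)) _.
  apply: measurable_funM; first exact: measurable_funX.
  exact: measurableT_comp mF (measurable_affine w).
move=> z; rewrite normrM normrX gamD mulrCA ler_pM ?exprn_le_gam //.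
by apply: le_trans (FC _) _; rewrite -mulrA ler_wpM2l // gam_mulD.
Qed.

Lemma is_derive_affine (F dF : R -> R) (w z : R) :
  (forall x : R, is_derive x (1 : R) F (dF x)) ->
  is_derive w (1 : R) (fun w => F (s * w + c * z)) (s * dF (s * w + c * z)).
Proof.
move=> Fd; have h := is_derive_comp (Fd _) (is_derive_affine_map (c * z) s w).
have -> : s * dF (s * w + c * z) = dF (c * z + s * w) * s by rewrite mulrC addrC.
by under eq_fun do rewrite addrC.
Qed.

Lemma is_derive_smoothing (F dF : R -> R) (C q w : R) (e : nat) : 0 <= C -> 0 <= q ->
  (forall x : R, is_derive x (1 : R) F (dF x)) ->
  (forall x, `|F x| <= C * gam q x) -> (forall x, `|dF x| <= C * gam q x) ->
  is_derive w (1 : R) (fun w => \int[N]_z (z ^+ e * F (s * w + c * z)))%R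
    (\int[N]_z (z ^+ e * (s * dF (s * w + c * z))))%R.
Proof.
move=> C0 q0 Fd FC dFC; have qe : 0 <= e%:R + q by rewrite addr_ge0.
have mF : measurable_fun setT F.
  by apply: continuous_measurable_fun => x; exact: is_derive_continuous (Fd x).
apply: (@is_derive_Rintegral R _ _ N (fun w z => z ^+ e * F (s * w + c * z))
  (fun w z => z ^+ e * (s * dF (s * w + c * z))) w (w - 1) (w + 1)
  (fun z => C * gam q (`|w| + 1) * gam (e%:R + q) z)).
- by rewrite ltrBlDr ltrDl ltr01.
- by move=> t _; exact: integrable_smoothing FC.
- by move=> t z _; apply: (is_derive_scale (z ^+ e)); exact: is_derive_affine.
- move=> t z /andP[t1 t2].
  have tw : `|t| <= `| `|w| + 1|.
    rewrite [leRHS]ger0_norm ?addr_ge0 // ler_norml.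
    by have := ler_norm w; have := ler_norm (- w); rewrite normrN; lra.
  rewrite !normrM normrX gamD [leRHS]mulrCA ler_pM ?exprn_le_gam ?mulr_ge0 //.
  apply: (@le_trans _ _ (C * gam q (s * t + c * z))).
    by rewrite -[leRHS]mul1r ler_pM.
  rewrite -mulrA ler_wpM2l //; apply: le_trans (gam_mulD _ _ q0 s1 c1) _.
  by rewrite ler_wpM2r ?gam_ge0 // gam_mono.
- apply: integrable_scale; exact: integrable_gam_gaussian.
Qed.

Lemma smoothing_growth (F : R -> R) (C q w : R) : 0 <= C -> 0 <= q ->
  measurable_fun setT F -> (forall x, `|F x| <= C * gam q x) ->
  `|(\int[N]_z F (s * w + c * z))%R| <= C * (\int[N]_z gam q z)%R * gam q w.
Proof.
move=> C0 q0 mF FC.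
have iF := @integrable_smoothing F C q w 0 C0 q0 mF FC.
have {}iF : N.-integrable setT (EFin \o (fun z => F (s * w + c * z))).
  by apply: eq_integrable iF => // z _ /=; rewrite mul1r.
have iG := integrable_gam_gaussian q0.
apply: le_trans (le_normr_Rintegral measurableT iF) _.
rewrite [leRHS]mulrAC -(RintegralZl _ measurableT iG).
apply: le_Rintegral => //.
- by apply: integrable_norm.
- exact: integrable_scale.
by move=> z _; apply: le_trans (FC _) _; rewrite -mulrA ler_wpM2l // gam_mulD.
Qed.

(** The factor c is the derivative of the inner affine map in z; dividing by it is what puts 1 / cos
    t into the bound on the top derivative. *)
Lemma smoothing_ibp (F dF : R -> R) (C q w : R) : 0 <= C -> 0 <= q ->
  (forall x : R, is_derive x (1 : R) F (dF x)) ->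
  (forall x, `|F x| <= C * gam q x) -> (forall x, `|dF x| <= C * gam q x) ->
  (\int[N]_z (z * F (s * w + c * z)) = c * \int[N]_z dF (s * w + c * z))%R.
Proof.
move=> C0 q0 Fd FC dFC; have mdF := is_derive_measurable Fd.
have i1 := @integrable_smoothing dF C q w 0 C0 q0 mdF dFC.
have {}i1 : N.-integrable setT (EFin \o (fun z => dF (s * w + c * z))).
  by apply: eq_integrable i1 => // z _ /=; rewrite mul1r.
rewrite -(RintegralZl _ measurableT i1).
have b (H : R -> R) z : (forall x, `|H x| <= C * gam q x) ->
    `|H (s * w + c * z)| <= C * gam q w * gam q z.
  by move=> HC; apply: le_trans (HC _) _; rewrite -mulrA ler_wpM2l // gam_mulD.
apply: (@gaussian_ibp R q (C * gam q w) (fun z => F (s * w + c * z))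
  (fun z => c * dF (s * w + c * z))) => // z; last first.
- by rewrite normrM -[leRHS]mul1r ler_pM // b.
- exact: b.
by rewrite [c * dF _]mulrC; exact: (is_derive_comp (Fd _) (is_derive_affine_map (s * w) c z)).
Qed.

End smoothing.

Definition add_const (R : realType) (r : R) : R := if r < 1 then 1 else 2 `^ r.

Lemma add_const_ge0 (R : realType) (r : R) : 0 <= add_const r.
Proof. by rewrite /add_const; case: ifP => // _; exact: powR_ge0. Qed.

Lemma powR_norm_add_le (R : realType) (r u v : R) : 0 <= r ->
  `|u + v| `^ r <= add_const r * (`|u| `^ r + `|v| `^ r).
Proof.
move=> r0; apply: (@le_trans _ _ ((`|u| + `|v|) `^ r)).
  by rewrite ge0_ler_powR ?nnegrE ?addr_ge0 ?ler_normD.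
rewrite /add_const; case: ltP => r1; last exact: powR_add_le.
by rewrite mul1r; apply: powR_subadditive => //; exact: ltW.
Qed.

Lemma add_const_le (R : realType) (r : R) : 0 <= r -> add_const r <= 2 `^ r.
Proof.
move=> r0; rewrite /add_const; case: ifP => // _.
by rewrite -[leLHS](powRr0 2); apply: ler_powR => //; lra.
Qed.

Lemma add_split_const (R : realType) (r : R) : add_const r * split_const r <= 2 `^ r * 2 `^ r.
Proof.
rewrite /add_const /split_const; case: ifP => _; last by [].
by rewrite mul1r.
Qed.

(** * The smoothed derivatives *)

Section smoothed_sequence.
Context {R : realType}.
Local Notation N := (gaussian R).
Variables (s c : R) (p1 : nat) (Psi : nat -> R -> R) (al be r : R).
Hypotheses (s0 : 0 <= s) (s1 : s <= 1) (c0 : 0 < c) (c1 : c <= 1).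
Hypotheses (p10 : (0 < p1)%N) (al0 : 0 <= al) (be0 : 0 <= be) (r0 : 0 <= r).
Hypothesis dPsi : forall k (x : R), (k < p1.+1)%N ->
  is_derive x (1 : R) (Psi k) (Psi k.+1 x).
Hypothesis topPsi : forall x, `|Psi p1.+1 x| <= al + be * `|x| `^ r.

Let q : R := p1.+1%:R + r.
Let q0 : 0 <= q. Proof. by rewrite addr_ge0. Qed.
Let ns : `|s| <= 1. Proof. by rewrite ger0_norm. Qed.
Let nc : `|c| <= 1. Proof. by rewrite ger0_norm // ltW. Qed.

(* For k <= p1 this is the k-th derivative of w |-> E Psi_1(s w + c Z). Since
   Psi_(p1.+1) need not be derivable, the last derivative is taken after a
   Gaussian integration by parts. *)
Definition smoothed (k : nat) (w : R) : R :=
  if (k <= p1)%N then s ^+ k * (\int[N]_z Psi k.+1 (s * w + c * z))%R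
  else s ^+ p1.+1 / c * (\int[N]_z (z * Psi p1.+1 (s * w + c * z)))%R.

Lemma measurable_Psi k : (k <= p1.+1)%N -> measurable_fun setT (Psi k).
Proof.
case: k => [_|k kp].
  by apply: continuous_measurable_fun => x; exact: is_derive_continuous (dPsi x (ltn0Sn p1)).
by apply: (is_derive_measurable (f := Psi k)) => x; exact: dPsi.
Qed.

Lemma is_derive_smoothed k (w : R) : (k < p1.+1)%N ->
  is_derive w (1 : R) (smoothed k) (smoothed k.+1 w).
Proof.
have [C C0 hC] := derivatives_growth al0 be0 r0 dPsi topPsi.
rewrite ltnS leq_eqVlt => /orP[/eqP ->|kp].
  (* Integration by parts read backwards: in this form w enters through [Psi p1], which can still be
     differentiated. *)
  have e : smoothed p1 = (fun w => s ^+ p1 / c *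
      (\int[N]_z (z ^+ 1 * Psi p1 (s * w + c * z)))%R).
    apply/funext => x; rewrite /smoothed leqnn.
    transitivity (s ^+ p1 / c * (c * \int[N]_z Psi p1.+1 (s * x + c * z)))%R.
      by field; rewrite gt_eqF.
    congr (_ * _); apply/esym.
    exact: (@smoothing_ibp R s c ns nc (Psi p1) (Psi p1.+1) C q x C0 q0
      (fun x => dPsi x (leqnn _)) (fun x => hC p1 x (leqnSn _))
      (fun x => hC p1.+1 x (leqnn _))).
  rewrite e /smoothed ltnn.
  have h := is_derive_scale (s ^+ p1 / c) (@is_derive_smoothing R s c ns nc (Psi p1) (Psi p1.+1)
    C q w 1 C0 q0 (fun x => dPsi x (leqnn _)) (fun x => hC p1 x (leqnSn _))
    (fun x => hC p1.+1 x (leqnn _))).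
  apply: is_derive_eq h _.
  have i1 := @integrable_smoothing R s c ns nc (Psi p1.+1) C q w 1 C0 q0
    (measurable_Psi (leqnn _)) (fun x => hC p1.+1 x (leqnn _)).
  rewrite exprS.
  transitivity (s ^+ p1 / c * (s * \int[N]_z (z ^+ 1 * Psi p1.+1 (s * w + c * z))))%R.
    congr (_ * _); rewrite -(RintegralZl _ measurableT i1).
    by apply: eq_Rintegral => z _; ring.
  by ring.
have kp' : (k.+1 < p1.+1)%N by rewrite ltnS.
have e : smoothed k = (fun w => s ^+ k * (\int[N]_z (z ^+ 0 * Psi k.+1 (s * w + c * z)))%R).
  apply/funext => x; rewrite /smoothed ltnW //; congr (_ * _).
  by apply: eq_Rintegral => z _; rewrite mul1r.
rewrite e /smoothed kp.
have h := is_derive_scale (s ^+ k) (@is_derive_smoothing R s c ns nc (Psi k.+1) (Psi k.+2)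
    C q w 0 C0 q0 (fun x => dPsi x kp') (fun x => hC k.+1 x (ltnW kp'))
    (fun x => hC k.+2 x kp')).
apply: is_derive_eq h _.
have i1 := @integrable_smoothing R s c ns nc (Psi k.+2) C q w 0 C0 q0
  (measurable_Psi kp') (fun x => hC k.+2 x kp').
transitivity (s ^+ k * (s * \int[N]_z (z ^+ 0 * Psi k.+2 (s * w + c * z))))%R.
  congr (_ * _); rewrite -(RintegralZl _ measurableT i1).
  by apply: eq_Rintegral => z _; ring.
rewrite exprSr -mulrA; congr (_ * (_ * _)).
by apply: eq_Rintegral => z _; rewrite mul1r.
Qed.

Lemma smoothed_growth : exists C, forall k w, (k <= p1)%N ->
  `|smoothed k w| <= C * gam q w.
Proof.
have [C C0 hC] := derivatives_growth al0 be0 r0 dPsi topPsi.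
exists (C * (\int[N]_z gam q z)%R) => k w kp; rewrite /smoothed kp normrM.
have h := @smoothing_growth R s c ns nc (Psi k.+1) C q w C0 q0
  (measurable_Psi (kp : (k.+1 <= p1.+1)%N)) (fun x => hC k.+1 x kp).
rewrite -[leRHS]mul1r ler_pM // normrX.
by rewrite exprn_ile1.
Qed.

(** The weight |Z| multiplies al + be |s w + c Z|^r. Splitting the power with [add_const] leaves
    E|Z| with the part in w, and raises the part in Z to a moment of order r + 1. *)
Lemma smoothed_top w : `|smoothed p1.+1 w| <=
  s ^+ p1.+1 / c * (al * (\int[N]_z `|z|)%R + be * add_const r * (\int[N]_z (`|z| `^ (r + 1)))%R)
  + s ^+ p1.+1 / c * (be * add_const r * (\int[N]_z `|z|)%R) * `|w| `^ r.
Proof.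
have [C C0 hC] := derivatives_growth al0 be0 r0 dPsi topPsi.
rewrite /smoothed ltnn normrM ger0_norm; last by rewrite divr_ge0 ?exprn_ge0 // ltW.
rewrite -[X in _ + X]mulrA -[leRHS]mulrDr ler_wpM2l //.
  by rewrite divr_ge0 ?exprn_ge0 // ltW.
have i1 := @integrable_smoothing R s c ns nc (Psi p1.+1) C q w 1 C0 q0
    (measurable_Psi (leqnn _)) (fun x => hC p1.+1 x (leqnn _)).
apply: le_trans (le_normr_Rintegral measurableT i1) _.
have j1 : N.-integrable setT (EFin \o (fun z => `|z|)).
  have := integrable_powR_gaussian (@ler01 R).
  by apply: eq_integrable => // z _ /=; rewrite powRr1.
have jr := integrable_powR_gaussian (addr_ge0 r0 ler01).
have k1 := integrable_scale (al + be * add_const r * `|w| `^ r) j1.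
have kr := integrable_scale (be * add_const r) jr.
apply: (@le_trans _ _ (\int[N]_z ((al + be * add_const r * `|w| `^ r) * `|z| +
    be * add_const r * `|z| `^ (r + 1)))%R).
  apply: le_Rintegral => //; first exact: integrable_norm.
    exact: integrable_add k1 kr.
  move=> z _; rewrite normrM powRD; last by apply/implyP; rewrite gt_eqF // ltr_wpDl.
  rewrite powRr1 //.
  have -> : (al + be * add_const r * `|w| `^ r) * `|z| +
      be * add_const r * (`|z| `^ r * `|z|) =
    `|z| * (al + be * (add_const r * (`|w| `^ r + `|z| `^ r))) by ring.
  rewrite ler_wpM2l //; apply: le_trans (topPsi _) _; rewrite lerD2l ler_wpM2l //.
  apply: le_trans (powR_norm_add_le _ _ r0) _; rewrite ler_wpM2l ?add_const_ge0 //.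
  have mono (a x : R) : `|a| <= 1 -> `|a * x| `^ r <= `|x| `^ r.
    by move=> a1; rewrite ge0_ler_powR ?nnegrE // normrM ler_piMl.
  by rewrite lerD // mono.
rewrite (RintegralD measurableT k1 kr) (RintegralZl _ measurableT j1).
rewrite (RintegralZl _ measurableT jr).
by rewrite le_eqVlt; apply/orP; left; apply/eqP; ring.
Qed.

End smoothed_sequence.

(* [t / 2 - sin t cos t / 2] is a primitive of [sin ^ 2], so the integral of
   [sin ^ 2] over [0, pi / 2] is [pi / 4 <= 1]. *)
Lemma sine_comparison (R : realType) (F D : R -> R) (L : R) :
  (forall t : R, is_derive t (1 : R) F (D t)) -> 0 <= L ->
  (forall t, 0 < t -> t < pi / 2 -> D t <= sin t ^+ 2 * L) ->
  F (pi / 2) - F 0 <= L.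
Proof.
move=> dF L0 DL.
pose G t := F t - L * (2^-1 * t - 2^-1 * (sin t * cos t)).
have dG (t : R) : is_derive t (1 : R) G (D t - L * sin t ^+ 2).
  have h := is_derive_sub (is_derive_scale 2^-1 (is_derive_id t (1 : R)))
    (is_derive_scale 2^-1 (is_derive_mul (is_derive_sin t) (is_derive_cos t))).
  apply: is_derive_eq (is_derive_sub (dF t) (is_derive_scale L h)) _.
  congr (_ - _ * _); have := cos2Dsin2 t; move: (cos t) (sin t) => u v uv.
  have -> : v ^+ 2 = 2^-1 * (u ^+ 2 + v ^+ 2) + 2^-1 * (v ^+ 2 - u ^+ 2) by field.
  by rewrite uv; field.
have pi0 : 0 < pi / 2 :> R by rewrite divr_gt0 // pi_gt0.
have cG : {within `[0, (pi / 2)], continuous G}%classic.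
  by apply: continuous_subspaceT => t; exact: (@is_derive_continuous R G (fun t => D t - L * sin t ^+ 2) t (dG t)).
have [t] := MVT pi0 (fun t _ => dG t) cG.
rewrite in_itv /= => /andP[t0 t1] Gt.
have G1 : G (pi / 2) <= G 0.
  rewrite -subr_le0 Gt subr0 pmulr_lle0 // subr_le0 mulrC; exact: DL.
have : pi / 2 <= (2 : R) by have /andP[_ /ltW] := @pihalf_02 R.
move: G1; rewrite /G sin0 sin_pihalf cos_pihalf !mul0r !mulr0 !subr0.
move: (F (pi / 2)) (F 0) (pi / 2) => a b c'; nra.
Qed.

(** * Comparison for one coordinate *)

Section one_dim.
Context {R : realType} {d : measure_display} {T : measurableType d}.
Variable P : probability T R.
Local Notation N := (gaussian R).
Variables (n : nat) (X : 'I_n -> {RV P >-> R}) (p1 : nat) (r : R).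
Hypotheses (n0 : (0 < n)%N) (indepX : mutually_independent X).
Hypotheses (p10 : (0 < p1)%N) (r0 : 0 <= r).
Hypothesis mX : forall i k, (k <= p1.+1)%N ->
  (\int[P]_x (X i x ^+ k) = \int[N]_z (z ^+ k))%R.
Hypothesis iX : forall i, P.-integrable setT (EFin \o (gam (p1.+2%:R + r) \o X i)).
Variables (al be : R) (Psi : nat -> R -> R).
Hypotheses (al0 : 0 <= al) (be0 : 0 <= be).
Hypothesis dPsi : forall k (x : R), (k < p1.+1)%N ->
  is_derive x (1 : R) (Psi k) (Psi k.+1 x).
Hypothesis topPsi : forall x, `|Psi p1.+1 x| <= al + be * `|x| `^ r.

Let W := col_sum X.
Let q : R := p1.+1%:R + r.
Let q0 : 0 <= q. Proof. by rewrite addr_ge0. Qed.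
Let q1 : q + 1 = p1.+2%:R + r.
Proof. by rewrite /q addrAC natr1. Qed.

Let gq x : gam (q + 1) x = gam q x * gam 1 x.
Proof. exact: gamD. Qed.

Let mXi i : measurable_fun setT (X i). Proof. exact: measurable_funPT. Qed.
Let mW : measurable_fun setT W.
Proof. by apply: measurable_funM => //; exact: measurable_sum_cond. Qed.

Let iW : P.-integrable setT (EFin \o (gam (q + 1) \o W)).
Proof. rewrite q1; exact: integrable_gam_col_sum. Qed.

Let M i := (\int[P]_x (`|X i x| ^+ p1.+2))%R.
Let EW := (\int[P]_x (`|W x| `^ r))%R.
Let MR i := (n%:R `^ (r / 2))^-1 * (\int[P]_x (`|X i x| `^ (p1.+2%:R + r)))%R.
(** The bound of [column_stein] as a function of the two growth constants; by homogeneity the factor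
    (sin t)^p / cos t comes out of it. *)
Let S (a b : R) : R := p1.+2%:R / p1.+1`!%:R * \sum_(i < n) (n%:R `^ (p1.+2%:R / 2))^-1 *
    (a * M i + b * (split_const r * (M i * EW + MR i))).

Let S_scale t a b : S (t * a) (t * b) = t * S a b.
Proof.
rewrite /S [RHS]mulrCA; congr (_ * _); rewrite mulr_sumr; apply: eq_bigr => i _; ring.
Qed.

Let stein (a : nat -> R -> R) (C a1 b1 : R) : 0 <= a1 -> 0 <= b1 ->
  (forall k (x : R), (k < p1.+1)%N -> is_derive x (1 : R) (a k) (a k.+1 x)) ->
  (forall k x, (k <= p1)%N -> `|a k x| <= C * gam q x) ->
  (forall x, `|a p1.+1 x| <= a1 + b1 * `|x| `^ r) ->
  `|(\int[P]_x (W x * a 0 (W x)))%R - (\int[P]_x (a 1 (W x)))%R| <= S a1 b1.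
Proof.
apply: (@column_stein R d T P n X n0 indepX p1 r (fun k => \int[N]_z (z ^+ k))%R) => //.
- by move=> i; have := @mX i 1 isT; rewrite gaussian_mean.
- by move=> k _; exact: gaussian_moment_rec.
Qed.

(** Multiplication by c = cos t removes the factor 1 / c of the top derivative, so the bound on Phi'
    stays bounded up to pi/2. *)
Let stein_smoothed (s c : R) : 0 <= s -> s <= 1 -> 0 < c -> c <= 1 ->
  c * `|(\int[P]_x (W x * smoothed s c p1 Psi 0 (W x)))%R -
        (\int[P]_x (smoothed s c p1 Psi 1 (W x)))%R| <=
  s ^+ p1.+1 * S (al * (\int[N]_z `|z|)%R + be * add_const r * (\int[N]_z (`|z| `^ (r + 1)))%R)
    (be * add_const r * (\int[N]_z `|z|)%R).
Proof.
move=> s0 s1 c0 c1.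
have [C aC] := smoothed_growth s0 s1 c0 c1 al0 be0 r0 dPsi topPsi.
have m1 : 0 <= (\int[N]_z `|z|)%R by exact: Rintegral_ge0.
have mr : 0 <= (\int[N]_z (`|z| `^ (r + 1)))%R.
  by apply: Rintegral_ge0 => z _; exact: powR_ge0.
have K0 := add_const_ge0 r.
have t0 : 0 <= s ^+ p1.+1 / c by rewrite divr_ge0 ?exprn_ge0 // ltW.
have h := @stein (smoothed s c p1 Psi) C _ _
  (mulr_ge0 t0 (addr_ge0 (mulr_ge0 al0 m1) (mulr_ge0 (mulr_ge0 be0 K0) mr)))
  (mulr_ge0 t0 (mulr_ge0 (mulr_ge0 be0 K0) m1))
  (fun k x kp => is_derive_smoothed s0 s1 c0 c1 al0 be0 r0 dPsi topPsi x kp)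
  aC (fun x => smoothed_top s0 s1 c0 c1 al0 be0 r0 dPsi topPsi x).
apply: (le_trans (ler_wpM2l (ltW c0) h)); rewrite S_scale.
set v := S _ _; rewrite le_eqVlt; apply/orP; left; apply/eqP; field.
by rewrite gt_eqF.
Qed.

Let C := projT1 (cid2 (derivatives_growth al0 be0 r0 dPsi topPsi)).
Let C0 : 0 <= C. Proof. by rewrite /C; case: cid2. Qed.
Let PsiC k x : (k <= p1.+1)%N -> `|Psi k x| <= C * gam q x.
Proof. by rewrite /C; case: cid2 => /= c _ h; exact: h. Qed.

(** The Gaussian variable of the interpolation is the second coordinate under [N], hence independent
    of W by construction. *)
Let f (t : R) (y : T * R) := Psi 0 (sin t * W y.1 + cos t * y.2).
Let df (t : R) (y : T * R) :=
  (cos t * W y.1 - sin t * y.2) * Psi 1 (sin t * W y.1 + cos t * y.2).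

Let mPsi k : (k <= p1.+1)%N -> measurable_fun setT (Psi k).
Proof. exact: (measurable_Psi dPsi). Qed.

Let m_arg t : measurable_fun setT (fun y : T * R => sin t * W y.1 + cos t * y.2).
Proof.
apply: measurable_funD; apply: measurable_funM => //.
exact: measurableT_comp mW measurable_fst.
Qed.

Let mf t : measurable_fun setT (f t).
Proof. exact: measurableT_comp (mPsi (leq0n _)) (m_arg t). Qed.

Let mdf t : measurable_fun setT (df t).
Proof.
apply: measurable_funM; last exact: measurableT_comp (mPsi (ltn0Sn _)) (m_arg t).
apply: measurable_funB; apply: measurable_funM => //.
exact: measurableT_comp mW measurable_fst.
Qed.

Let iu : P.-integrable setT (EFin \o (fun x => C * gam (q + 1) (W x))).
Proof. exact: integrable_scale iW. Qed.
Let iv : N.-integrable setT (EFin \o gam (q + 1)).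
Proof. by apply: integrable_gam_gaussian; rewrite addr_ge0. Qed.

Let Psi_arg k t w z : (k <= p1.+1)%N ->
  `|Psi k (sin t * w + cos t * z)| <= C * (gam q w * gam q z).
Proof.
move=> kp; apply: le_trans (PsiC _ kp) _; rewrite ler_wpM2l //.
by apply: gam_mulD; rewrite ?sin_max ?cos_max.
Qed.

Let f_dom t (x : T) z : `|f t (x, z)| <= `|C * gam (q + 1) (W x)| * `|gam (q + 1) z|.
Proof.
apply: le_trans (Psi_arg _ _ _ (leq0n _)) _.
rewrite !ger0_norm ?mulr_ge0 ?gam_ge0 // -mulrA ler_wpM2l //=.
by rewrite ler_pM ?gam_ge0 // gam_le // lerDl.
Qed.

(** The bound is free of t, as differentiation under the integral demands; the extra power of the
    weight pays for the factor W or Z. *)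
Let df_dom t (x : T) z : `|df t (x, z)| <= `|C * gam (q + 1) (W x)| * `|gam (q + 1) z|.
Proof.
rewrite [leLHS]normrM [X in _ <= X * _]ger0_norm ?mulr_ge0 ?gam_ge0 //.
rewrite [X in _ <= _ * X]ger0_norm ?gam_ge0 // -[leRHS]mulrA !gq.
have -> : C * (gam q (W x) * gam 1 (W x) * (gam q z * gam 1 z)) =
  (gam 1 (W x) * gam 1 z) * (C * (gam q (W x) * gam q z)) by ring.
rewrite ler_pM // /=; last exact: Psi_arg.
apply: le_trans (ler_normB _ _) _.
rewrite (normrM (cos t)) (normrM (sin t)) /gam !powRr1 ?addr_ge0 //.
have h (a b : R) : 0 <= a -> 0 <= b -> a + b <= (1 + a) * (1 + b) by nra.
apply: le_trans (h _ _ (normr_ge0 _) (normr_ge0 _)).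
by rewrite lerD ?ler_piMl ?cos_max ?sin_max.
Qed.

Let fi t : (P \x N)%E.-integrable setT (EFin \o f t).
Proof.
exact: (@integrable_prod_dominated R _ _ T (measurableTypeR R) P N (f t)
  (fun x => C * gam (q + 1) (W x)) (gam (q + 1)) (mf t) iu iv (f_dom t)).
Qed.
Let dfi t : (P \x N)%E.-integrable setT (EFin \o df t).
Proof.
exact: (@integrable_prod_dominated R _ _ T (measurableTypeR R) P N (df t)
  (fun x => C * gam (q + 1) (W x)) (gam (q + 1)) (mdf t) iu iv (df_dom t)).
Qed.

Let section_integrable (h : T * R -> R) : measurable_fun setT h ->
  (forall x z, `|h (x, z)| <= `|C * gam (q + 1) (W x)| * `|gam (q + 1) z|) ->
  forall x, N.-integrable setT (fun z => (h (x, z))%:E).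
Proof.
move=> mh hd x.
apply: integrable_dominated (integrable_scale (C * gam (q + 1) (W x)) iv) _.
  exact: measurableT_comp mh (measurable_pair1 x).
move=> z; apply: le_trans (hd x z) _.
by rewrite !ger0_norm ?mulr_ge0 ?gam_ge0.
Qed.

Let F t := (\int[(P \x N)%E]_y f t y)%R.
Let D t := (\int[(P \x N)%E]_y df t y)%R.

Let dF (t : R) : is_derive t (1 : R) F (D t).
Proof.
apply: (@is_derive_Rintegral R _ _ (P \x N)%E f df t (t - 1) (t + 1)
  (fun y => C * gam (q + 1) (W y.1) * gam (q + 1) y.2)).
- by rewrite ltrBlDr ltrDl ltr01.
- by move=> u _; exact: fi.
- move=> u y _.
  have h := is_derive_add (is_derive_mul (is_derive_sin u) (is_derive_cst (W y.1) u (1 : R)))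
    (is_derive_mul (is_derive_cos u) (is_derive_cst y.2 u (1 : R))).
  have h2 := @is_derive_comp R (Psi 0) (fun u => sin u * W y.1 + cos u * y.2) _ _ u
    (dPsi (sin u * W y.1 + cos u * y.2) (ltn0Sn _)) h.
  apply: is_derive_eq h2 _; rewrite /df /cst.
  by rewrite !mulr0 !addr0 mulNr mulrC.
- by move=> u [x z] _; apply: le_trans (df_dom u x z) _; rewrite !ger0_norm ?mulr_ge0 ?gam_ge0.
- apply: (@integrable_prod_dominated R _ _ T (measurableTypeR R) P N _ _ _ _ iu iv) => /=.
    apply: measurable_funM; last exact: measurableT_comp (measurable_gam _) measurable_snd.
    apply: measurable_funM => //; apply: (measurableT_comp (measurable_gam _)).
    exact: measurableT_comp mW measurable_fst.
  by move=> x z; rewrite normrM.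
Qed.

Let F0 : F 0 = (\int[N]_z Psi 0 z)%R.
Proof.
rewrite /F (Rintegral_prod (fi 0) (section_integrable (mf 0) (f_dom 0))).
transitivity (\int[P]_x cst (\int[N]_z Psi 0 z)%R x)%R; last exact: Rintegral_cst_prob.
apply: eq_Rintegral => x _; apply: eq_Rintegral => z _.
by rewrite /f sin0 cos0 mul0r add0r mul1r.
Qed.

Let F1 : F (pi / 2) = (\int[P]_x Psi 0 (W x))%R.
Proof.
rewrite /F (Rintegral_prod (fi _) (section_integrable (mf _) (f_dom _))).
apply: eq_Rintegral => x _; rewrite -[RHS](Rintegral_cst_prob N).
by apply: eq_Rintegral => z _; rewrite /f sin_pihalf cos_pihalf mul1r mul0r addr0.
Qed.

(** The term of [df] in W already has the form cos t E W a(W); the term in Z becomes cos t E a'(W)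
    through integration by parts in Z. *)
Let DE t : 0 < t -> t < pi / 2 ->
  D t = cos t * ((\int[P]_x (W x * smoothed (sin t) (cos t) p1 Psi 0 (W x)))%R -
        (\int[P]_x (smoothed (sin t) (cos t) p1 Psi 1 (W x)))%R).
Proof.
move=> t0 t1.
have s0 : 0 <= sin t by apply/ltW/sin_gt0_pihalf; rewrite t0.
have c0 : 0 < cos t.
  by apply: cos_gt0_pihalf; rewrite t1 andbT (lt_trans _ t0) // oppr_lt0 (lt_trans t0).
have s1 := sin_le1 t; have c1 := cos_le1 t.
have ns := sin_max t; have nc := cos_max t.
have da k x kp := is_derive_smoothed s0 s1 c0 c1 al0 be0 r0 dPsi topPsi (k := k) x kp.
have [C' aC] := smoothed_growth s0 s1 c0 c1 al0 be0 r0 dPsi topPsi.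
set a := smoothed (sin t) (cos t) p1 Psi.
have ma k : (k < p1.+1)%N -> measurable_fun setT (a k).
  move=> kp; apply: continuous_measurable_fun => x.
  exact: (@is_derive_continuous R (a k) (a k.+1) x (da k x kp)).
have i0 : P.-integrable setT (EFin \o (fun x => W x * a 0 (W x))).
  apply: integrable_dominated (integrable_scale C' iW) _.
    by apply: measurable_funM => //; exact: measurableT_comp (ma 0 isT) mW.
  move=> x /=; rewrite normrM gq mulrA [leRHS]mulrC ler_pM ?norm_le_gam //.
  exact: aC.
have i1 : P.-integrable setT (EFin \o (fun x => a 1 (W x))).
  have C'0 : 0 <= C'.
    have := le_trans (normr_ge0 _) (aC 0 0 isT).
    by rewrite pmulr_lge0 // gam_gt0.
  apply: integrable_dominated (integrable_scale C' iW) _.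
    exact: measurableT_comp (ma 1 p10) mW.
  move=> x /=; apply: le_trans (aC 1 (W x) p10) _; rewrite ler_wpM2l // gam_le // lerDl //.
rewrite -(RintegralB measurableT i0 i1) -(RintegralZl _ measurableT); last first.
  exact: integrable_sub i0 i1.
rewrite /D (Rintegral_prod (dfi t) (section_integrable (mdf t) (df_dom t))).
apply: eq_Rintegral => x _; set w := W x.
have j1 : N.-integrable setT (EFin \o (fun z => Psi 1 (sin t * w + cos t * z))).
  have := @integrable_smoothing R (sin t) (cos t) ns nc (Psi 1) C q w 0 C0 q0
    (mPsi (ltn0Sn _)) (fun x => PsiC x (ltn0Sn _)).
  by apply: eq_integrable => // z _ /=; rewrite mul1r.
have j2 := @integrable_smoothing R (sin t) (cos t) ns nc (Psi 1) C q w 1 C0 q0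
    (mPsi (ltn0Sn _)) (fun x => PsiC x (ltn0Sn _)).
transitivity (\int[N]_z ((cos t * w) * Psi 1 (sin t * w + cos t * z) -
    sin t * (z ^+ 1 * Psi 1 (sin t * w + cos t * z))))%R.
  by apply: eq_Rintegral => z _; rewrite /df /= -/w; ring.
rewrite (RintegralB measurableT (integrable_scale _ j1) (integrable_scale _ j2)).
rewrite (RintegralZl _ measurableT j1) (RintegralZl _ measurableT j2).
(* The second derivative of Psi is available because p >= 2. *)
have -> : (\int[N]_z (z ^+ 1 * Psi 1 (sin t * w + cos t * z)))%R =
    cos t * (\int[N]_z Psi 2 (sin t * w + cos t * z))%R.
  transitivity (\int[N]_z (z * Psi 1 (sin t * w + cos t * z)))%R.
    by apply: eq_Rintegral => z _; rewrite expr1.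
  have h := @smoothing_ibp R (sin t) (cos t) ns nc (Psi 1) (Psi 2) C q w C0 q0
    (fun x => dPsi x (p10 : (1 < p1.+1)%N)) (fun x => PsiC x (ltn0Sn _))
    (fun x => PsiC x (p10 : (2 <= p1.+1)%N)).
  exact: h.
by rewrite /a /smoothed leq0n p10; ring.
Qed.

(** E|Z| is bounded by 1 in the last term but kept next to al: in several dimensions al contains
    powers of the other coordinates, some of them Gaussian, and E|Z| is then needed to reach
    E|Z|^(r+1). *)
Lemma one_dim :
  `|(\int[P]_x Psi 0 (W x))%R - (\int[N]_z Psi 0 z)%R| <=
  p1.+2%:R / p1.+1`!%:R * \sum_(i < n) (n%:R `^ (p1.+2%:R / 2))^-1 *
    (al * (\int[N]_z `|z|)%R * M i +
     be * (2 `^ r * (\int[N]_z (`|z| `^ (r + 1)))%R * M i +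
           2 `^ r * 2 `^ r * (M i * EW + MR i))).
Proof.
have K0 := add_const_ge0 r.
set m1 := (\int[N]_z `|z|)%R; set mr := (\int[N]_z (`|z| `^ (r + 1)))%R.
pose L := S (al * m1 + be * add_const r * mr) (be * add_const r * m1).
have m10 : 0 <= m1 by exact: Rintegral_ge0.
have m11 : m1 <= 1 by exact: gaussian_mean_norm_le1.
have mr0 : 0 <= mr by apply: Rintegral_ge0 => z _; exact: powR_ge0.
have M0 i : 0 <= M i by apply: Rintegral_ge0 => x _; exact: exprn_ge0.
have EW0 : 0 <= EW by apply: Rintegral_ge0 => x _; exact: powR_ge0.
have MR0 i : 0 <= MR i.
  rewrite /MR; apply: mulr_ge0; first by rewrite invr_ge0 powR_ge0.
  by apply: Rintegral_ge0 => x _; exact: powR_ge0.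
have sc0 : 0 <= split_const r.
  by rewrite /split_const; case: ifP => _; rewrite ?mulr_ge0 ?powR_ge0.
have L0 : 0 <= L.
  rewrite /L /S mulr_ge0 ?divr_ge0 // sumr_ge0 // => i _.
  move: (M i) (M0 i) (MR i) (MR0 i) EW EW0 => u u0 v v0 w w0.
  apply: mulr_ge0; first by rewrite invr_ge0 powR_ge0.
  by repeat (apply: mulr_ge0 || apply: addr_ge0).
have DL t : 0 < t -> t < pi / 2 -> `|D t| <= sin t ^+ 2 * L.
  move=> t0 t1; rewrite DE //.
  have s0 : 0 <= sin t by apply/ltW/sin_gt0_pihalf; rewrite t0.
  have c0 : 0 < cos t.
    by apply: cos_gt0_pihalf; rewrite t1 andbT (lt_trans _ t0) // oppr_lt0 (lt_trans t0).
  rewrite normrM (ger0_norm (ltW c0)).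
  apply: le_trans (stein_smoothed s0 (sin_le1 t) c0 (cos_le1 t)) _.
  rewrite -/m1 -/mr -/L ler_wpM2r //.
  have -> : p1.+1 = (p1.-1 + 2)%N by rewrite addn2 prednK.
  by rewrite exprD ler_piMl ?sqr_ge0 // exprn_ile1 // sin_le1.
have FL : `|(\int[P]_x Psi 0 (W x))%R - (\int[N]_z Psi 0 z)%R| <= L.
  rewrite -F0 -F1 ler_norml; apply/andP; split.
    have h : F 0 - F (pi / 2) <= L.
      have := @sine_comparison R (fun t => - F t) (fun t => - D t) L.
      rewrite opprK addrC; apply=> // [t|t t0 t1]; first exact: is_deriveN.
      by apply: le_trans (DL t t0 t1); rewrite -normrN ler_norm.
    by rewrite lerNl opprB.
  apply: (sine_comparison dF) => // t t0 t1.
  by apply: le_trans (DL t t0 t1); rewrite ler_norm.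
apply: le_trans FL _; rewrite /L /S ler_wpM2l ?divr_ge0 //.
apply: ler_sum => i _; rewrite ler_wpM2l ?invr_ge0 ?powR_ge0 //.
rewrite mulrDl -addrA lerD2l [be * (_ + _)]mulrDr lerD //.
  rewrite -2!mulrA ler_wpM2l // -[leRHS]mulrA.
  by apply: ler_wpM2r; [exact: mulr_ge0|exact: add_const_le].
rewrite -2!mulrA ler_wpM2l //.
have -> : add_const r * (m1 * (split_const r * (M i * EW + MR i))) =
  (m1 * (M i * EW + MR i)) * (add_const r * split_const r) by ring.
have v0 : 0 <= M i * EW + MR i by apply: addr_ge0 (MR0 i); exact: mulr_ge0.
rewrite [leRHS]mulrC; apply: ler_pM.
- exact: mulr_ge0.
- exact: mulr_ge0.
- exact: ler_piMl.
- exact: add_split_const.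
Qed.

End one_dim.

(** * Several coordinates *)

Section caratheodory.
Context {R : realType} {d : measure_display} {S : measurableType d}.

(* Discretise [Y x] on the grid of mesh [1 / n.+1] and let [n] tend to infinity. *)
Lemma caratheodory_measurable (f : S -> R -> R) (Y : S -> R) :
  (forall t, measurable_fun setT (f^~ t)) -> (forall x, continuous (f x)) ->
  measurable_fun setT Y -> measurable_fun setT (fun x => f x (Y x)).
Proof.
move=> mf cf mY.
pose a (n : nat) (t : R) : R := (Num.floor (n.+1%:R * t))%:~R / n.+1%:R.
have acvg t : a n t @[n --> \oo] --> t.
  apply/cvgrPdist_le => e e0; near=> n.
  have n0 : 0 < n.+1%:R :> R by rewrite ltr0n.
  have -> : t - a n t = (n.+1%:R * t - (Num.floor (n.+1%:R * t))%:~R) / n.+1%:R.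
    by rewrite /a; field; rewrite gt_eqF.
  have h1 := floor_le (n.+1%:R * t); have h2 := floorD1_gt (n.+1%:R * t).
  rewrite ger0_norm; last by rewrite divr_ge0 // subr_ge0.
  apply: (@le_trans _ _ (n.+1%:R^-1)).
    rewrite -[leRHS]mul1r ler_wpM2r ?invr_ge0 // lerBlDr addrC.
    by move: h2; rewrite intrD => /ltW.
  by apply: ltW; near: n; exact: (near_infty_natSinv_lt (PosNum e0)).
apply: (@measurable_fun_cvg _ _ _ _ (fun n x => f x (a n (Y x)))) => [n|x _]; last first.
  apply: (@cvg_comp _ _ _ (fun n => a n (Y x)) (f x)); first exact: acvg.
  exact: cf.
move=> _ E mE; rewrite setTI.
have -> : (fun x => f x (a n (Y x))) @^-1` E =
    \bigcup_(z : int) ((fun x => n.+1%:R * Y x) @^-1` [set` `[z%:~R, (z + 1)%:~R[] `&`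
      (f^~ (z%:~R / n.+1%:R)) @^-1` E).
  apply/seteqP; split => [x /= Ex|x [z _] /= []].
    exists (Num.floor (n.+1%:R * Y x)) => //; split=> //=.
    by rewrite in_itv /= floor_le floorD1_gt.
  by rewrite in_itv => /floor_def zE; rewrite /a zE.
apply: countable_bigcupT_measurable => [|z]; first exact: countableP.
apply: measurableI; last by rewrite -[X in measurable X]setTI; exact: mf.
rewrite -[X in measurable X]setTI; apply: measurable_funM => //.
Unshelve. all: by end_near.
Qed.

End caratheodory.

Definition upd (R : Type) (d : nat) (v : 'I_d -> R) (j : 'I_d) (t : R) : 'I_d -> R :=
  fun k => if k == j then t else v k.

(** The random arguments are substituted one coordinate at a time, the remaining ones being frozen
    at v; each substitution is an instance of [caratheodory_measurable]. *)
Lemma separately_continuous_measurable (R : realType) (d : nat) (F : ('I_d -> R) -> R)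
    (dS : measure_display) (S : measurableType dS) (Y : 'I_d -> S -> R) :
  (forall v j, continuous (fun t => F (upd v j t))) ->
  (forall j, measurable_fun setT (Y j)) ->
  measurable_fun setT (fun x => F (Y^~ x)).
Proof.
move=> cF mY.
have h m v : (m <= d)%N -> measurable_fun setT
    (fun x => F (fun j : 'I_d => if (j < m)%N then Y j x else v j)).
  elim: m v => [|m ih] v md.
    by rewrite (_ : (fun x => _) = cst (F v)); [exact: measurable_cst|exact/funext].
  pose j0 := Ordinal md.
  have e x t : (fun j : 'I_d => if (j < m)%N then Y j x else upd v j0 t j) =
      upd (fun j : 'I_d => if (j < m)%N then Y j x else v j) j0 t.
    apply/funext => j; rewrite /upd; case: (eqVneq j j0) => [->|_] //=.
    by rewrite ltnn.
  have := @caratheodory_measurable R dS S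
    (fun x t => F (upd (fun j : 'I_d => if (j < m)%N then Y j x else v j) j0 t)) (Y j0).
  have -> : (fun x => F (fun j : 'I_d => if (j < m.+1)%N then Y j x else v j)) =
      (fun x => F (upd (fun j : 'I_d => if (j < m)%N then Y j x else v j) j0 (Y j0 x))).
    apply/funext => x; congr F; apply/funext => j; rewrite /upd ltnS leq_eqVlt.
    by case: (eqVneq j j0) => [->|jj0]; [rewrite eqxx|rewrite -[_ == m :> nat]/(j == j0) (negbTE jj0)].
  apply=> // t; under eq_fun do rewrite -e.
  exact: ih (ltnW md).
have := h d (fun=> 0) (leqnn _).
by apply: eq_measurable_fun => x _; congr F; apply/funext => j; rewrite ltn_ord.
Qed.

Section subfamily.
Context {R : realType} {d : measure_display} {T : measurableType d}.
Variable P : probability T R.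

Lemma mutually_independent_sub (I K : finType) (X : I -> {RV P >-> R}) (iota : K -> I) :
  injective iota -> mutually_independent X ->
  mutually_independent (fun k => X (iota k)).
Proof.
move=> inj indep J E mE.
pose E' i := if [pick k | iota k == i] is Some k then E k else setT.
have E'E k : E' (iota k) = E k.
  rewrite /E'; case: pickP => [k' /eqP/inj -> //|/(_ k)]; by rewrite eqxx.
have h := indep (iota @: J)%SET E'.
transitivity (P (\bigcap_(i in [set` (iota @: J)%SET]) (X i @^-1` E' i))).
  congr (P _); apply/seteqP; split => [x Jx i /= /imsetP[k kJ ->]|x Jx k /= kJ].
    by rewrite E'E; exact: Jx.
  by rewrite /= -E'E; apply: (Jx (iota k)); exact: imset_f.
rewrite h => [|_ /imsetP[k kJ ->]]; last by rewrite E'E; exact: mE.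
rewrite big_imset /=; last by move=> ? ? _ _; exact: inj.
by apply: eq_bigr => k _; rewrite E'E.
Qed.

End subfamily.

Section random_variable_of.
Context {R : realType} {d : measure_display} {T : measurableType d}.
Variables (P : probability T R) (f : T -> R) (mf : measurable_fun setT f).

Definition random_variable_of_fun : T -> R := f.
HB.instance Definition _ := isMeasurableFun.Build d _ T R random_variable_of_fun mf.
Definition random_variable_of : {RV P >-> R} := random_variable_of_fun.

End random_variable_of.

(** * Joining two independent families on a product space *)

Section product_space.
Context {R : realType} {d1 d2 : measure_display} {T : measurableType d1}
  {U : measurableType d2}.
Variables (P : probability T R) (Q : probability U R).
Variables (I K : finType) (X : I -> {RV P >-> R}) (Z : K -> {RV Q >-> R}).

Lemma measurable_joint (i : I + K) : measurable_fun setT (fun w : T * U =>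
  match i with inl i => X i w.1 | inr k => Z k w.2 end).
Proof.
case: i => [i|k]; first exact: measurableT_comp (@measurable_funPT _ _ _ _ (X i)) measurable_fst.
exact: measurableT_comp (@measurable_funPT _ _ _ _ (Z k)) measurable_snd.
Qed.

(** The X_ij and the Z_j are given on two unrelated spaces. On the product they form one independent
    family with unchanged laws, as the exchange of coordinates demands. *)
Definition joint (i : I + K) : {RV (P \x Q)%E >-> R} :=
  random_variable_of (P \x Q)%E (measurable_joint i).

Lemma same_law_fst : same_law (P \x Q)%E P fst id.
Proof.
move=> A mA; have -> : fst @^-1` A = A `*` (setT : set U).
  by apply/seteqP; split => [[x y]|[x y] []].
transitivity (P A * Q setT)%E; first exact: product_measure1E.
by rewrite [X in (_ * X)%E]probability_setT mule1.
Qed.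

Lemma same_law_snd : same_law (P \x Q)%E Q snd id.
Proof.
move=> A mA; have -> : snd @^-1` A = (setT : set T) `*` A.
  by apply/seteqP; split => [[x y]|[x y] []].
transitivity (P setT * Q A)%E; first exact: product_measure1E.
by rewrite [X in (X * _)%E]probability_setT mul1e.
Qed.

Lemma joint_independent : mutually_independent X -> mutually_independent Z ->
  mutually_independent joint.
Proof.
move=> iX iZ J E mE.
pose J1 := [set i | inl i \in J]%SET; pose J2 := [set k | inr k \in J]%SET.
pose A1 := \bigcap_(i in [set` J1]) (X i @^-1` E (inl i)).
pose A2 := \bigcap_(k in [set` J2]) (Z k @^-1` E (inr k)).
have mA1 : measurable A1.
  apply: fin_bigcap_measurable => // i /=; rewrite inE => iJ.
  exact: measurable_preimage_RV (mE _ iJ).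
have mA2 : measurable A2.
  apply: fin_bigcap_measurable => // i /=; rewrite inE => iJ.
  exact: measurable_preimage_RV (mE _ iJ).
have -> : \bigcap_(i in [set` J]) (joint i @^-1` E i) = A1 `*` A2.
  apply/seteqP; split => [[x y] h|[x y] [h1 h2] [i|k] /= iJ].
  - by split => [i|k] /=; rewrite inE => /h.
  - by apply: (h1 i); rewrite /= inE.
  - by apply: (h2 k); rewrite /= inE.
transitivity (P A1 * Q A2)%E; first exact: product_measure1E.
rewrite /A1 /A2 iX => [|i]; last by rewrite inE; exact: mE.
rewrite iZ => [|i]; last by rewrite inE; exact: mE.
rewrite big_sumType; congr (_ * _)%E; apply: eq_big => [i|i]; rewrite inE // => iJ.
- have -> : joint (inl i) @^-1` E (inl i) = fst @^-1` (X i @^-1` E (inl i)) by [].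
  by rewrite same_law_fst //; apply: measurable_preimage_RV; exact: mE.
- have -> : joint (inr i) @^-1` E (inr i) = snd @^-1` (Z i @^-1` E (inr i)) by [].
  by rewrite same_law_snd //; apply: measurable_preimage_RV; exact: mE.
Qed.

End product_space.

(** * Exchange of the coordinates one at a time *)

Section multi_dim.
Context {R : realType} {dO : measure_display} {Om : measurableType dO}.
Variable P : probability Om R.
Local Notation N := (gaussian R).
Variables (d : nat) (n : 'I_d -> nat).
Local Notation I := ({j : 'I_d & 'I_(n j)} + 'I_d)%type.
Variable Y : I -> {RV P >-> R}.

Definition entry (j : 'I_d) (i : 'I_(n j)) : {RV P >-> R} :=
  Y (inl (Tagged (fun j => 'I_(n j)) i)).
Definition limit_entry (j : 'I_d) : {RV P >-> R} := Y (inr j).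

Local Notation X := entry.
Local Notation Z := limit_entry.

(** The X_ij and the limit Z_j are assigned to the same coordinate, so that the block of j contains
    both variables being exchanged, and the complementary block all other coordinates of the
    hybrid. *)
Definition column (t : I) : 'I_d := match t with inl u => tag u | inr k => k end.

Let W (j : 'I_d) : Om -> R := col_sum (@X j).

(* The coordinates below m are already Gaussian. *)
Definition hybrid (m : nat) (w : Om) : 'I_d -> R :=
  fun j => if (j < m)%N then Z j w else W j w.

Variables (p1 : nat) (r : 'I_d -> R) (rho A B Kp C : R) (F : ('I_d -> R) -> R).
Hypotheses (indepY : mutually_independent Y) (n0 : forall j, (0 < n j)%N).
Hypotheses (p10 : (0 < p1)%N) (r0 : forall k, 0 <= r k) (rrho : forall k, r k <= rho).
Hypotheses (rho0 : 0 <= rho) (A0 : 0 <= A) (B0 : 0 <= B) (Kp0 : 0 <= Kp) (C0 : 0 <= C).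
Hypothesis mX : forall j (i : 'I_(n j)) k, (k <= p1.+1)%N ->
  (\int[P]_x (X i x ^+ k) = \int[N]_z (z ^+ k))%R.
Hypothesis iX : forall j (i : 'I_(n j)),
  P.-integrable setT (EFin \o (gam (p1.+2%:R + rho) \o X i)).
Hypothesis lawZ : forall j, same_law P N (Z j) id.
Hypothesis F_deriv : forall v j, exists Psi : nat -> R -> R,
  [/\ Psi 0 = (fun t => F (upd v j t)),
      forall k (x : R), (k < p1.+1)%N -> is_derive x (1 : R) (Psi k) (Psi k.+1 x) &
      forall x, `|Psi p1.+1 x| <= Kp * (A + B * \sum_k `|upd v j x k| `^ r k)].
Hypothesis F_growth : forall v, `|F v| <= C * \sum_k gam (rho + 1) (v k).

Let Q : R := rho + 1.
Let Q0 : 0 <= Q. Proof. by rewrite addr_ge0. Qed.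

Let mXi j (i : 'I_(n j)) : measurable_fun setT (X i). Proof. exact: measurable_funPT. Qed.
Let mZ j : measurable_fun setT (Z j). Proof. exact: measurable_funPT. Qed.
Let mW j : measurable_fun setT (W j).
Proof. by apply: measurable_funM => //; exact: measurable_sum_cond. Qed.

Let iW j : P.-integrable setT (EFin \o (gam Q \o W j)).
Proof.
have h := @integrable_gam_col_sum R dO Om P (n j) (@X j) (n0 j) p1 rho rho0 (@iX j).
apply: integrable_gam_le _ (mW j) h.
by rewrite /Q addrC lerD2r ler1n.
Qed.

Let iZ j : P.-integrable setT (EFin \o (gam Q \o Z j)).
Proof.
have law' : same_law N P id (Z j) by move=> E mE; rewrite lawZ.
have mg : measurable_fun setT (EFin \o gam Q : R -> \bar R).
  by apply/measurable_EFinP; exact: measurable_gam.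
exact: (@same_law_integrable R _ _ _ _ _ _ N P id (Z j) (@measurable_id _ _ _) (mZ j) law'
  (EFin \o gam Q) mg (integrable_gam_gaussian Q0)).
Qed.

Let F_cont v j : continuous (fun t => F (upd v j t)).
Proof.
have [Psi [<- dPsi _]] := F_deriv v j => x.
exact: is_derive_continuous (dPsi 0 x isT).
Qed.

Let hybridE m k : (fun w => hybrid m w k) = if (k < m)%N then Z k : Om -> R else W k.
Proof. by apply/funext => w; rewrite /hybrid; case: ifP. Qed.

Let m_hybrid m k : measurable_fun setT (fun w => hybrid m w k).
Proof. by rewrite hybridE; case: ifP. Qed.

Let i_hybrid m k : P.-integrable setT (EFin \o (fun w => gam Q (hybrid m w k))).
Proof.
have -> : (fun w => gam Q (hybrid m w k)) = gam Q \o (fun w => hybrid m w k) by [].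
by rewrite hybridE; case: ifP => _; [exact: iZ|exact: iW].
Qed.

Let J1 (j : 'I_d) : {set I} := [set t | column t == j]%SET.
Let J2 (j : 'I_d) : {set I} := [set t | column t != j]%SET.

Let mX_block (J : {set I}) k (i : 'I_(n k)) :
  inl (Tagged (fun j => 'I_(n j)) i) \in J -> measurable_fun setT (X i : block Y J -> R).
Proof. exact: measurable_block. Qed.

Let mW_block (J : {set I}) k : (forall t, column t == k -> t \in J) ->
  measurable_fun setT (W k : block Y J -> R).
Proof.
move=> kJ; apply: measurable_funM => //; apply: measurable_sum_cond => i _.
by apply: mX_block; apply: kJ => /=.
Qed.

Let mZ_block (J : {set I}) k : (forall t, column t == k -> t \in J) ->
  measurable_fun setT (Z k : block Y J -> R).
Proof. by move=> kJ; apply: measurable_block; apply: kJ => /=. Qed.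

Section swap.
Variable j : 'I_d.

Let V := hybrid j.

(** Here c is W_j or Z_j, a function of the block of j, while the other coordinates are functions of
    the complementary block: decoupling yields an iterated integral with V frozen outside. The j-th
    entry of V is overwritten by [upd]. *)
Let half (c : Om -> R) :
  measurable_fun setT (c : block Y (J1 j) -> R) -> measurable_fun setT c ->
  P.-integrable setT (EFin \o (gam Q \o c)) ->
  [/\ P.-integrable setT (EFin \o (fun w => F (upd (V w) j (c w)))),
      P.-integrable setT (EFin \o (fun w => \int[P]_u F (upd (V w) j (c u)))%R) &
  (\int[P]_w F (upd (V w) j (c w)) = \int[P]_w \int[P]_u F (upd (V w) j (c u)))%R].
Proof.
move=> mcb mc ic.
pose f (z : Om * Om) := F (upd (V z.2) j (c z.1)).
have coordE (z : Om * Om) : upd (V z.2) j (c z.1) =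
    (fun k => (if k == j then c z.1 else V z.2 k)) by [].
have mf : measurable_fun setT f.
  have := @separately_continuous_measurable R d F _ (Om * Om)%type
    (fun k z => if k == j then c z.1 else V z.2 k) F_cont.
  apply=> k; case: (eqVneq k j) => _; first exact: measurableT_comp mc measurable_fst.
  exact: measurableT_comp (m_hybrid _ _) measurable_snd.
have mfb : measurable_fun setT (f : block Y (J1 j) * block Y (J2 j) -> R).
  have := @separately_continuous_measurable R d F _ (block Y (J1 j) * block Y (J2 j))%type
    (fun k z => if k == j then c z.1 else V z.2 k) F_cont.
  apply=> k; case: (eqVneq k j) => [_|kj]; first exact: measurableT_comp mcb measurable_fst.
  apply: (measurableT_comp (f := fun w : block Y (J2 j) => V w k)); last exact: measurable_snd.
  have kJ t : column t == k -> t \in J2 j by move=> /eqP tk; rewrite inE tk.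
  by rewrite /V hybridE; case: ifP => _; [exact: mZ_block kJ|exact: mW_block kJ].
have dom (x y : Om) : `|F (upd (V y) j (c x))| <=
    C * (gam Q (c x) + \sum_k gam Q (V y k)).
  apply: le_trans (F_growth _) _; rewrite ler_wpM2l // -/Q (bigD1 j) //= /upd eqxx lerD2l.
  rewrite [leRHS](bigD1 j) //= -[leLHS]add0r lerD ?gam_ge0 //.
  by rewrite le_eqVlt; apply/orP; left; apply/eqP; apply: eq_bigr => k /negbTE ->.
have isum : P.-integrable setT (EFin \o (fun w => \sum_k gam Q (V w k))).
  by apply: integrable_sumn => k; exact: i_hybrid.
have i1 : P.-integrable setT (EFin \o (fun w => F (upd (V w) j (c w)))).
  apply: integrable_dominated (integrable_scale C (integrable_add ic isum)) _.
    have := @separately_continuous_measurable R d F _ Om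
      (fun k w => if k == j then c w else V w k) F_cont.
    by apply=> k; case: (eqVneq k j) => _ //; exact: m_hybrid.
  by move=> w; exact: dom.
have disj t : t \in J1 j -> t \notin J2 j by rewrite !inE => ->.
have law : same_law P (P \x P)%E (fun w => F (upd (V w) j (c w))) f.
  move=> E mE; have mE' : measurable ((f : block Y (J1 j) * block Y (J2 j) -> R) @^-1` E).
    by rewrite -[X in measurable X]setTI; exact: mfb.
  exact: (block_decoupling indepY disj mE').
have mfun1 : measurable_fun setT (fun w => F (upd (V w) j (c w))).
  exact: integrable_measurable i1.
have i2 : (P \x P)%E.-integrable setT (EFin \o f).
  by apply: (@same_law_integrable R _ _ _ _ _ _ P (P \x P)%E _ _ mfun1 mf law EFin).
have i3 y : P.-integrable setT (fun x => (f (x, y))%:E).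
  apply: integrable_dominated
    (integrable_scale C (integrable_add ic (integrable_cst_prob P (\sum_k gam Q (V y k))))) _.
    exact: measurableT_comp mf (measurable_pair2 y).
  by move=> x; exact: dom.
split => //; first exact: (integrable_Rintegral_prod2 i2 i3).
rewrite -(Rintegral_prod2 i2 i3).
exact: (@same_law_Rintegral R _ _ _ _ _ _ P (P \x P)%E _ _ mfun1 mf law id).
Qed.

Let M (i : 'I_(n j)) := (\int[P]_x (`|X i x| ^+ p1.+2))%R.

(** The bracket of the final bound for one entry. The mixed moment is recorded for k = j only, the
    one coordinate whose growth involves X_ij; there it is a moment of a single variable. *)
Definition swap_term (i : 'I_(n j)) : R :=
  A * M i + B * \sum_k 2 `^ r k * (2 `^ r k * M i * (\int[P]_x (`|W k x| `^ r k))%R +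
    (if k == j then 2 `^ r k / (n k)%:R `^ (r k / 2) *
       (\int[P]_x (`|X i x| `^ (p1.+2%:R + r k)))%R else 0) +
    (\int[N]_z (`|z| `^ (r k + 1)))%R * M i).

Let m1 := (\int[N]_z `|z|)%R.
Let S : R := \sum_(i < n j) ((n j)%:R `^ (p1.+2%:R / 2))^-1 * M i.
Let S' : R := \sum_(i < n j) ((n j)%:R `^ (p1.+2%:R / 2))^-1 *
  (2 `^ r j * (\int[N]_z (`|z| `^ (r j + 1)))%R * M i +
   2 `^ r j * 2 `^ r j * (M i * (\int[P]_x (`|W j x| `^ r j))%R +
     ((n j)%:R `^ (r j / 2))^-1 * (\int[P]_x (`|X i x| `^ (p1.+2%:R + r j)))%R)).
Let pre : R := p1.+2%:R / p1.+1`!%:R * Kp.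
Let u (k : 'I_d) (w : Om) : R := if k == j then 0 else `|V w k| `^ r k.

(** For frozen V, [one_dim] applies with be = Kp B and al = Kp (A + B U), where U is the sum of
    |V_k|^(r_k) over k distinct from j. *)
Let conditional_bound w :
  `|(\int[P]_x F (upd (V w) j (W j x)))%R - (\int[P]_x F (upd (V w) j (Z j x)))%R| <=
  pre * (A * m1 * S + B * S') + pre * (B * m1 * S) * \sum_k u k w.
Proof.
have [Psi [Psi0 dPsi topPsi]] := F_deriv (V w) j.
have sum0 : 0 <= \sum_k u k w.
  by apply: sumr_ge0 => k _; rewrite /u; case: ifP => // _; exact: powR_ge0.
have al0 : 0 <= Kp * (A + B * \sum_k u k w) by rewrite mulr_ge0 // addr_ge0 // mulr_ge0.
have be0 : 0 <= Kp * B by exact: mulr_ge0.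
have iXj (i : 'I_(n j)) : P.-integrable setT (EFin \o (gam (p1.+2%:R + r j) \o X i)).
  by apply: integrable_gam_le _ (mXi i) (iX i); rewrite lerD2l.
have top x : `|Psi p1.+1 x| <= Kp * (A + B * \sum_k u k w) + Kp * B * `|x| `^ r j.
  apply: le_trans (topPsi x) _; rewrite -mulrA -mulrDr ler_wpM2l // -addrA lerD2l.
  rewrite -mulrDr ler_wpM2l // (bigD1 j) //= /upd eqxx addrC lerD2r.
  rewrite [leRHS](bigD1 j) //= {1}/u eqxx add0r.
  by apply: ler_sum => k /negbTE kj; rewrite /u kj.
have inj : injective (fun i : 'I_(n j) => inl (Tagged (fun j => 'I_(n j)) i) : I).
  by move=> a b [] /eqP; rewrite eq_Tagged => /eqP.
have indepX := mutually_independent_sub inj indepY.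
have := @one_dim R dO Om P (n j) (@X j) p1 (r j) (n0 j) indepX p10 (r0 j) (@mX j) iXj
  _ _ Psi al0 be0 dPsi top.
have -> : (\int[N]_z Psi 0 z)%R = (\int[P]_x F (upd (V w) j (Z j x)))%R.
  rewrite Psi0; apply/esym; apply: (@same_law_Rintegral R _ _ _ _ _ _ P N (Z j) id _ _
    (lawZ j) (fun t => F (upd (V w) j t))) => //.
  by apply: continuous_measurable_fun; exact: F_cont.
rewrite Psi0 => /le_trans; apply; rewrite /=.
rewrite le_eqVlt; apply/orP; left; apply/eqP.
rewrite /pre /S /S' /M /m1.
transitivity (p1.+2%:R / p1.+1`!%:R * (Kp * ((A + B * \sum_k u k w) * m1 * S + B * S'))).
  congr (_ * _); rewrite /S /S' !mulr_sumr -big_split mulr_sumr; apply: eq_bigr => i _ /=.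
  by rewrite /M /m1; ring.
by rewrite /S /S' /m1 /M; ring.
Qed.

Lemma swap_bound :
  `|(\int[P]_w F (hybrid j w))%R - (\int[P]_w F (hybrid j.+1 w))%R| <=
  pre * \sum_(i < n j) ((n j)%:R `^ (p1.+2%:R / 2))^-1 * swap_term i.
Proof.
have tJ t : column t == j -> t \in J1 j by rewrite inE.
have [iW1 iW2 eW] := half (mW_block tJ) (mW j) (iW j).
have [iZ1 iZ2 eZ] := half (mZ_block tJ) (mZ j) (iZ j).
have -> : (\int[P]_w F (hybrid j w))%R = (\int[P]_w F (upd (V w) j (W j w)))%R.
  apply: eq_Rintegral => w _; congr F; apply/funext => k; rewrite /V /upd /hybrid.
  by case: (eqVneq k j) => [->|//]; rewrite ltnn.
have -> : (\int[P]_w F (hybrid j.+1 w))%R = (\int[P]_w F (upd (V w) j (Z j w)))%R.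
  apply: eq_Rintegral => w _; congr F; apply/funext => k; rewrite /V /upd /hybrid ltnS leq_eqVlt.
  by case: (eqVneq k j) => [->|kj]; [rewrite eqxx|rewrite -[_ == j :> nat]/(k == j) (negbTE kj)].
rewrite eW eZ -(RintegralB measurableT iW2 iZ2).
have iD := integrable_sub iW2 iZ2.
apply: le_trans (le_normr_Rintegral measurableT iD) _.
have rQ k : r k <= Q by rewrite (le_trans (rrho k)) // lerDl.
have iU k : P.-integrable setT (EFin \o u k).
  case: (eqVneq k j) => [->|kj].
    have -> : u j = cst 0 by apply/funext => w; rewrite /u eqxx.
    exact: integrable_cst_prob.
  have -> : u k = (fun w => `|V w k| `^ r k) by apply/funext => w; rewrite /u (negbTE kj).
  apply: integrable_dominated (i_hybrid j k) _.
    apply: (measurableT_comp (measurable_powR (r k))); apply: measurableT_comp => //.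
    exact: m_hybrid.
  by move=> w; rewrite ger0_norm ?powR_ge0 // (le_trans (powR_le_gam _ (r0 k))) // gam_le.
have iS := integrable_scale (pre * (B * m1 * S)) (integrable_sumn iU).
have iC := integrable_cst_prob P (pre * (A * m1 * S + B * S')).
apply: (@le_trans _ _ (\int[P]_w (cst (pre * (A * m1 * S + B * S')) w +
    pre * (B * m1 * S) * \sum_k u k w))%R).
  apply: le_Rintegral => //; first exact: integrable_norm.
    exact: integrable_add iC iS.
rewrite (RintegralD measurableT iC iS) Rintegral_cst_prob.
rewrite (RintegralZl _ measurableT (integrable_sumn iU)) (Rintegral_sumn iU).
pose U k := (\int[P]_w u k w)%R; rewrite -/U.
have M0 i : 0 <= M i by apply: Rintegral_ge0 => x _; exact: exprn_ge0.
have m10 : 0 <= m1 by exact: Rintegral_ge0.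
have m11 : m1 <= 1 by exact: gaussian_mean_norm_le1.
have Uj : U j = 0.
  rewrite /U; transitivity (\int[P]_w cst (0 : R) w)%R; last exact: Rintegral_cst_prob.
  by apply: eq_Rintegral => w _; rewrite /u eqxx.
(* Coordinates before j are Gaussian, where E|Z| E|Z|^r <= E|Z|^(r+1) applies; those after j are
   still W_k, where E|Z| <= 1 is enough. The right-hand side contains both bounds. *)
have Uk k : k != j -> m1 * U k <= 2 `^ r k * (2 `^ r k * (\int[P]_x (`|W k x| `^ r k))%R +
    (\int[N]_z (`|z| `^ (r k + 1)))%R).
  move=> kj.
  have e0 : 0 <= (\int[P]_x (`|W k x| `^ r k))%R by apply: Rintegral_ge0 => x _; exact: powR_ge0.
  have u0 : 0 <= (\int[N]_z (`|z| `^ (r k + 1)))%R by apply: Rintegral_ge0 => x _; exact: powR_ge0.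
  have two : 1 <= 2 `^ r k :> R by rewrite -[leLHS](powRr0 2) ler_powR // ler1n.
  have two0 := le_trans ler01 two.
  apply: (@le_trans _ _ ((\int[P]_x (`|W k x| `^ r k))%R + (\int[N]_z (`|z| `^ (r k + 1)))%R));
    last first.
    apply: le_trans (_ : 1 * (1 * _ + _) <= _); first by rewrite !mul1r.
    by apply: ler_pM => //; [rewrite addr_ge0 ?mul1r|rewrite lerD2r ler_wpM2r].
  have -> : U k = (\int[P]_w (`|hybrid j w k| `^ r k))%R.
    by apply: eq_Rintegral => w _; rewrite /u (negbTE kj).
  rewrite /hybrid; case: (ltnP k j) => _.
    have -> : (\int[P]_w (`|Z k w| `^ r k))%R = (\int[N]_z (`|z| `^ r k))%R.
      apply: (@same_law_Rintegral R _ _ _ _ _ _ P N (Z k) id _ _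
        (lawZ k) (fun t => `|t| `^ r k)) => //.
      by apply: (measurableT_comp (measurable_powR (r k))); exact: normr_measurable.
    by apply: le_trans (gaussian_moment_assoc (r0 k)) _; rewrite lerDr.
  by apply: le_trans (_ : _ <= (\int[P]_w (`|W k w| `^ r k))%R) _; rewrite ?lerDl // ler_piMl.
have pre0 : 0 <= pre by rewrite mulr_ge0 // divr_ge0.
have -> : pre * (A * m1 * S + B * S') + pre * (B * m1 * S) * \sum_k U k =
    pre * (A * m1 * S + B * S' + B * m1 * S * \sum_k U k) by ring.
have [SU SUE] : exists SU, SU = \sum_k U k by eexists.
rewrite -SUE ler_wpM2l //.
have -> : A * m1 * S + B * S' + B * m1 * S * SU =
  A * m1 * S + B * S' + (B * m1 * SU) * S by ring.
rewrite /S /S' !mulr_sumr -!big_split /=; apply: ler_sum => i _.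
set ci := (_ `^ _)^-1; have ci0 : 0 <= ci by rewrite invr_ge0 powR_ge0.
set Qi := 2 `^ r j * _ * M i + _.
have -> : A * m1 * (ci * M i) + B * (ci * Qi) + B * m1 * SU * (ci * M i) =
  ci * (m1 * (A * M i) + B * (Qi + M i * (m1 * SU))) by ring.
rewrite ler_wpM2l // /swap_term lerD //; first by rewrite ler_piMl // mulr_ge0.
rewrite ler_wpM2l // SUE (bigD1 j) //= [leRHS](bigD1 j) //= Uj add0r eqxx lerD //.
  by rewrite /Qi le_eqVlt; apply/orP; left; apply/eqP; ring.
rewrite !mulr_sumr; apply: ler_sum => k kj; rewrite (negbTE kj) addr0.
apply: le_trans (ler_wpM2l (M0 i) (Uk k kj)) _.
by rewrite le_eqVlt; apply/orP; left; apply/eqP; ring.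
Qed.

End swap.

Lemma integrable_hybrid m : P.-integrable setT (EFin \o (fun w => F (hybrid m w))).
Proof.
apply: integrable_dominated (integrable_scale C (integrable_sumn (i_hybrid m))) _.
  exact: (@separately_continuous_measurable R d F _ Om (fun k w => hybrid m w k) F_cont).
by move=> w; exact: F_growth.
Qed.

Lemma multi_dim :
  `|(\int[P]_w F (fun j => W j w))%R - (\int[P]_w F (fun j => Z j w))%R| <=
  p1.+2%:R / p1.+1`!%:R * Kp * \sum_(j < d) \sum_(i < n j)
    ((n j)%:R `^ (p1.+2%:R / 2))^-1 * swap_term i.
Proof.
pose E m := (\int[P]_w F (hybrid m w))%R.
have -> : (\int[P]_w F (fun j => W j w))%R = E 0.
  by apply: eq_Rintegral => w _; congr F; apply/funext => j.
have -> : (\int[P]_w F (fun j => Z j w))%R = E d.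
  by apply: eq_Rintegral => w _; congr F; apply/funext => j; rewrite /hybrid ltn_ord.
have -> : E 0 - E d = \sum_(j < d) (E j - E j.+1).
  rewrite -(big_mkord xpredT (fun j => E j - E j.+1)) -opprB -(telescope_sumr E (leq0n d)).
  by rewrite -sumrN; apply: eq_bigr => j _; rewrite opprB.
apply: le_trans (ler_norm_sum _ _ _) _; rewrite mulr_sumr; apply: ler_sum => j _.
exact: swap_bound.
Qed.
End multi_dim.

Section coordinates.
Context {R : realType} {d : nat}.

Definition rowf (v : 'I_d -> R) : 'rV[R]_d := \row_k v k.

Lemma rowf_upd (v : 'I_d -> R) j s t :
  rowf (upd v j (s + t)) = s *: basis_vec R j + rowf (upd v j t).
Proof.
apply/rowP => k; rewrite !mxE eqxx /= /upd.
by case: (eqVneq k j) => _; rewrite ?mulr1 // mulr0 add0r.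
Qed.

Lemma is_derive_coord (f : 'rV[R]_d -> R) v j (t : R) :
  derivable f (rowf (upd v j t)) (basis_vec R j) ->
  is_derive t (1 : R) (fun t => f (rowf (upd v j t)))
    ('D_(basis_vec R j) f (rowf (upd v j t))).
Proof.
have e : (fun h : R => h^-1 *: (f (rowf (upd v j (h *: (1 : R) + t))) - f (rowf (upd v j t)))) =
    (fun h => h^-1 *: (f (h *: basis_vec R j + rowf (upd v j t)) - f (rowf (upd v j t)))).
  by apply/funext => h; rewrite [h *: _]mulr1 rowf_upd.
move=> df; split; first by rewrite /derivable e.
by rewrite /derive e.
Qed.

End coordinates.

(** * Derivatives and growth of the composition of a mollified h with g *)

Section composition.
Context {R : realType} (d p1 : nat).
Variables (A B : R) (r : 'I_d -> R) (g : 'rV[R]_d -> R).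
Hypotheses (A0 : 0 <= A) (B0 : 0 <= B) (r0 : forall k, 0 <= r k).
Hypothesis gP : C_P p1.+1 (growth A B r) g.

Let P := growth A B r.
Let P0 w : 0 <= P w.
Proof.
rewrite addr_ge0 // mulr_ge0 // sumr_ge0 // => k _; exact: powR_ge0.
Qed.

Let G v j k t := iter_partial (nseq k j) g (rowf (upd v j t)).

Let dG v j k (t : R) : (k < p1.+1)%N ->
  is_derive t (1 : R) (G v j k) (G v j k.+1 t).
Proof.
by move=> kp; apply: is_derive_coord; apply: gP.1; rewrite size_nseq.
Qed.

(** This is the purpose of the exponent n/k in [C_P]: the derivative of order k is at most Q^k for
    the single number Q = P^(1/p), the form in which Faa di Bruno's formula adds up the orders. *)
Let G_bound v j k t : (0 < k <= p1.+1)%N ->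
  `|G v j k t| <= (P (rowf (upd v j t)) `^ (p1.+1%:R^-1)) ^+ k.
Proof.
move=> /andP[k0 kp]; have := gP.2 (nseq k j) (rowf (upd v j t)).
rewrite size_nseq k0 kp -/(G v j k t) -/P => /(_ isT) h.
have k0' : (k%:R : R) != 0 by rewrite pnatr_eq0 -lt0n.
have pk : (p1.+1%:R : R) / k%:R * (k%:R / p1.+1%:R) = 1.
  by rewrite mulrA divfK // divff ?pnatr_eq0.
have e (a : R) : 0 <= a -> a = (a `^ (p1.+1%:R / k%:R)) `^ (k%:R / p1.+1%:R).
  by move=> a0; rewrite -powRrM pk powRr1.
move: (`|_|) (normr_ge0 (G v j k t)) (P _) (P0 (rowf (upd v j t))) h => a a0 b b0 h.
have e2 : (b `^ p1.+1%:R^-1) ^+ k = b `^ (k%:R / p1.+1%:R).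
  by rewrite -powR_mulrn ?powR_ge0 // -powRrM mulrC.
rewrite e2; apply: (@le_trans _ _ ((a `^ (p1.+1%:R / k%:R)) `^ (k%:R / p1.+1%:R))).
  by rewrite -(e a a0).
apply: ge0_ler_powR => //.
by rewrite nnegrE powR_ge0.
Qed.

Let G1_bound v j t : `|G v j 1 t| <= 1 + P (rowf (upd v j t)).
Proof.
have [h|h] := leP `|G v j 1 t| 1; first by apply: le_trans h _; rewrite lerDl.
have := gP.2 [:: j] (rowf (upd v j t)) isT.
rewrite /= divr1 powR_mulrn // => h2; apply: le_trans (_ : _ <= P (rowf (upd v j t))) _.
  by apply: le_trans h2; rewrite -[leLHS]expr1 ler_weXn2l // ltW.
by rewrite lerDr.
Qed.

Variables (H : nat -> R -> R) (K : nat -> R).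
Hypothesis K0 : forall k, (0 < k <= p1.+1)%N -> 0 <= K k.
Hypothesis dH : forall k (x : R), (k < p1.+1)%N -> is_derive x (1 : R) (H k) (H k.+1 x).
Hypothesis HK : forall k x, (0 < k <= p1.+1)%N -> `|H k x| <= K k.

Definition composite (v : 'I_d -> R) : R := H 0 (g (rowf v)).

Lemma composite_deriv v j : exists Psi : nat -> R -> R,
  [/\ Psi 0 = (fun t => composite (upd v j t)),
      forall k (x : R), (k < p1.+1)%N -> is_derive x (1 : R) (Psi k) (Psi k.+1 x) &
      forall x, `|Psi p1.+1 x| <= (\sum_(1 <= k < p1.+2) (stirling2 p1.+1 k)%:R * K k) *
        (A + B * \sum_k `|upd v j x k| `^ r k)].
Proof.
exists (fun k x => \sum_(t <- faa_terms k) H t.1 (G v j 0 x) * \prod_(i <- t.2) G v j i x).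
split.
- apply/funext => x; rewrite /= big_seq1 /= big_nil mulr1 //.
- move=> k x kp; apply: faa_di_bruno kp => // i y ip; exact: dG.
move=> x; have PE : P (rowf (upd v j x)) = A + B * \sum_k `|upd v j x k| `^ r k.
  by rewrite /P /growth; congr (_ + _ * _); apply: eq_bigr => k _; rewrite mxE.
have := @faa_di_bruno_bound R p1.+1 H (G v j) K (P (rowf (upd v j x)) `^ (p1.+1%:R^-1)) x isT
  (powR_ge0 _ _) (fun k y kp => HK y kp) (fun k kp => G_bound v j x kp).
rewrite -[X in _ * X]powR_mulrn ?powR_ge0 // -powRrM mulVf ?pnatr_eq0 // powRr1 // PE.
exact.
Qed.

(** [H 0] has Lipschitz constant [K 1], and |dg/dw_j| <= 1 + P; the coordinates are carried from 0
    to v one at a time by the mean value theorem. *)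
Lemma composite_growth (rho : R) : (0 < d)%N -> 0 <= rho -> (forall k, r k <= rho) ->
  exists2 C, 0 <= C & forall v, `|composite v| <= C * \sum_k gam (rho + 1) (v k).
Proof.
move=> d0 rho0 rrho.
pose Gam (v : 'I_d -> R) := \sum_k gam (rho + 1) (v k).
have rho10 : 0 <= rho + 1 by rewrite addr_ge0.
have gam_Gam v k : gam (rho + 1) (v k) <= Gam v.
  by rewrite /Gam (bigD1 k) //= lerDl sumr_ge0 // => i _; exact: gam_ge0.
have Gam1 v : 1 <= Gam v.
  by apply: le_trans (gam_Gam v (Ordinal d0)); exact: gam_ge1.
have K10 : 0 <= K 1 by exact: K0.
(* 1 and A account for the constants; each of the d products of |v_k| and |v_l|^(r_l) is at most
   twice the total weight. *)
pose D := 1 + A + B * (\sum_(k < d) 2).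
have D0 : 0 <= D by rewrite !addr_ge0 // mulr_ge0 // sumr_ge0.
pose PA (v : 'I_d -> R) : R := A + B * \sum_k `|v k| `^ r k.
have slope (v : 'I_d -> R) k : `|v k| * (1 + PA v) <= D * Gam v.
  have vG : `|v k| <= Gam v.
    apply: le_trans (gam_Gam v k); apply: le_trans (norm_le_gam _) _.
    by apply: gam_le; rewrite lerDr.
  rewrite /D /PA mulrDr mulr1 !mulrDl mul1r -addrA lerD // mulrDr lerD //.
    by rewrite mulrC ler_wpM2l.
  rewrite mulrCA -mulrA ler_wpM2l // mulr_sumr mulr_suml; apply: ler_sum => l _.
  apply: (@le_trans _ _ (gam 1 (v k) * gam rho (v l))).
    rewrite ler_pM ?powR_ge0 ?norm_le_gam //.
    by apply: le_trans (powR_le_gam _ (r0 l)) _; exact: gam_le.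
  apply: le_trans (gam_mul_le _ _ rho0) _.
  by rewrite mulr_natl mulr2n lerD.
pose cut m (v : 'I_d -> R) : 'I_d -> R := fun k => if (k < m)%N then v k else 0.
have step v (j : 'I_d) : `|composite (cut j.+1 v) - composite (cut j v)| <= K 1 * D * Gam v.
  have e1 : cut j.+1 v = upd (cut j v) j (v j).
    apply/funext => k; rewrite /upd /cut ltnS leq_eqVlt.
    by case: (eqVneq k j) => [->|kj]; [rewrite eqxx|rewrite -[_ == j :> nat]/(k == j) (negbTE kj)].
  have e0 : cut j v = upd (cut j v) j 0.
    by apply/funext => k; rewrite /upd /cut; case: (eqVneq k j) => [->|//]; rewrite ltnn.
  have dF (t : R) : is_derive t (1 : R) (fun t => composite (upd (cut j v) j t))
      (H 1 (G (cut j v) j 0 t) * G (cut j v) j 1 t).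
    have h1 : is_derive (G (cut j v) j 0 t) (1 : R) (H 0) (H 1 (G (cut j v) j 0 t)) by exact: dH.
    have h2 : is_derive t (1 : R) (G (cut j v) j 0) (G (cut j v) j 1 t) by exact: dG.
    exact: is_derive_comp h1 h2.
  have [c /andP[c1 c2]] := is_derive_mvt 0 (v j) dF.
  rewrite -e1 -e0 subr0 => ->.
  have cv : `|c| <= `|v j|.
    move: c1 c2; rewrite ge_min le_max ler_norml.
    have [x0|/ltW x0] := leP 0 (v j).
      by rewrite (ger0_norm x0); move=> /orP[] h1 /orP[] h2; apply/andP; split; lra.
    by rewrite (ler0_norm x0); move=> /orP[] h1 /orP[] h2; apply/andP; split; lra.
  rewrite !normrM -!mulrA ler_pM ?mulr_ge0 ?HK //.
  apply: le_trans (slope v j); rewrite mulrC ler_wpM2l //.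
  apply: le_trans (G1_bound _ _ _) _; rewrite lerD2l /P /growth /PA lerD2l ler_wpM2l //.
  apply: ler_sum => k _; rewrite mxE /upd /cut ge0_ler_powR ?nnegrE //.
  by case: (eqVneq k j) => [->|_] //; case: ifP; rewrite ?normr0.
exists (`|composite (cut 0 (fun=> 0))| + K 1 * D * d%:R).
  by rewrite addr_ge0 // mulr_ge0 // mulr_ge0.
move=> v; rewrite -/(Gam v).
have -> : composite v = composite (cut 0 (fun=> 0)) +
    \sum_(j < d) (composite (cut j.+1 v) - composite (cut j v)).
  rewrite -(big_mkord xpredT (fun j => composite (cut j.+1 v) - composite (cut j v))).
  rewrite (telescope_sumr (fun j => composite (cut j v)) (leq0n d)).
  have -> : cut d v = v by apply/funext => k; rewrite /cut ltn_ord.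
  by rewrite addrC subrK.
apply: le_trans (ler_normD _ _) _; rewrite mulrDl lerD ?ler_peMr //.
apply: le_trans (ler_norm_sum _ _ _) _.
apply: (@le_trans _ _ (\sum_(j < d) K 1 * D * Gam v)).
  by apply: ler_sum => j _; exact: step.
by rewrite sumr_const card_ord -mulr_natr le_eqVlt; apply/orP; left; apply/eqP; ring.
Qed.

End composition.

(** * The comparison of expectations *)

Section transfer.
Context {R : realType} {dT dU : measure_display} {T : measurableType dT}
  {U : measurableType dU}.
Variables (Pr : probability T R) (Qr : probability U R).
Local Notation Om := (Pr \x Qr)%E.
Local Notation N := (gaussian R).

Lemma Rintegral_fst (f : T -> R) : measurable_fun setT f ->
  (\int[Om]_w f w.1 = \int[Pr]_x f x)%R.
Proof.
move=> mf; exact: (@same_law_Rintegral R _ _ _ _ _ _ Om Pr fst id measurable_fst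
  (@measurable_id _ _ _) (same_law_fst Pr Qr) f mf).
Qed.

Lemma Rintegral_snd (f : U -> R) : measurable_fun setT f ->
  (\int[Om]_w f w.2 = \int[Qr]_y f y)%R.
Proof.
move=> mf; exact: (@same_law_Rintegral R _ _ _ _ _ _ Om Qr snd id measurable_snd
  (@measurable_id _ _ _) (same_law_snd Pr Qr) f mf).
Qed.

Lemma integrable_fst (f : T -> R) : measurable_fun setT f ->
  (Om.-integrable setT (fun w => (f w.1)%:E) <-> Pr.-integrable setT (EFin \o f)).
Proof.
move=> mf; have law' : same_law Pr Om id fst.
  by move=> E mE; rewrite (same_law_fst Pr Qr mE).
have mE : measurable_fun setT (EFin \o f) by exact/measurable_EFinP.
split.
  exact: (@same_law_integrable R _ _ _ _ _ _ Om Pr fst id measurable_fst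
    (@measurable_id _ _ _) (same_law_fst Pr Qr) (EFin \o f) mE).
exact: (@same_law_integrable R _ _ _ _ _ _ Pr Om id fst (@measurable_id _ _ _)
  measurable_fst law' (EFin \o f) mE).
Qed.

Lemma integrable_snd (f : U -> R) : measurable_fun setT f ->
  (Om.-integrable setT (fun w => (f w.2)%:E) -> Qr.-integrable setT (EFin \o f)).
Proof.
move=> mf; have mE : measurable_fun setT (EFin \o f) by exact/measurable_EFinP.
exact: (@same_law_integrable R _ _ _ _ _ _ Om Qr snd id measurable_snd
    (@measurable_id _ _ _) (same_law_snd Pr Qr) (EFin \o f) mE).
Qed.

Variables (d p1 : nat) (n : 'I_d -> nat) (A B : R) (r : 'I_d -> R) (g : 'rV[R]_d -> R).
Variables (X : forall j : 'I_d, 'I_(n j) -> {RV Pr >-> R}) (Zv : 'I_d -> {RV Qr >-> R}).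
Arguments X : clear implicits.
Variables (h : R -> R) (rho : R).
Hypotheses (d0 : (0 < d)%N) (p10 : (0 < p1)%N) (n0 : forall j, (0 < n j)%N).
Hypotheses (A0 : 0 <= A) (B0 : 0 <= B) (r0 : forall k, 0 <= r k).
Hypotheses (rho0 : 0 <= rho) (rrho : forall k, r k <= rho).
Hypotheses (gP : C_P p1.+1 (growth A B r) g) (hC : C_b p1.+1 h).
Hypotheses (indepX : mutually_independent (flat_array X)) (normZ : std_normal_vec Zv).
Hypothesis mX : forall j i k, (k <= p1.+1)%N ->
  (\int[Pr]_x (X j i x ^+ k) = \int[N]_z (z ^+ k))%R.
Hypothesis iX : forall j i, Pr.-integrable setT (EFin \o (gam (p1.+2%:R + rho) \o X j i)).

Let Y := joint (flat_array X) Zv.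
Let Kp := fine (h_norm p1.+1 h).

Let mXi j i : measurable_fun setT (X j i). Proof. exact: measurable_funPT. Qed.
Let mZ j : measurable_fun setT (Zv j). Proof. exact: measurable_funPT. Qed.

Let mW k : measurable_fun setT (fun x => std_sum X x 0 k).
Proof.
under eq_fun do rewrite mxE.
by apply: measurable_funM => //; exact: measurable_sum_cond.
Qed.

Definition entry_term (j : 'I_d) (i : 'I_(n j)) : R :=
  let M := (\int[Pr]_x (`|X j i x| ^+ p1.+2))%R in
  A * M + B * \sum_k 2 `^ r k * (2 `^ r k * M * (\int[Pr]_x (`|std_sum X x 0 k| `^ r k))%R +
    (if k == j then 2 `^ r k / (n k)%:R `^ (r k / 2) *
       (\int[Pr]_x (`|X j i x| `^ (p1.+2%:R + r k)))%R else 0) +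
    (\int[N]_z (`|z| `^ (r k + 1)))%R * M).

Let swap_termE j i : swap_term Y p1 r A B i = @entry_term j i.
Proof.
have mpow (f : T -> R) e : measurable_fun setT f -> measurable_fun setT (fun x => `|f x| `^ e).
  move=> mf; apply: (measurableT_comp (measurable_powR e)); exact: measurableT_comp.
rewrite /swap_term /entry_term.
have -> : (\int[Om]_x (`|entry Y i x| ^+ p1.+2))%R = (\int[Pr]_x (`|X j i x| ^+ p1.+2))%R.
  apply: (Rintegral_fst (f := fun x => `|X j i x| ^+ p1.+2)).
  by apply: measurable_funX; exact: measurableT_comp.
congr (_ + _ * _); apply: eq_bigr => k _; congr (_ * (_ * _ + _ + _)).
  rewrite -(Rintegral_fst (mpow _ (r k) (mW k))).
  by apply: eq_Rintegral => w _; rewrite mxE.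
case: ifP => // _; congr (_ * _).
exact: (Rintegral_fst (mpow _ _ (mXi i))).
Qed.

Let ch : continuous h.
Proof.
have [dh _ _] := hC => x; apply/differentiable_continuous/derivable1_diffP.
exact: (dh 0 x p10).
Qed.

Let F (v : 'I_d -> R) : R := h (g (rowf v)).

Let F_cont v j : continuous (fun t => F (upd v j t)).
Proof.
move=> t; apply: (@cvg_comp _ _ _ (fun t => g (rowf (upd v j t))) h); last exact: ch.
apply: (@is_derive_continuous R _ (fun t => 'D_(basis_vec R j) g (rowf (upd v j t)))).
by apply: is_derive_coord; exact: (gP.1 [::]).
Qed.

Let std_sumE x : h (g (std_sum X x)) = F (fun k => std_sum X x 0 k).
Proof. by rewrite /F; congr (h (g _)); apply/rowP => k; rewrite !mxE. Qed.

Lemma measurable_std_sum_comp : measurable_fun setT (fun x => h (g (std_sum X x))).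
Proof.
under eq_fun do rewrite std_sumE.
exact: (@separately_continuous_measurable R d F _ T (fun k x => std_sum X x 0 k) F_cont).
Qed.

Lemma measurable_rand_vec_comp : measurable_fun setT (fun y => h (g (rand_vec Zv y))).
Proof. exact: (@separately_continuous_measurable R d F _ U Zv F_cont). Qed.

Let h_normE (K : nat -> R) :
  (forall k, (0 < k <= p1.+1)%N -> deriv_norm p1.+1 h k = (K k)%:E /\ 0 <= K k) ->
  h_norm p1.+1 h = (\sum_(1 <= k < p1.+2) (stirling2 p1.+1 k)%:R * K k)%:E.
Proof.
move=> hK; rewrite /h_norm -sumEFin !big_nat; apply: eq_bigr => k kp.
by rewrite (hK k kp).1 EFinM.
Qed.

Lemma h_norm_fin : h_norm p1.+1 h = Kp%:E /\ 0 <= Kp.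
Proof.
have [K hK _] := C_b_mollify (ltn0Sn p1) hC.
have e := h_normE hK; rewrite /Kp e; split => //=; rewrite big_nat sumr_ge0 // => k kp.
by rewrite mulr_ge0 // (hK k kp).2.
Qed.

(** Mollification changes h uniformly by at most e, while the bound for the mollified function is
    independent of e. The integrability of both composites is recorded too, so that the expectations
    can be read as real numbers. *)
Lemma comparison_real :
  [/\ Pr.-integrable setT (EFin \o (fun x => h (g (std_sum X x)))),
      Qr.-integrable setT (EFin \o (fun y => h (g (rand_vec Zv y)))) &
  `|(\int[Pr]_x h (g (std_sum X x)))%R - (\int[Qr]_y h (g (rand_vec Zv y)))%R| <=
  p1.+2%:R / p1.+1`!%:R * Kp * \sum_(j < d) \sum_(i < n j)
    ((n j)%:R `^ (p1.+2%:R / 2))^-1 * entry_term i].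
Proof.
have [K hK moll] := C_b_mollify (ltn0Sn p1) hC.
have KpE : Kp = \sum_(1 <= k < p1.+2) (stirling2 p1.+1 k)%:R * K k by rewrite /Kp (h_normE hK).
have [_ Kp0] := h_norm_fin.
have K0 k kp := (hK k kp).2.
have indepY : mutually_independent Y := joint_independent indepX normZ.2.
have mXY j (i : 'I_(n j)) k : (k <= p1.+1)%N ->
    (\int[Om]_w (entry Y i w ^+ k) = \int[N]_z (z ^+ k))%R.
  move=> kp; rewrite -(mX i kp).
  by apply: (Rintegral_fst (f := fun x => X j i x ^+ k)); exact: measurable_funX.
have iXY j (i : 'I_(n j)) : Om.-integrable setT (EFin \o (gam (p1.+2%:R + rho) \o entry Y i)).
  have mg : measurable_fun setT (gam (p1.+2%:R + rho) \o X j i).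
    exact: measurableT_comp (measurable_gam _) (mXi i).
  exact: ((integrable_fst mg).2 (iX i)).
have lawZ j : same_law Om N (limit_entry Y j) id.
  move=> E mE; transitivity (Qr (Zv j @^-1` E)); last exact: (normZ.1 j E mE).
  exact: (same_law_snd Pr Qr (measurable_preimage_RV (Zv j) mE)).
have eW (G : ('I_d -> R) -> R) w :
    G (fun j => col_sum (@entry _ _ _ _ _ _ Y j) w) = G (fun k => std_sum X w.1 0 k).
  by congr G; apply/funext => k; rewrite mxE.
have eZ (G : ('I_d -> R) -> R) w :
    G (fun j => limit_entry Y j w) = G (fun k => Zv k w.2) by [].
(* Each of the two expectations moves by at most e when h is mollified. *)
have key e : 0 < e ->
  [/\ Om.-integrable setT (fun w => (F (fun k => std_sum X w.1 0 k))%:E),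
      Om.-integrable setT (fun w => (F (fun k => Zv k w.2))%:E) &
  `|(\int[Om]_w F (fun k => std_sum X w.1 0 k))%R - (\int[Om]_w F (fun k => Zv k w.2))%R| <=
   p1.+2%:R / p1.+1`!%:R * Kp * (\sum_(j < d) \sum_(i < n j)
    ((n j)%:R `^ (p1.+2%:R / 2))^-1 * entry_term i) + (e + e)].
  move=> e0; have [H [He dH HK]] := moll e e0.
  pose FH := composite g H.
  have FHe v : `|F v - FH v| <= e by rewrite distrC; exact: He.
  have cd v j : exists Psi : nat -> R -> R,
    [/\ Psi 0 = (fun t => FH (upd v j t)),
      forall k (x : R), (k < p1.+1)%N -> is_derive x (1 : R) (Psi k) (Psi k.+1 x) &
      forall x, `|Psi p1.+1 x| <= Kp * (A + B * \sum_k `|upd v j x k| `^ r k)].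
    by rewrite KpE; exact: (composite_deriv A0 B0 gP dH HK v j).
  have [C C0 FC] := composite_growth A0 B0 r0 gP K0 dH HK d0 rho0 rrho.
  have ih m := @integrable_hybrid R _ _ Om d n Y p1 r rho A B Kp C FH n0 rho0
    iXY lawZ cd FC m.
  have md := @multi_dim R _ _ Om d n Y p1 r rho A B Kp C FH indepY n0 p10 r0 rrho
    rho0 A0 B0 Kp0 C0 mXY iXY lawZ cd FC.
  have iFHW : Om.-integrable setT (fun w => (FH (fun k => std_sum X w.1 0 k))%:E).
    apply: eq_integrable (ih 0) => // w _ /=; congr EFin; rewrite -eW.
    by congr FH; apply/funext.
  have iFHZ : Om.-integrable setT (fun w => (FH (fun k => Zv k w.2))%:E).
    apply: eq_integrable (ih d) => // w _ /=; congr EFin; rewrite -eZ.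
    by congr FH; apply/funext => k; rewrite /hybrid ltn_ord.
  have ie := integrable_cst_prob Om e.
  have close (V : T * U -> 'I_d -> R) : measurable_fun setT (fun w => F (V w)) ->
      Om.-integrable setT (fun w => (FH (V w))%:E) ->
      Om.-integrable setT (fun w => (F (V w))%:E) /\
      `|(\int[Om]_w F (V w))%R - (\int[Om]_w FH (V w))%R| <= e.
    move=> mF iFH.
    have iF : Om.-integrable setT (EFin \o (fun w => F (V w))).
      apply: integrable_dominated (integrable_add (integrable_norm iFH) ie) _ => //.
      move=> w; have := FHe (V w); have := ler_normD (F (V w) - FH (V w)) (FH (V w)).
      by rewrite subrK /cst /=; lra.
    split => //; rewrite -(RintegralB measurableT iF iFH).
    have iD := integrable_sub iF iFH.
    apply: le_trans (le_normr_Rintegral measurableT iD) _.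
    rewrite -[leRHS](Rintegral_cst_prob Om); apply: le_Rintegral => //.
    exact: integrable_norm.
  have mFW : measurable_fun setT (fun w : T * U => F (fun k => std_sum X w.1 0 k)).
    under eq_fun do rewrite -std_sumE.
    exact: measurableT_comp measurable_std_sum_comp measurable_fst.
  have mFZ : measurable_fun setT (fun w : T * U => F (fun k => Zv k w.2)).
    exact: measurableT_comp measurable_rand_vec_comp measurable_snd.
  have [iFW cW] := close _ mFW iFHW; have [iFZ cZ] := close _ mFZ iFHZ.
  split => //.
  have e1 : (\int[Om]_w FH (fun j => col_sum (@entry _ _ _ _ _ _ Y j) w))%R =
      (\int[Om]_w FH (fun k => std_sum X w.1 0 k))%R.
    by apply: eq_Rintegral => w _; exact: eW.
  have {md} : `|(\int[Om]_w FH (fun k => std_sum X w.1 0 k))%R -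
      (\int[Om]_w FH (fun k => Zv k w.2))%R| <=
    p1.+2%:R / p1.+1`!%:R * Kp * (\sum_(j < d) \sum_(i < n j)
      ((n j)%:R `^ (p1.+2%:R / 2))^-1 * entry_term i).
    rewrite -e1; apply: le_trans md _; rewrite le_eqVlt; apply/orP; left; apply/eqP.
    congr (_ * _); apply: eq_bigr => j _; apply: eq_bigr => i _; congr (_ * _).
    exact: swap_termE.
  move: cW cZ; rewrite [`|_ - \int[Om]_w FH (fun k => Zv k w.2)|]distrC !ler_norml.
  set a := (\int[_]_w _)%R; set a' := (\int[_]_w _)%R; set b := (\int[_]_w _)%R.
  set b' := (\int[_]_w _)%R; set L := _ * _.
  by move=> /andP[? ?] /andP[? ?] /andP[? ?]; apply/andP; split; lra.
(* Integrability follows from the comparison at any accuracy. *)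
have [iFW iFZ _] := key 1 ltr01.
have e1 : (fun x => h (g (std_sum X x))) = (fun x => F (fun k => std_sum X x 0 k)).
  by apply/funext => x; exact: std_sumE.
have mS := measurable_std_sum_comp; have mR := measurable_rand_vec_comp.
rewrite e1 in mS *; split.
- exact/(integrable_fst mS).
- exact: (integrable_snd mR iFZ).
apply/ler_addgt0Pr => e e0; have e20 : 0 < e / 2 by rewrite divr_gt0.
have [_ _] := key _ e20; rewrite -splitr; move=> /(le_trans _); apply.
by rewrite -(Rintegral_fst mS) -(Rintegral_snd mR).
Qed.

End transfer.

Lemma exists_max_ord {R : realType} (d : nat) (r : 'I_d -> R) : (0 < d)%N ->
  exists j, forall k, r k <= r j.
Proof.
move=> d0; have [j _ jmax] := @Order.TotalTheory.arg_maxP _ _ _ (Ordinal d0) xpredT r isT.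
by exists j => k; exact: jmax.
Qed.

Lemma expectation_Rintegral {R : realType} {d : measure_display} {T : measurableType d}
    (P : probability T R) (f : T -> R) : P.-integrable setT (EFin \o f) ->
  ('E_P[f] = (\int[P]_x f x)%R%:E)%E.
Proof. by move=> fi; rewrite unlock integral_EFin_Rintegral. Qed.

Lemma integrable_gam_moment {R : realType} {d : measure_display} {T : measurableType d}
    (P : probability T R) (f : T -> R) (q : R) : 0 <= q -> measurable_fun setT f ->
  ('E_P[fun x => (`|f x| `^ q)%R] < +oo)%E -> P.-integrable setT (EFin \o (gam q \o f)).
Proof.
move=> q0 mf; rewrite unlock => fq.
have mp : measurable_fun setT (fun x => `|f x| `^ q).
  by apply: (measurableT_comp (measurable_powR q)); exact: measurableT_comp.
have ip : P.-integrable setT (EFin \o (fun x => `|f x| `^ q)).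
  apply/integrableP; split; first exact/measurable_EFinP.
  apply: le_lt_trans fq; rewrite le_eqVlt; apply/orP; left; apply/eqP.
  by apply: eq_integral => x _ /=; rewrite ger0_norm ?powR_ge0.
apply: integrable_dominated
  (integrable_scale (2 `^ q) (integrable_add (integrable_cst_prob P 1) ip)) _.
  exact: measurableT_comp (measurable_gam q) mf.
by move=> x /=; rewrite ger0_norm ?gam_ge0 // gam_le_powR.
Qed.

Theorem theorem3p2 (R : realType) (d p : nat) (n : 'I_d -> nat)
    (hd : (1 <= d)%N) (hp : (2 <= p)%N) (hn : forall j, (1 <= n j)%N)
    (A B : R) (r : 'I_d -> R)
    (hA : 0 <= A) (hB : 0 <= B) (hr : forall k, 0 <= r k)
    (g : 'rV[R]_d -> R) (hg : C_P p (growth A B r) g)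
    (dT : measure_display) (T : measurableType dT) (Pr : probability T R)
    (dU : measure_display) (U : measurableType dU) (Qr : probability U R)
    (X : forall j : 'I_d, 'I_(n j) -> {RV Pr >-> R})
    (Z : {RV Qr >-> R}) (Zv : 'I_d -> {RV Qr >-> R})
    (hX : mutually_independent (flat_array X))
    (hZ : std_normal Z) (hZv : std_normal_vec Zv)
    (hmatch : forall (j : 'I_d) (i : 'I_(n j)) (k : nat), (1 <= k <= p)%N ->
      ('E_Pr[fun x => (X j i x ^+ k)%R] = 'E_Qr[fun y => (Z y ^+ k)%R])%E)
    (hmom : forall (j : 'I_d) (i : 'I_(n j)) (l : 'I_d),
      ('E_Pr[fun x => (`|X j i x| `^ (r l + p%:R + 1))%R] < +oo)%E)
    (h : R -> R) (hh : C_b p h) :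
  (`| 'E_Pr[fun x => h (g (std_sum X x))]
      - 'E_Qr[fun y => h (g (rand_vec Zv y))] |
   <= (p.+1%:R / p`!%:R)%:E * h_norm p h *
      \sum_(j < d) \sum_(i < n j)
        (((n j)%:R `^ ((p%:R + 1) / 2))^-1)%:E *
        (A%:E * 'E_Pr[fun x => (`|X j i x| ^+ p.+1)%R] +
         B%:E * \sum_(k < d) (2 `^ r k)%:E *
           ((2 `^ r k)%:E * 'E_Pr[fun x => (`|X j i x| ^+ p.+1)%R]
              * 'E_Pr[fun x => (`|std_sum X x 0 k| `^ r k)%R]
            + (if insub (val i) is Some i' then
                 (2 `^ r k / (n k)%:R `^ (r k / 2))%:E
                 * 'E_Pr[fun x =>
                     (`|X j i x ^+ p.+1 * `|X k i' x| `^ r k|)%R]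
               else 0)
            + 'E_Qr[fun y => (`|Z y| `^ (r k + 1))%R]
              * 'E_Pr[fun x => (`|X j i x| ^+ p.+1)%R])))%E.
Proof.
case: p hp hg hmatch hmom hh => [//|p1] hp hg hmatch hmom hh.
have p10 : (0 < p1)%N by [].
(* The moment of order p + 1 + max r_k dominates all the moments of the X_ij in the argument. *)
have [j0 rmax] := exists_max_ord r hd.
set rho := r j0 in rmax.
have rho0 : 0 <= rho by exact: hr.
have lawZ : same_law Qr (gaussian R) Z id by move=> E mE; exact: (hZ E mE).
have pE (a : R) : a + p1.+1%:R + 1 = p1.+2%:R + a by rewrite -addrA natr1 addrC.
have mXi j i : measurable_fun setT (X j i) by exact: measurable_funPT.
have iX j i : Pr.-integrable setT (EFin \o (gam (p1.+2%:R + rho) \o X j i)).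
  apply: integrable_gam_moment => //; first by rewrite addr_ge0.
  by rewrite -pE; exact: hmom.
have iXn j i (e : R) : 0 <= e <= p1.+2%:R + rho ->
    Pr.-integrable setT (EFin \o (fun x => `|X j i x| `^ e)).
  move=> /andP[e0 ee]; apply: integrable_dominated (iX j i) _.
    by apply: (measurableT_comp (measurable_powR e)); exact: measurableT_comp.
  by move=> x; rewrite ger0_norm ?powR_ge0 // (le_trans (powR_le_gam _ e0)) // gam_le.
have iXk j i k : (k <= p1.+2)%N -> Pr.-integrable setT (EFin \o (fun x => X j i x ^+ k)).
  move=> kp; apply: integrable_dominated (iX j i) _; first exact: measurable_funX.
  move=> x; rewrite normrX (le_trans (exprn_le_gam _ _)) // gam_le //.
  by rewrite ler_wpDr // ler_nat.
have mX j i k : (k <= p1.+1)%N ->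
    (\int[Pr]_x (X j i x ^+ k) = \int[gaussian R]_z (z ^+ k))%R.
  move=> kp.
  have -> : (\int[gaussian R]_z (z ^+ k))%R = (\int[Qr]_y (Z y ^+ k))%R.
    apply/esym; exact: (@same_law_Rintegral R _ _ _ _ _ _ Qr (gaussian R) Z id
      (@measurable_funPT _ _ _ _ Z) (@measurable_id _ _ _) lawZ (fun z => z ^+ k)
      (measurable_funX k (@measurable_id _ _ _))).
  (* The moments are matched from k = 1 on; for k = 0 both sides are 1. *)
  case: k kp => [|k] kp.
    by rewrite (Rintegral_cst_prob Pr 1) (Rintegral_cst_prob Qr 1).
  by have := hmatch j i k.+1 kp; rewrite unlock /Rintegral => ->.
have [iW iZ main] := comparison_real hd p10 hn hA hB hr rho0 rmax hg hh hX hZv mX iX.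
have [hn_fin Kp0] := h_norm_fin hh.
rewrite (expectation_Rintegral iW) (expectation_Rintegral iZ) -EFinB abse_EFin.
apply: le_trans (_ : _ <= (_)%:E)%E _; first by rewrite lee_fin; exact: main.
rewrite hn_fin EFinM [(_ / _ * fine _)%:E]EFinM; apply: lee_wpmul2l.
  by rewrite mule_ge0 // lee_fin // divr_ge0.
rewrite -sumEFin; apply: lee_sum => j _; rewrite -sumEFin; apply: lee_sum => i _.
rewrite natr1 EFinM; apply: lee_wpmul2l; first by rewrite lee_fin invr_ge0 powR_ge0.
have iM : Pr.-integrable setT (EFin \o (fun x => `|X j i x| ^+ p1.+2)).
  have := iXn j i p1.+2%:R; rewrite ler0n lerDl rho0 => /(_ isT).
  by apply: eq_integrable => // x _ /=; rewrite powR_mulrn.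
rewrite (expectation_Rintegral iM) /entry_term.
set M := (\int[Pr]_x _)%R.
rewrite EFinD !EFinM; apply: leeD => //; apply: lee_wpmul2l; first by rewrite lee_fin.
rewrite -sumEFin; apply: lee_sum => k _; rewrite EFinM; apply: lee_wpmul2l.
  by rewrite lee_fin powR_ge0.
have mpow (e : R) : measurable_fun setT (fun z : R => `|z| `^ e).
  by apply: (measurableT_comp (measurable_powR e)); exact: normr_measurable.
have rrho : r k <= p1.+2%:R + rho by rewrite ler_wpDl.
have iWk : Pr.-integrable setT (EFin \o (fun x => `|std_sum X x 0 k| `^ r k)).
  have -> : (fun x => `|std_sum X x 0 k| `^ r k) = (fun x => `|col_sum (@X k) x| `^ r k).
    by apply/funext => x; rewrite mxE.
  apply: integrable_dominated (@integrable_gam_col_sum R _ T Pr (n k) (@X k) (hn k)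
    p1 rho rho0 (@iX k)) _.
    apply: measurableT_comp (mpow (r k)) _; apply: measurable_funM => //.
    exact: measurable_sum_cond.
  move=> x; rewrite ger0_norm ?powR_ge0 // (le_trans (powR_le_gam _ (hr k))) //.
  exact: gam_le.
have mZ : measurable_fun setT Z by exact: measurable_funPT.
have iZk : Qr.-integrable setT (EFin \o (fun y => `|Z y| `^ (r k + 1))).
  have law' : same_law (gaussian R) Qr id Z by move=> E mE; rewrite lawZ.
  have mE : measurable_fun setT (EFin \o (fun z : R => `|z| `^ (r k + 1))).
    by apply/measurable_EFinP; exact: mpow.
  exact: (@same_law_integrable R _ _ _ _ _ _ (gaussian R) Qr id Z (@measurable_id _ _ _)
    mZ law' _ mE (integrable_powR_gaussian (addr_ge0 (hr k) ler01))).
rewrite (expectation_Rintegral iWk) (expectation_Rintegral iZk).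
have -> : (\int[Qr]_y (`|Z y| `^ (r k + 1)))%R = (\int[gaussian R]_z (`|z| `^ (r k + 1)))%R.
  exact: (@same_law_Rintegral R _ _ _ _ _ _ Qr (gaussian R) Z id mZ
      (@measurable_id _ _ _) lawZ _ (mpow (r k + 1))).
rewrite EFinD [X in (_ + X <= _)%E]EFinM; apply: leeD => //.
rewrite EFinD !EFinM; apply: leeD => //.
(* For k distinct from j the mixed term is compared with 0, whether it is present or omitted. For k
   = j the index found is i itself, and the two powers of |X_ij| merge into one of order p + 1 +
   r_j. *)
have [kj|kj] := eqVneq k j; last first.
  case: insub => [i'|] //; apply: mule_ge0; first by rewrite lee_fin divr_ge0 ?powR_ge0.
  by apply: expectation_ge0 => x.
subst k; rewrite valK EFinM.
have -> : (fun x => `|X j i x ^+ p1.+2 * `|X j i x| `^ r j|) =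
    (fun x => `|X j i x| `^ (p1.+2%:R + r j)).
  apply/funext => x; rewrite normrM normrX (ger0_norm (powR_ge0 _ _)) powRD ?powR_mulrn //.
  by apply/implyP; rewrite gt_eqF // ltr_pwDl.
rewrite expectation_Rintegral //; apply: iXn.
by rewrite addr_ge0 // lerD2l rmax.
Qed.
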